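(* Let $\beta>0$ and let either $0<\alpha<1/2$, or $\alpha=1/2$ and $\beta\ge1/2$. Let $\Omega=[0,\alpha)\cup[\alpha+\beta,1+\beta)\subset\mathbb{R}$ and $g=\chi_\Omega$. Then there exists a discrete countable set $\Lambda\subset\mathbb{R}^2$ such that the Gabor system $\{g_\lambda\}_{\lambda\in\Lambda}$ is an orthonormal basis of $L^2(\mathbb{R})$ if and only if $\Omega$ tiles the real line. This occurs exactly when one of the following conditions holds: (i) $0<\alpha<1/2$ and $\beta\in\mathbb{N}$; (ii) $\alpha=1/2$ and $\beta\in\frac12\mathbb{N}$.
   Context: $\mathbb{N}$ denotes the positive integers. For $\lambda=(t,\nu)\in\mathbb{R}^2$, $g_\lambda(x)=g(x-t)e^{2\pi i x\nu}$. A measurable set $\Omega\subset\mathbb{R}$ tiles the real line if there is a discrete set $T\subset\mathbb{R}$ with $\sum_{t\in T}\chi_\Omega(x-t)=1$ for almost every $x\in\mathbb{R}$. *)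

(* Defs.v *)
From HB Require Import structures.
From mathcomp Require Import all_boot all_order all_algebra.
From mathcomp Require Import all_classical all_reals all_analysis.
From mathcomp Require Import complex.
Import Order.TTheory GRing.Theory Num.Theory.
Import numFieldNormedType.Exports.

Set Implicit Arguments.
Unset Strict Implicit.
Unset Printing Implicit Defensive.

Local Open Scope classical_set_scope.
Local Open Scope ring_scope.

(* Discrete as a subspace: every point of [A] is isolated in [A].  This does
   not require [A] to be closed. *)
Definition discrete_set (T : topologicalType) (A : set T) : Prop :=
  A `<=` isolated A.

Section L2.
Context {R : realType}.
Implicit Types f h : R -> R[i].

(* There is no measurable structure on [R[i]] in the library, so measurability
   and integrals are taken componentwise. *)
Definition cmeasurable f : Prop :=
  measurable_fun setT (fun x => complex.Re (f x)) /\
  measurable_fun setT (fun x => complex.Im (f x)).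

Definition cintegral f : R[i] :=
  (\int[lebesgue_measure]_x complex.Re (f x) +i*
   \int[lebesgue_measure]_x complex.Im (f x))%C.

Definition L2norm f : \bar R :=
  Lnorm lebesgue_measure 2%:E (fun x => (ComplexField.Normc.normc (f x))%:E).

Definition L2 : set (R -> R[i]) :=
  [set f | cmeasurable f /\ (L2norm f < +oo)%E].

Definition L2inner f h : R[i] := cintegral (fun x => f x * (h x)^*%C).

(* Elements of [L2] are functions rather than classes modulo a.e. equality;
   [L2norm] and [L2inner] only depend on the classes.  Completeness is density
   of the linear span. *)
Definition orthonormal_basis (I : choiceType) (A : set I)
    (e : I -> R -> R[i]) : Prop :=
  [/\ forall i, A i -> L2 (e i),
      forall i j, A i -> A j -> L2inner (e i) (e j) = (i == j)%:R
    & forall f, L2 f -> forall eps : R, 0 < eps ->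
        exists (s : seq I) (c : I -> R[i]), [set` s] `<=` A /\
          (L2norm (fun x => f x - \sum_(i <- s) c i * e i x)%R < eps%:E)%E].

End L2.

Section Gabor.
Context {R : realType}.

Definition expi (x : R) : R[i] := (cos x +i* sin x)%C.

Definition time_freq_shift (g : R -> R[i]) (l : R * R) (x : R) : R[i] :=
  g (x - l.1) * expi (2 * pi * x * l.2).

Definition cindic (A : set R) (x : R) : R[i] := (\1_A x)%:C%C.

Definition tiles_line (A : set R) : Prop :=
  exists2 T : set R, discrete_set T &
    {ae lebesgue_measure, forall x : R,
      \esum_(t in T) (\1_A (x - t) : R)%:E = 1%E}.

Definition two_intervals (a b : R) : set R :=
  `[0, a[ `|` `[a + b, 1 + b[.

End Gabor.

(* Main.v *)
(** Let [V s nu] be the Fourier transform at [nu] of the indicator of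
    [Omega `&` (Omega + s)]; up to phases, [<g_l, g_l'> = V (l - l')].

    From a Gabor basis to the arithmetic condition.  Completeness gives
    [\sum_l |V (z - l)|^2 >= 1] for every [z], while [\int |V|^2 <= 1] by
    Plancherel's inequality and Tonelli's theorem.  Integrating over a box
    [A `*` E] whose translates by [-Lambda] are disjoint, one gets
    [|A| |E| <= 1].  By orthogonality the translates are disjoint as soon as
    [V] does not vanish at the non-zero points of [(A - A) `*` (E - E)]; as [V]
    is a sum of at most three explicit sine waves, suitable [A] and [E] of
    product measure greater than 1 exclude every value of [beta] outside the
    two families.

    From a tiling to the arithmetic condition.  One-sided continuity turns the
    almost everywhere tiling into an exact one.  For [alpha = 1 / 2] the left
    ends of all the half-unit cells form a progression of step [1 / 2].  For
    [alpha < 1 / 2] the gap forces [T - beta] into [T], hence unit cells filled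
    by [t] and [t - beta]; by counting, [T] is [beta]-periodic far to the left,
    where it then has step 1.

    Conversely, [Lambda = T `*` S] with [T] tiling.  For (i) take
    [T = S = int].  For (ii), with [m = n + 1], take [T] the half-integers
    [k / 2] with [k %% (2 * m) < m] and [S] the numbers [2 j] and [2 j + 1 / m].
    Completeness over each tile follows from polynomials in a cosine which
    converge to indicators of arcs. *)
Require Import Defs.
From HB Require Import structures.
From mathcomp Require Import all_boot all_order all_algebra.
From mathcomp Require Import all_classical all_reals all_analysis.
From mathcomp Require Import measurable_realfun complex.
From mathcomp Require Import ring lra zify.
Import Order.TTheory GRing.Theory Num.Theory.
Import numFieldNormedType.Exports.

Set Implicit Arguments.
Unset Strict Implicit.
Unset Printing Implicit Defensive.

Local Open Scope classical_set_scope.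
Local Open Scope ring_scope.

(** * Bounded functions with bounded support *)

Section Compact.
Context {R : realType}.
Implicit Types (f h : R -> R) (a b c w q t : R).
Local Notation mu := (@lebesgue_measure R).

(** The two families reflect how sine waves cancel. If [beta >= 1 - alpha], a shift [s >= 0] lets
    the intervals meet themselves or lets the first meet the second, never both. In the ranges of
    frequencies used, a single wave cannot vanish, and two self-overlaps cancel only with equal
    amplitudes and opposite phases. Opposite phases mean that [|nu| * (1 + 2 * beta)] is an odd
    integer; for [alpha < 1 / 2] equal amplitudes mean [|nu| * (1 - 2 * s) = 1] in addition. For
    [alpha = 1 / 2] the amplitudes always agree and only the parity condition is left: there are
    more zeros to avoid, so [E] must be a union of many small intervals, and half-integers survive.

    Inner products are computed only for bounded functions with bounded support, a class that
    contains all Gabor functions and on which the integral is linear. General elements of [L2] enter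
    only through approximation, where the squared norm [energy] suffices. *)

Definition bounded_measurable f : Prop :=
  measurable_fun setT f /\ exists M : R, forall x, `|f x| <= M.

(** The single constant [M] bounds the values and the support at once. Such functions are
    integrable, and stable under sums and under products with bounded measurable functions. *)
Definition bounded_supported f : Prop :=
  measurable_fun setT f /\
  exists M : R, forall x, `|f x| <= M /\ (M < `|x| -> f x = 0).

Lemma bounded_supported_integrable f :
  bounded_supported f -> mu.-integrable setT (EFin \o f).
Proof.
move=> [mf [M fM]].
have -> : EFin \o f = (EFin \o f) \_ `[- M, M]%classic.
  apply/funext => x; rewrite patchE; case: ifPn => // /negP xM /=.
  congr EFin; apply: (fM x).2; rewrite ltNge; apply/negP => xM'; apply: xM.
  by rewrite inE /= in_itv /= -ler_norml.
apply: (iffLR (@integrable_mkcond _ _ R mu `[- M, M]%classic (EFin \o f) (measurable_itv _))).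
apply: measurable_bounded_integrable => //.
- rewrite /= lebesgue_measure_itv /=; case: ifP => // _; by rewrite -EFinD ltry.
- exact: measurable_funTS.
- exists M; split; first exact: num_real.
  by move=> N MN x /= _; apply: (le_trans (fM x).1); exact: ltW.
Qed.

Lemma bounded_supportedD f h :
  bounded_supported f -> bounded_supported h -> bounded_supported (f \+ h).
Proof.
move=> [mf [M fM]] [mh [N hN]]; split; first exact: measurable_funD.
have M0 : 0 <= M by apply: le_trans (fM 0).1.
have N0 : 0 <= N by apply: le_trans (hN 0).1.
exists (M + N) => x; split => [|xMN] /=.
  by rewrite (le_trans (ler_normD _ _))// lerD ?(fM x).1 ?(hN x).1.
rewrite (fM x).2 ?(hN x).2 ?addr0//; apply: le_lt_trans xMN.
  by rewrite lerDr.
by rewrite lerDl.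
Qed.

Lemma bounded_supportedM f h :
  bounded_supported f -> bounded_measurable h -> bounded_supported (f \* h).
Proof.
move=> [mf [M fM]] [mh [N hN]]; split; first exact: measurable_funM.
have M0 : 0 <= M by apply: le_trans (fM 0).1.
have N0 : 0 <= N by apply: le_trans (hN 0).
(* [N + 1] in place of [N] keeps the constant at least [M], beyond which [f] vanishes. *)
exists (M * (N + 1)) => x; split => [|xMN] /=.
  rewrite normrM ler_pM ?(fM x).1// (le_trans (hN x))// lerDl//.
rewrite (fM x).2 ?mul0r//; apply: le_lt_trans xMN.
by rewrite ler_peMr// lerDr.
Qed.

Lemma bounded_supported_bounded f : bounded_supported f -> bounded_measurable f.
Proof. by move=> [mf [M fM]]; split=> //; exists M => x; case: (fM x). Qed.

Lemma bounded_measurable_cst c : bounded_measurable (cst c).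
Proof. by split=> //; exists `|c|. Qed.

Lemma bounded_supportedZ c f :
  bounded_supported f -> bounded_supported (fun x => c * f x).
Proof.
move=> bf; have := bounded_supportedM bf (bounded_measurable_cst c).
by congr bounded_supported; apply/funext => x /=; rewrite mulrC.
Qed.

Lemma bounded_supported0 : bounded_supported (cst 0).
Proof. by split=> //; exists 0 => x; rewrite normr0. Qed.

Lemma bounded_supported_indic (A : set R) (M : R) : measurable A ->
  (forall x, A x -> `|x| <= M) -> bounded_supported (\1_A).
Proof.
move=> mA AM; split; first exact: measurable_indic.
exists (1 + `|M|) => x; rewrite indicE; split.
  by case: (x \in A); rewrite ?normr1 ?normr0 ?lerDl// addr_ge0.
have [|//] := boolP (x \in A); rewrite inE => /AM xM.
by rewrite ltNge (le_trans xM)// (le_trans (ler_norm _))// lerDr.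
Qed.

Lemma measurable_affine w q : measurable_fun setT (fun x : R => w * x + q).
Proof.
by apply: measurable_funD => //; apply: measurable_funM.
Qed.

Lemma bounded_measurable_cos w q : bounded_measurable (fun x => cos (w * x + q)).
Proof.
split; last by exists 1 => x; exact: cos_max.
apply: (measurableT_comp _ (measurable_affine w q)).
exact: continuous_measurable_fun (@continuous_cos R).
Qed.

Lemma bounded_measurable_sin w q : bounded_measurable (fun x => sin (w * x + q)).
Proof.
split; last by exists 1 => x; exact: sin_max.
apply: (measurableT_comp _ (measurable_affine w q)).
exact: continuous_measurable_fun (@continuous_sin R).
Qed.

Lemma measurable_shift t : measurable_fun setT (fun x : R => x + t).
Proof. exact: measurable_funD. Qed.

(** Lebesgue measure is determined by its values on half-open intervals, and a translation keeps
    their lengths. *)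
Lemma lebesgue_measure_shift t (A : set R) : measurable A ->
  mu ((fun x => x + t) @^-1` A) = mu A.
Proof.
move=> mA; apply/esym.
pose m : {measure set (measurableTypeR R) -> \bar R} :=
  @measure_function_pushforward__canonical__measure_function_Measure
    _ _ (measurableTypeR R) (measurableTypeR R) R mu _ (measurable_shift t).
apply: (@lebesgue_measure_unique R m) => // _ [[a b] _ <-] /=.
rewrite /pushforward.
have -> : (fun x : R => x + t) @^-1` `]a, b] = `]a - t, b - t]%classic.
  by apply/seteqP; split=> x /=; rewrite !in_itv /= ltrBlDr lerBrDr.
rewrite !lebesgue_measure_itv /= !lte_fin ltrD2r.
by case: ifP => // _; rewrite -!EFinD; congr EFin; ring.
Qed.

Lemma lebesgue_measure_opp (A : set R) : measurable A -> mu (-%R @^-1` A) = mu A.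
Proof.
move=> mA; apply/esym.
pose m : {measure set (measurableTypeR R) -> \bar R} :=
  @measure_function_pushforward__canonical__measure_function_Measure
    _ _ (measurableTypeR R) (measurableTypeR R) R mu _ (@oppr_measurable R setT).
apply: (@lebesgue_measure_unique R m) => // _ [[a b] _ <-] /=.
rewrite /pushforward.
have -> : -%R @^-1` `]a, b] = `[- b, - a[%classic.
  apply/seteqP; split=> x /=; rewrite !in_itv /= => /andP[? ?];
    by apply/andP; split; lra.
rewrite !lebesgue_measure_itv /= !lte_fin ltrN2.
by case: ifP => // _; rewrite -!EFinD; congr EFin; ring.
Qed.

Lemma ge0_integral_shift t (f : R -> \bar R) : measurable_fun setT f ->
  (forall x, 0 <= f x)%E ->
  (\int[mu]_x f (x + t)%R = \int[mu]_x f x)%E.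
Proof.
move=> mf f0.
have := @ge0_integral_pushforward _ _ (measurableTypeR R) (measurableTypeR R) R
  _ (measurable_shift t) mu setT f measurableT mf.
rewrite preimage_setT => <- //.
apply: eq_measure_integral => [|? A mA _]; first exact: measurable_shift.
exact: lebesgue_measure_shift.
Qed.

Lemma ge0_integral_opp (f : R -> \bar R) : measurable_fun setT f ->
  (forall x, 0 <= f x)%E ->
  (\int[mu]_x f (- x)%R = \int[mu]_x f x)%E.
Proof.
move=> mf f0.
have := @ge0_integral_pushforward _ _ (measurableTypeR R) (measurableTypeR R) R
  _ (@oppr_measurable R setT) mu setT f measurableT mf.
rewrite preimage_setT => <- //.
apply: eq_measure_integral => A mA _.
exact: lebesgue_measure_opp.
Qed.

Lemma Rintegral_shift t f : bounded_supported f ->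
  \int[mu]_x f (x + t) = \int[mu]_x f x.
Proof.
move=> bf; rewrite /Rintegral; congr fine.
have mf : measurable_fun setT (EFin \o f) by apply/measurable_EFinP; exact: bf.1.
rewrite integralE [RHS]integralE; congr (_ - _)%E.
  rewrite -[RHS](@ge0_integral_shift t (EFin \o f)^\+%E)//; last exact: measurable_funepos.
  by apply: eq_integral => x _; rewrite !funeposE.
rewrite -[RHS](@ge0_integral_shift t (EFin \o f)^\-%E)//; last exact: measurable_funeneg.
by apply: eq_integral => x _; rewrite !funenegE.
Qed.

Lemma Rintegral_itv_cos a b w q : a <= b -> w != 0 ->
  \int[mu]_x (\1_(`[a, b[) x * cos (w * x + q)) =
  (sin (w * b + q) - sin (w * a + q)) / w.
Proof.
move=> ab w0.
have [bw Mw] := bounded_measurable_cos w q.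
transitivity (\int[mu]_(x in `[a, b[) cos (w * x + q)).
  rewrite [RHS]Rintegral_mkcond; apply: eq_Rintegral => x _.
  by rewrite patchE indicE; case: ifP; rewrite ?mul1r ?mul0r.
rewrite Rintegral_itv_bndo_bndc; last first.
  apply: measurable_bounded_integrable => //.
  - by rewrite /= lebesgue_measure_itv /=; case: ifP => // _; rewrite -EFinD ltry.
  - exact: measurable_funTS.
  - exists 1; split; first exact: num_real.
    by move=> N N1 x /= _; rewrite (le_trans (cos_max _))// ltW.
move: ab; rewrite le_eqVlt => /predU1P[<-|ab].
  by rewrite set_itv1 Rintegral_set1 subrr mul0r.
pose F x : R := sin (w * x + q) / w.
have dF (x : R) : is_derive x 1 F (cos (w * x + q)).
  rewrite /F; apply: is_derive_eq.
  by rewrite !scaler0 addr0 add0r /GRing.scale /=; field.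
have cF : continuous F.
  by move=> x; apply/differentiable_continuous/derivable1_diffP; apply: ex_derive.
rewrite /Rintegral (continuous_FTC2 (F := F))//.
- by rewrite -EFinD /= /F mulrBl.
- apply: continuous_subspaceT => x.
  apply: (@continuous_comp _ _ _ (fun x : R => w * x + q) cos).
    apply: cvgD; last exact: cvg_cst.
    by apply: cvgM; [exact: cvg_cst|exact: cvg_id].
  exact: continuous_cos.
- split.
  + by move=> x _; apply: ex_derive.
  + exact/cvg_at_right_filter/cF.
  + exact/cvg_at_left_filter/cF.
- by move=> x _; rewrite derive1E; apply: derive_val.
Qed.

End Compact.

(** * Complex inner products of bounded functions with bounded support *)

Section ComplexInner.
Context {R : realType}.
Implicit Types (f g h : R -> R[i]) (z : R[i]).
Local Notation mu := (@lebesgue_measure R).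
Local Notation Re := (@complex.Re R).
Local Notation Im := (@complex.Im R).


Lemma cReD z1 z2 : Re (z1 + z2) = Re z1 + Re z2 :> R.
Proof. by case: z1; case: z2. Qed.
Lemma cImD z1 z2 : Im (z1 + z2) = Im z1 + Im z2 :> R.
Proof. by case: z1; case: z2. Qed.
Lemma cReN z : Re (- z) = - Re z :> R. Proof. by case: z. Qed.
Lemma cImN z : Im (- z) = - Im z :> R. Proof. by case: z. Qed.
Lemma cReM z1 z2 : Re (z1 * z2) = Re z1 * Re z2 - Im z1 * Im z2 :> R.
Proof. by case: z1; case: z2. Qed.
Lemma cImM z1 z2 : Im (z1 * z2) = Re z1 * Im z2 + Im z1 * Re z2 :> R.
Proof. by case: z1; case: z2. Qed.
Lemma cReJ z : Re z^*%C = Re z :> R. Proof. by case: z. Qed.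
Lemma cImJ z : Im z^*%C = - Im z :> R. Proof. by case: z. Qed.
Definition ReImE := (cReD, cImD, cReN, cImN, cReM, cImM, cReJ, cImJ).

Lemma complex_ext z1 z2 : Re z1 = Re z2 -> Im z1 = Im z2 -> z1 = z2 :> R[i].
Proof. by case: z1; case: z2 => /= ? ? ? ? -> ->. Qed.

Lemma conjcM z1 z2 : (z1 * z2)^*%C = z1^*%C * z2^*%C.
Proof. exact: rmorphM. Qed.
Lemma conjcB z1 z2 : (z1 - z2)^*%C = z1^*%C - z2^*%C.
Proof. exact: rmorphB. Qed.

Definition csq z : R := Re z ^+ 2 + Im z ^+ 2.

Lemma csq_ge0 z : 0 <= csq z. Proof. by rewrite addr_ge0 ?sqr_ge0. Qed.

Lemma csqE z : (csq z)%:C%C = z * z^*%C.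
Proof. by apply: complex_ext; rewrite !ReImE /csq /=; ring. Qed.

Lemma csqM z1 z2 : csq (z1 * z2) = csq z1 * csq z2.
Proof. by rewrite /csq !ReImE; ring. Qed.

Lemma csq_eq0 z : (csq z == 0) = (z == 0).
Proof.
case: z => a b; rewrite /csq /= paddr_eq0 ?sqr_ge0// !sqrf_eq0.
by rewrite eq_complex.
Qed.

Lemma csqD_le z1 z2 : csq (z1 + z2) <= 2 * csq z1 + 2 * csq z2.
Proof.
rewrite /csq !ReImE -subr_ge0.
have -> : 2 * (Re z1 ^+ 2 + Im z1 ^+ 2) + 2 * (Re z2 ^+ 2 + Im z2 ^+ 2) -
  ((Re z1 + Re z2) ^+ 2 + (Im z1 + Im z2) ^+ 2) =
  (Re z1 - Re z2) ^+ 2 + (Im z1 - Im z2) ^+ 2 by ring.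
by rewrite addr_ge0 ?sqr_ge0.
Qed.

Definition bounded_supportedC f : Prop :=
  bounded_supported (Re \o f) /\ bounded_supported (Im \o f).

Definition bounded_measurableC f : Prop :=
  bounded_measurable (Re \o f) /\ bounded_measurable (Im \o f).

Lemma bounded_supportedN (u : R -> R) :
  bounded_supported u -> bounded_supported (fun x => - u x).
Proof.
by move=> /(bounded_supportedZ (-1)); under eq_fun do rewrite mulN1r.
Qed.

Lemma bounded_supportedCD f g : bounded_supportedC f -> bounded_supportedC g ->
  bounded_supportedC (fun x => f x + g x).
Proof.
move=> [f1 f2] [g1 g2]; split.
  have := bounded_supportedD f1 g1; congr bounded_supported.
  by apply/funext => x /=; rewrite cReD.
have := bounded_supportedD f2 g2; congr bounded_supported.
by apply/funext => x /=; rewrite cImD.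
Qed.

Lemma bounded_supportedCM f g : bounded_supportedC f -> bounded_measurableC g ->
  bounded_supportedC (fun x => f x * g x).
Proof.
move=> [f1 f2] [g1 g2]; split.
  have := bounded_supportedD (bounded_supportedM f1 g1)
     (bounded_supportedN (bounded_supportedM f2 g2)).
  by congr bounded_supported; apply/funext => x /=; rewrite cReM.
have := bounded_supportedD (bounded_supportedM f1 g2) (bounded_supportedM f2 g1).
by congr bounded_supported; apply/funext => x /=; rewrite cImM.
Qed.

Lemma bounded_supportedC_bounded f :
  bounded_supportedC f -> bounded_measurableC f.
Proof. by move=> [? ?]; split; exact: bounded_supported_bounded. Qed.

Lemma bounded_measurableC_cst z : bounded_measurableC (cst z).
Proof. by split; exact: bounded_measurable_cst. Qed.

Lemma bounded_supportedCZ z f :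
  bounded_supportedC f -> bounded_supportedC (fun x => z * f x).
Proof.
move=> bf; have := bounded_supportedCM bf (bounded_measurableC_cst z).
by congr bounded_supportedC; apply/funext => x /=; rewrite mulrC.
Qed.

Lemma bounded_supportedCN f :
  bounded_supportedC f -> bounded_supportedC (fun x => - f x).
Proof.
by move=> /(bounded_supportedCZ (-1)); under eq_fun do rewrite mulN1r.
Qed.

Lemma bounded_supportedC0 : bounded_supportedC (cst 0).
Proof. by split; exact: bounded_supported0. Qed.

Lemma bounded_supportedC_sum (I : Type) (s : seq I) (f : I -> R -> R[i]) :
  (forall i, bounded_supportedC (f i)) ->
  bounded_supportedC (fun x => \sum_(i <- s) f i x).
Proof.
move=> bf; elim: s => [|i s IH].
  under eq_fun do rewrite big_nil; exact: bounded_supportedC0.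
by under eq_fun do rewrite big_cons; exact: bounded_supportedCD.
Qed.

Lemma bounded_supportedCJ f :
  bounded_supportedC f -> bounded_supportedC (fun x => (f x)^*%C).
Proof.
move=> [f1 f2]; split.
  by move: f1; congr bounded_supported; apply/funext => x /=; rewrite cReJ.
have := bounded_supportedN f2.
by congr bounded_supported; apply/funext => x /=; rewrite cImJ.
Qed.

Lemma bounded_supportedC_mulJ f g : bounded_supportedC f ->
  bounded_supportedC g -> bounded_supportedC (fun x => f x * (g x)^*%C).
Proof.
move=> bf bg; apply: bounded_supportedCM => //.
exact/bounded_supportedC_bounded/bounded_supportedCJ.
Qed.

Lemma cintegralD f g : bounded_supportedC f -> bounded_supportedC g ->
  cintegral (fun x => f x + g x) = cintegral f + cintegral g.
Proof.
move=> [f1 f2] [g1 g2]; apply: complex_ext; rewrite ReImE /=.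
  rewrite -RintegralD//; try exact: bounded_supported_integrable.
  by apply: eq_Rintegral => x _; rewrite cReD.
rewrite -RintegralD//; try exact: bounded_supported_integrable.
by apply: eq_Rintegral => x _; rewrite cImD.
Qed.

Lemma cintegralZ z f : bounded_supportedC f ->
  cintegral (fun x => z * f x) = z * cintegral f.
Proof.
move=> [f1 f2]; apply: complex_ext; rewrite ReImE /=.
  rewrite -!RintegralZl//; try exact: bounded_supported_integrable.
  rewrite -RintegralB//;
    try by apply: bounded_supported_integrable; exact: bounded_supportedZ.
  by apply: eq_Rintegral => x _; rewrite cReM.
rewrite -!RintegralZl//; try exact: bounded_supported_integrable.
rewrite -RintegralD//;
  try by apply: bounded_supported_integrable; exact: bounded_supportedZ.
by apply: eq_Rintegral => x _; rewrite cImM.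
Qed.

Lemma cintegralJ f : bounded_supportedC f ->
  cintegral (fun x => (f x)^*%C) = (cintegral f)^*%C.
Proof.
move=> [f1 f2]; apply: complex_ext; rewrite ReImE /=.
  by apply: eq_Rintegral => x _; rewrite cReJ.
rewrite -mulN1r -RintegralZl//; last exact: bounded_supported_integrable.
by apply: eq_Rintegral => x _; rewrite cImJ mulN1r.
Qed.

Lemma eq_cintegral f g : f =1 g -> cintegral f = cintegral g.
Proof. by move=> /funext ->. Qed.

Lemma L2innerBl f g h z : bounded_supportedC f -> bounded_supportedC g ->
  bounded_supportedC h ->
  L2inner (fun x => f x - z * g x) h = L2inner f h - z * L2inner g h.
Proof.
move=> bf bg bh; rewrite /L2inner -mulNr -cintegralZ; last first.
  exact: bounded_supportedC_mulJ.
rewrite -cintegralD; [|exact: bounded_supportedC_mulJ|]; last first.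
  by apply: bounded_supportedCZ; exact: bounded_supportedC_mulJ.
by apply: eq_cintegral => x; ring.
Qed.

Lemma L2innerJ f g : bounded_supportedC f -> bounded_supportedC g ->
  L2inner g f = (L2inner f g)^*%C.
Proof.
move=> bf bg; rewrite /L2inner -cintegralJ; last exact: bounded_supportedC_mulJ.
by apply: eq_cintegral => x; rewrite conjcM conjcK mulrC.
Qed.

Lemma L2innerBB f g z : bounded_supportedC f -> bounded_supportedC g ->
  L2inner (fun x => f x - z * g x) (fun x => f x - z * g x) =
  L2inner f f - z^*%C * L2inner f g - z * (L2inner f g)^*%C + (csq z)%:C%C * L2inner g g.
Proof.
move=> bf bg.
have bh : bounded_supportedC (fun x => f x - z * g x).
  by apply: bounded_supportedCD => //; apply: bounded_supportedCN;
     exact: bounded_supportedCZ.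
rewrite L2innerBl// (L2innerJ bh bf) (L2innerJ bh bg) !L2innerBl//.
rewrite !conjcB !conjcM csqE (L2innerJ bf bg) conjcK.
by rewrite -(L2innerJ bf bf) -(L2innerJ bg bg); ring.
Qed.

Definition orthonormal_seq (I : choiceType) (s : seq I) (e : I -> R -> R[i]) :=
  {in s &, forall i j, L2inner (e i) (e j) = (i == j)%:R}.

(** Pythagoras: the residual splits into the distance to the span and the error of the coefficients.
    Exact coefficients give Bessel's inequality; for arbitrary [c], dropping the last sum bounds the
    distance to the span by the residual. *)
Lemma L2inner_residual (I : choiceType) (s : seq I) (e : I -> R -> R[i])
    (c : I -> R[i]) f : uniq s -> orthonormal_seq s e ->
  (forall i, bounded_supportedC (e i)) -> bounded_supportedC f ->
  L2inner (fun x => f x - \sum_(i <- s) c i * e i x)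
          (fun x => f x - \sum_(i <- s) c i * e i x) =
  L2inner f f - \sum_(i <- s) (csq (L2inner f (e i)))%:C%C
              + \sum_(i <- s) (csq (c i - L2inner f (e i)))%:C%C.
Proof.
move=> us os be bf.
have bg (s' : seq I) : bounded_supportedC (fun x => f x - \sum_(i <- s') c i * e i x).
  apply: bounded_supportedCD => //; apply: bounded_supportedCN.
  by apply: bounded_supportedC_sum => i; apply: bounded_supportedCZ.
elim: s us os => [_ _|i s IH /= /andP[si us] os].
  by rewrite !big_nil subr0 addr0; under eq_fun do rewrite big_nil subr0.
have os' : orthonormal_seq s e.
  by move=> j k js ks; apply: os; rewrite in_cons ?js ?ks orbT.
have fE : (fun x => f x - \sum_(j <- i :: s) c j * e j x) =
  (fun x => (f x - \sum_(j <- s) c j * e j x) - c i * e i x).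
  by apply/funext => x; rewrite big_cons; ring.
(* The functions of index in [s] are orthogonal to [e i], as [i] is not in [s]; subtracting them
   leaves the coefficient at [i] unchanged. *)
have ort s' : {subset s' <= s} ->
    L2inner (fun x => f x - \sum_(j <- s') c j * e j x) (e i) = L2inner f (e i).
  elim: s' => [|j s' IHs'] ss'; first by under eq_fun do rewrite big_nil subr0.
  have -> : (fun x => f x - \sum_(j <- j :: s') c j * e j x) =
    (fun x => (f x - \sum_(j <- s') c j * e j x) - c j * e j x).
    by apply/funext => x; rewrite big_cons; ring.
  rewrite L2innerBl// IHs'; last by move=> k ks; rewrite ss'// in_cons ks orbT.
  have js : j \in s by rewrite ss'// mem_head.
  rewrite os ?mem_head ?in_cons ?js ?orbT//.
  suff /negPf -> : j != i by rewrite mulr0 subr0.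
  by apply: contraNneq si => <-.
rewrite fE L2innerBB// ort// IH// os ?mem_head// eqxx mulr1 !big_cons !csqE.
by rewrite !conjcB; ring.
Qed.

End ComplexInner.

(** * Bessel's and Parseval's inequalities *)

Section Energy.
Context {R : realType}.
Implicit Types (f g h : R -> R[i]) (z : R[i]).
Local Notation mu := (@lebesgue_measure R).
Local Notation Re := (@complex.Re R).
Local Notation Im := (@complex.Im R).

Definition energy f : \bar R := (\int[mu]_x (csq (f x))%:E)%E.

Lemma energy_ge0 f : (0 <= energy f)%E.
Proof. by apply: integral_ge0 => x _; rewrite lee_fin csq_ge0. Qed.

Lemma L2normE f : L2norm f = (energy f `^ 2^-1)%E.
Proof.
rewrite /L2norm unlock; congr (_ `^ _)%E; apply: eq_integral => x _ /=.
congr EFin; rewrite powR_mulrn// /csq.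
case: (f x) => a b; rewrite /ComplexField.Normc.normc.
by rewrite ger0_norm ?sqrtr_ge0// sqr_sqrtr// addr_ge0 ?sqr_ge0.
Qed.

Lemma L2norm_lt f (eps : R) : 0 < eps ->
  (L2norm f < eps%:E)%E = (energy f < (eps ^+ 2)%:E)%E.
Proof.
move=> e0; rewrite L2normE; have := energy_ge0 f.
case: (energy f) => [r|_|//].
  rewrite lee_fin => r0; rewrite poweR_EFin !lte_fin powR12_sqrt//.
  by rewrite -{2}(sqr_sqrtr r0) ltr_pXn2r// ?nnegrE ?sqrtr_ge0// ltW.
by rewrite poweRyr// invr_neq0.
Qed.

Lemma L2norm_lty f : (L2norm f < +oo)%E = (energy f < +oo)%E.
Proof.
rewrite L2normE; have := energy_ge0 f.
case: (energy f) => [r|_|//]; first by rewrite poweR_EFin !ltry.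
by rewrite poweRyr// invr_neq0.
Qed.

Lemma bounded_supported_csq f : bounded_supportedC f ->
  bounded_supported (csq \o f).
Proof.
move=> [f1 f2].
have := bounded_supportedD
  (bounded_supportedM f1 (bounded_supported_bounded f1))
  (bounded_supportedM f2 (bounded_supported_bounded f2)).
by congr bounded_supported; apply/funext => x /=; rewrite /csq !expr2.
Qed.

Lemma L2inner_selfE f : L2inner f f = ((\int[mu]_x csq (f x))%:C)%C.
Proof.
rewrite /L2inner /cintegral; congr Complex.
  by apply: eq_Rintegral => x _; rewrite -csqE.
transitivity (\int[mu]_x (cst 0 x : R)).
  by apply: eq_Rintegral => x _; rewrite -csqE.
by rewrite Rintegral_cst// mul0r.
Qed.

Lemma energyE f : bounded_supportedC f -> energy f = (\int[mu]_x csq (f x))%:E.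
Proof.
move=> /bounded_supported_csq/bounded_supported_integrable bf.
by rewrite /Rintegral fineK//; exact: integrable_fin_num.
Qed.

Lemma bounded_supported_L2 f : bounded_supportedC f -> L2 f.
Proof.
move=> bf; split; first by split; [exact: bf.1.1|exact: bf.2.1].
by rewrite L2norm_lty energyE// ltry.
Qed.

Lemma bessel (I : choiceType) (s : seq I) (e : I -> R -> R[i]) f :
  uniq s -> orthonormal_seq s e ->
  (forall i, bounded_supportedC (e i)) -> bounded_supportedC f ->
  \sum_(i <- s) csq (L2inner f (e i)) <= \int[mu]_x csq (f x).
Proof.
move=> us os be bf.
have := L2inner_residual (fun i => L2inner f (e i)) us os be bf.
rewrite !L2inner_selfE [X in _ = _ + X]big1; last first.
  by move=> i _; rewrite subrr /csq /= expr0n addr0.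
rewrite -!rmorph_sum addr0 -rmorphB => /(congr1 Re) /= h.
by rewrite -subr_ge0 -h; apply: Rintegral_ge0 => x _; exact: csq_ge0.
Qed.

Lemma parseval_ge (I : choiceType) (A : set I) (e : I -> R -> R[i]) f :
  orthonormal_basis A e -> (forall i, bounded_supportedC (e i)) ->
  bounded_supportedC f ->
  ((\int[mu]_x csq (f x))%:E <= \esum_(i in A) (csq (L2inner f (e i)))%:E)%E.
Proof.
move=> [_ oe ce] be bf; apply/lee_addgt0Pr => eps e0.
have se0 : 0 < Num.sqrt eps by rewrite sqrtr_gt0.
have [s [c [sA]]] := ce f (bounded_supported_L2 bf) _ se0.
rewrite L2norm_lt// sqr_sqrtr ?(ltW e0)// => small.
move: small.
(* [s] may repeat an index; each index is kept once, its coefficient multiplied by its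
   multiplicity. *)
pose c' i := c i *+ count_mem i s.
have -> : (fun x => f x - \sum_(i <- s) c i * e i x) =
    (fun x => f x - \sum_(i <- undup s) c' i * e i x).
  apply/funext => x; congr (_ - _); rewrite -big_undup_iterop_count; apply: eq_bigr => i _.
  by rewrite /c' mulrnAl.
have us := undup_uniq s.
have os : orthonormal_seq (undup s) e.
  by move=> i j; rewrite !mem_undup => si sj; apply: oe; apply: sA.
have bg : bounded_supportedC (fun x => f x - \sum_(i <- undup s) c' i * e i x).
  apply: bounded_supportedCD => //; apply: bounded_supportedCN.
  by apply: bounded_supportedC_sum => i; apply: bounded_supportedCZ.
rewrite energyE// lte_fin => small.
have := L2inner_residual c' us os be bf.
rewrite !L2inner_selfE -!rmorph_sum -rmorphB -rmorphD => /(congr1 Re) /= h.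
have fin : \int[mu]_x csq (f x) <= \sum_(i <- undup s) csq (L2inner f (e i)) + eps.
  have pos : 0 <= \sum_(i <- undup s) csq (c' i - L2inner f (e i)).
    by apply: sumr_ge0 => i _; exact: csq_ge0.
  by move: small; rewrite h => small; lra.
apply: (@le_trans _ _ (\sum_(i <- undup s) csq (L2inner f (e i)) + eps)%:E).
  by rewrite lee_fin.
rewrite EFinD leeD2r//; apply: esum_ge; exists [set` undup s].
  split; first exact: finite_seq.
  by move=> i /=; rewrite mem_undup; exact: sA.
by rewrite -fsbig_seq//= -sumEFin.
Qed.

End Energy.

(** * The ambiguity function *)

Section Expi.
Context {R : realType}.
Implicit Types x y : R.

Lemma expiD x y : expi (x + y) = expi x * expi y.
Proof. by apply: complex_ext; rewrite !ReImE /= ?cosD ?sinD; ring. Qed.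

Lemma expiN x : expi (- x) = (expi x)^*%C.
Proof. by apply: complex_ext; rewrite !ReImE /= ?cosN ?sinN. Qed.

Lemma expi0 : expi 0 = 1 :> R[i].
Proof. by rewrite /expi cos0 sin0. Qed.

Lemma csq_expi x : csq (expi x) = 1.
Proof. exact: cos2Dsin2. Qed.

Lemma bounded_measurable_expi (w q : R) :
  bounded_measurableC (fun x => expi (w * x + q)).
Proof. by split; [exact: bounded_measurable_cos|exact: bounded_measurable_sin]. Qed.

End Expi.

Section Ambiguity.
Context {R : realType}.
Local Notation mu := (@lebesgue_measure R).
Implicit Types (u : R -> R) (w q s t nu : R).

Lemma integral_cos_phase u w q : bounded_supported u ->
  \int[mu]_x (u x * cos (w * x + q)) =
  cos q * (\int[mu]_x (u x * cos (w * x))) - sin q * (\int[mu]_x (u x * sin (w * x))).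
Proof.
move=> bu.
have bc : bounded_supported (fun x => u x * cos (w * x)).
  apply: bounded_supportedM => //.
  by have := bounded_measurable_cos w 0; under eq_fun do rewrite addr0.
have bs : bounded_supported (fun x => u x * sin (w * x)).
  apply: bounded_supportedM => //.
  by have := bounded_measurable_sin w 0; under eq_fun do rewrite addr0.
rewrite -!RintegralZl//; try exact: bounded_supported_integrable.
rewrite -RintegralB//;
  try by apply: bounded_supported_integrable; exact: bounded_supportedZ.
by apply: eq_Rintegral => x _; rewrite cosD; ring.
Qed.

Lemma integral_sin_phase u w q : bounded_supported u ->
  \int[mu]_x (u x * sin (w * x + q)) =
  sin q * (\int[mu]_x (u x * cos (w * x))) + cos q * (\int[mu]_x (u x * sin (w * x))).
Proof.
move=> bu; have := integral_cos_phase w (q - pi / 2) bu.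
rewrite cosBpihalf sinBpihalf mulNr opprK => <-.
by apply: eq_Rintegral => x _; rewrite addrA cosBpihalf.
Qed.

(** The squared modulus of the Fourier transform of the real function [u] at [nu]; for
    [u = overlap Om s] it is [|V s nu|^2]. *)
Definition fourier_csq u nu : R :=
  (\int[mu]_x (u x * cos (2 * pi * nu * x))) ^+ 2 +
  (\int[mu]_x (u x * sin (2 * pi * nu * x))) ^+ 2.

Lemma fourier_csq_ge0 u nu : 0 <= fourier_csq u nu.
Proof. by rewrite addr_ge0 ?sqr_ge0. Qed.

Lemma fourier_csq_phase u nu q : bounded_supported u ->
  (\int[mu]_x (u x * cos (2 * pi * nu * x + q))) ^+ 2 +
  (\int[mu]_x (u x * sin (2 * pi * nu * x + q))) ^+ 2 = fourier_csq u nu.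
Proof.
move=> bu; rewrite integral_cos_phase// integral_sin_phase// /fourier_csq.
set A := \int[mu]_x _; set B := \int[mu]_x _.
transitivity ((cos q ^+ 2 + sin q ^+ 2) * (A ^+ 2 + B ^+ 2)); first by ring.
by rewrite cos2Dsin2 mul1r.
Qed.

Section Window.
Variables (Om : set R) (M : R).
Hypotheses (mOm : measurable Om) (OmM : forall x, Om x -> `|x| <= M).

Definition overlap s (x : R) : R := \1_Om (x - s) * \1_Om x.

Lemma bounded_supported_window : bounded_supported (\1_Om : R -> R).
Proof. exact: bounded_supported_indic OmM. Qed.

Lemma bounded_measurable_window_shift s :
  bounded_measurable (fun x => \1_Om (x - s) : R).
Proof.
split; last first.
  by exists 1 => x; rewrite indicE; case: (_ \in _); rewrite ?normr1 ?normr0.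
apply: (measurableT_comp (f := \1_Om : R -> R)); first exact: measurable_indic.
exact: measurable_shift.
Qed.

Lemma bounded_supported_window_shift s :
  bounded_supported (fun x => \1_Om (x - s) : R).
Proof.
have [m b] := bounded_measurable_window_shift s; split=> //.
exists (1 + `|M| + `|s|) => x; rewrite indicE; split.
  by case: (_ \in _); rewrite ?normr1 ?normr0 ?addr_ge0// -addrA lerDl addr_ge0.
have [|//] := boolP (x - s \in Om); rewrite inE => /OmM xM.
rewrite ltNge => /negP; case; rewrite -[x in `|x|](subrK s).
rewrite (le_trans (ler_normD _ _))// lerD2r (le_trans xM)//.
by rewrite (le_trans (ler_norm _))// lerDr.
Qed.

Lemma bounded_supported_overlap s : bounded_supported (overlap s).
Proof.
apply: bounded_supportedM (bounded_supported_window_shift s) _.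
exact: bounded_supported_bounded bounded_supported_window.
Qed.

Lemma bounded_supported_gabor (l : R * R) :
  bounded_supportedC (time_freq_shift (cindic Om) l).
Proof.
apply: (@bounded_supportedCM _ (fun x => cindic Om (x - l.1))).
  split; first exact: bounded_supported_window_shift.
  exact: bounded_supported0.
have := bounded_measurable_expi (2 * pi * l.2) 0.
congr bounded_measurableC; apply/funext => x.
by rewrite addr0; congr expi; ring.
Qed.

(** A translation by [l.1] makes the overlap depend on [z.1 - l.1] only; all that remains of [l.1]
    is the phase [w * l.1], which does not affect the modulus. *)
Lemma L2inner_gabor_shift (z l : R * R) :
  let w := 2 * pi * (z.2 - l.2) in
  L2inner (time_freq_shift (cindic Om) z) (time_freq_shift (cindic Om) l) =
  ((\int[mu]_x (overlap (z.1 - l.1) x * cos (w * x + w * l.1))) +i*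
   (\int[mu]_x (overlap (z.1 - l.1) x * sin (w * x + w * l.1))))%C.
Proof.
move=> w.
have E x : time_freq_shift (cindic Om) z x * (time_freq_shift (cindic Om) l x)^*%C =
    ((\1_Om (x - z.1) * \1_Om (x - l.1))%:C)%C * expi (w * x).
  rewrite /time_freq_shift conjcM -expiN.
  have -> : w * x = 2 * pi * x * z.2 + - (2 * pi * x * l.2) by rewrite /w; ring.
  by rewrite expiD; apply: complex_ext; rewrite !ReImE /cindic /=; ring.
have bo w' q : bounded_supported (fun x => \1_Om (x - z.1) * \1_Om (x - l.1) * cos (w' * x + q) : R).
  apply: bounded_supportedM; last exact: bounded_measurable_cos.
  apply: bounded_supportedM; first exact: bounded_supported_window_shift.
  exact: bounded_measurable_window_shift.
rewrite /L2inner /cintegral; congr Complex.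
  rewrite -[RHS](Rintegral_shift (- l.1)); last first.
    apply: bounded_supportedM; first exact: bounded_supported_overlap.
    exact: bounded_measurable_cos.
  apply: eq_Rintegral => x _; rewrite E !ReImE /= mul0r subr0 /overlap.
  by congr (\1_Om _ * _ * cos _); ring.
rewrite -[RHS](Rintegral_shift (- l.1)); last first.
  apply: bounded_supportedM; first exact: bounded_supported_overlap.
  exact: bounded_measurable_sin.
apply: eq_Rintegral => x _; rewrite E !ReImE /= mul0r addr0 /overlap.
by congr (\1_Om _ * _ * sin _); ring.
Qed.

Lemma csq_L2inner_gabor (z l : R * R) :
  csq (L2inner (time_freq_shift (cindic Om) z) (time_freq_shift (cindic Om) l)) =
  fourier_csq (overlap (z.1 - l.1)) (z.2 - l.2).
Proof.
rewrite L2inner_gabor_shift; apply: fourier_csq_phase.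
exact: bounded_supported_overlap.
Qed.

(** The free phase [q] encodes the vanishing of both parts of the complex integral, and later allows
    each wave to be read at a convenient point. *)
Lemma gabor_orthogonal (z l : R * R) q :
  L2inner (time_freq_shift (cindic Om) z) (time_freq_shift (cindic Om) l) = 0 ->
  \int[mu]_x (overlap (z.1 - l.1) x * cos (2 * pi * (z.2 - l.2) * x + q)) = 0.
Proof.
move=> /(congr1 csq); rewrite csq_L2inner_gabor /fourier_csq /csq /=.
rewrite expr0n addr0 => /eqP; rewrite paddr_eq0 ?sqr_ge0// !sqrf_eq0.
move=> /andP[/eqP C0 /eqP S0]; rewrite integral_cos_phase; last first.
  exact: bounded_supported_overlap.
by rewrite C0 S0 !mulr0 subrr.
Qed.

Local Notation RR := (measurableTypeR R).

Lemma measurable_overlap_integral (h : (RR * RR) * RR -> R) :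
  measurable_fun setT h -> (forall p, 0 <= h p) ->
  measurable_fun setT (fun z : RR * RR => \int[mu]_x (overlap z.1 x * h (z, x))).
Proof.
move=> mh h0.
pose psi (p : (RR * RR) * RR) : \bar R := (overlap p.1.1 p.2 * h p)%:E.
have mpsi : measurable_fun setT psi.
  apply/measurable_EFinP; apply: measurable_funM => //.
  apply: measurable_funM; last first.
    exact: (measurableT_comp (f := \1_Om : R -> R)).
  apply: (measurableT_comp (f := \1_Om : R -> R)); first exact: measurable_indic.
  apply: measurable_funB => //.
  by apply: measurableT_comp => //.
have psi0 p : (0 <= psi p)%E by rewrite lee_fin !mulr_ge0// indicE.
have := measurable_fun_fubini_tonelli_F (m2 := mu) psi mpsi psi0.
move=> m; exact: (measurableT_comp (f := fine) _ m).
Qed.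

Lemma measurable_fourier_csq :
  measurable_fun setT (fun z : RR * RR => fourier_csq (overlap z.1) z.2).
Proof.
pose w : (RR * RR) * RR -> R := fun p => 2 * pi * p.1.2 * p.2.
have mw : measurable_fun setT w.
  apply: measurable_funM => //; apply: measurable_funM => //.
  exact: measurableT_comp.
have key (f : R -> R) : measurable_fun setT f -> (forall x, `|f x| <= 1) ->
    measurable_fun setT (fun z : RR * RR => \int[mu]_x (overlap z.1 x * f (2 * pi * z.2 * x))).
  move=> mf f1.
  (* Tonelli's theorem gives measurability for non-negative integrands; adding 1 makes [f]
     non-negative, and the integral of the overlap is subtracted afterwards. *)
  have -> : (fun z : RR * RR => \int[mu]_x (overlap z.1 x * f (2 * pi * z.2 * x))) =
    (fun z => (\int[mu]_x (overlap z.1 x * (1 + f (w (z, x))))) -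
              (\int[mu]_x (overlap z.1 x * 1))).
    apply/funext => z.
    have mfz : measurable_fun setT (fun x => f (w (z, x))).
      apply: (measurableT_comp mf); rewrite /w /=.
      by apply: measurable_funM => //; exact: measurable_id.
    have bfz : bounded_supported (fun x => overlap z.1 x * (1 + f (w (z, x)))).
      apply: bounded_supportedM; first exact: bounded_supported_overlap.
      split; first exact: measurable_funD.
      by exists 2 => x; rewrite (le_trans (ler_normD _ _))// normr1 -[2]/(1 + 1) lerD2l.
    rewrite -RintegralB//.
    - by apply: eq_Rintegral => x _; rewrite /w /=; ring.
    - exact: bounded_supported_integrable.
    - apply: bounded_supported_integrable; under eq_fun do rewrite mulr1.
      exact: bounded_supported_overlap.
  apply: measurable_funB.
    apply: (@measurable_overlap_integral (fun p => 1 + f (w p))).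
      by apply: measurable_funD => //; exact: measurableT_comp.
    by move=> p; have := f1 (w p); rewrite ler_norml => /andP[]; lra.
  by apply: (@measurable_overlap_integral (cst 1)).
apply: measurable_funD; apply: measurable_funX; apply: key.
- exact: continuous_measurable_fun (@continuous_cos R).
- exact: cos_max.
- exact: continuous_measurable_fun (@continuous_sin R).
- exact: sin_max.
Qed.

End Window.
End Ambiguity.

(** * Plancherel's inequality from Bessel's inequality *)

Section Plancherel.
Context {R : realType}.
Local Notation mu := (@lebesgue_measure R).
Implicit Types (u : R -> R) (a h x y : R).

Lemma sin_period (n : nat) x : sin (x + 2 * pi * n%:R) = sin x.
Proof.
have -> : x + 2 * pi * n%:R = x + (pi *+ 2) *+ n by rewrite -mulr_natr; ring.
exact: (periodicn (@sinD2pi R)).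
Qed.

Lemma cos_period (n : nat) x : cos (x + 2 * pi * n%:R) = cos x.
Proof. by rewrite -!sinDpihalf addrAC sin_period. Qed.

Lemma integral_itv_cos_period (Q : R) (w q : R) (j k : nat) :
  0 < Q -> j != k -> w = pi * (j%:R - k%:R) / Q ->
  \int[mu]_x (\1_(`[- Q, Q[) x * cos (w * x + q)) = 0.
Proof.
move=> Q0 jk wE.
have w0 : w != 0.
  rewrite wE !mulf_neq0 ?invr_neq0 ?(gt_eqF Q0) ?(gt_eqF (pi_gt0 R))//.
  by rewrite subr_eq0 eqr_nat.
rewrite Rintegral_itv_cos//; last by lra.
(* The arguments at the two ends differ by [2 * pi * (j - k)]; from the base point [y] both are
   reached by natural multiples of the period. *)
pose y : R := q - pi * j%:R - pi * k%:R.
have -> : w * Q + q = y + 2 * pi * j%:R by rewrite wE /y; field; rewrite gt_eqF.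
have -> : w * - Q + q = y + 2 * pi * k%:R by rewrite wE /y; field; rewrite gt_eqF.
by rewrite !sin_period subrr mul0r.
Qed.

Lemma csqZ (c : R) (z : R[i]) : csq (c%:C%C * z) = c ^+ 2 * csq z.
Proof. by rewrite /csq !ReImE /=; ring. Qed.

(** Exponentials whose frequencies are spaced by [1 / (2 * Q)] are orthogonal on [[- Q, Q[], which
    carries [u]. This is Bessel's inequality for them, [c] being the normalising constant. *)
Lemma bessel_fourier u (Q : R) (nu : R) (n : nat) : bounded_supported u ->
  0 < Q -> (forall x, ~ (- Q <= x < Q) -> u x = 0) ->
  \sum_(k < n) fourier_csq u (nu + k%:R / (2 * Q)) <=
  2 * Q * (\int[mu]_x (u x) ^+ 2).
Proof.
move=> bu Q0 uQ.
pose w (k : nat) := 2 * pi * (nu + k%:R / (2 * Q)).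
pose c : R := (Num.sqrt (2 * Q))^-1.
have P0 : 0 < 2 * Q by rewrite mulr_gt0.
have c2 : c ^+ 2 = (2 * Q)^-1 by rewrite exprVn sqr_sqrtr// ltW.
pose e (k : nat) x : R[i] := c%:C%C * ((\1_(`[- Q, Q[) x)%:C%C * expi (w k * x)).
have b1 : bounded_supported (\1_(`[- Q, Q[) : R -> R).
  apply: (@bounded_supported_indic _ _ Q) => // x /=.
  by rewrite in_itv /= ler_norml => /andP[-> /ltW].
have be k : bounded_supportedC (e k).
  apply: bounded_supportedCZ; apply: bounded_supportedCM.
    by split; [exact: b1|exact: bounded_supported0].
  have := bounded_measurable_expi (w k) 0.
  by congr bounded_measurableC; apply/funext => x; rewrite addr0.
have bU : bounded_supportedC (fun x => (u x)%:C%C).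
  by split; [exact: bu|exact: bounded_supported0].
have os : orthonormal_seq (iota 0 n) e.
  move=> j k _ _.
  have E x : e j x * (e k x)^*%C =
      (2 * Q)^-1%:C%C * ((\1_(`[- Q, Q[) x)%:C%C * expi ((w j - w k) * x)).
    have -> : (w j - w k) * x = w j * x + - (w k * x) by ring.
    rewrite -c2 expiD expiN /e !conjcM.
    have i1 : (\1_(`[- Q, Q[) x : R) * \1_(`[- Q, Q[) x = \1_(`[- Q, Q[) x.
      by rewrite indicE; case: (_ \in _); rewrite ?mulr1 ?mulr0.
    rewrite -[in RHS]i1; set i := \1__ _.
    by apply: complex_ext; rewrite !ReImE /=; ring.
  rewrite /L2inner (eq_cintegral E) cintegralZ; last first.
    apply: bounded_supportedCM; first by split; [exact: b1|exact: bounded_supported0].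
    have := bounded_measurable_expi (w j - w k) 0.
    by congr bounded_measurableC; apply/funext => x; rewrite addr0.
  have [->|jk] := eqVneq j k.
    have -> : cintegral (fun x => (\1_(`[- Q, Q[) x)%:C%C * expi ((w k - w k) * x)) = (2 * Q)%:C%C.
      rewrite /cintegral; congr Complex.
        transitivity (\int[mu]_x (\1_(`[- Q, Q[) x : R)).
          by apply: eq_Rintegral => x _; rewrite subrr mul0r expi0 mulr1.
        rewrite /Rintegral integral_indic// setIT /= lebesgue_measure_itv /= lte_fin.
        by rewrite ifT ?gtrN// -EFinD /=; ring.
      transitivity (\int[mu]_x (cst 0 x : R)).
        by apply: eq_Rintegral => x _; rewrite subrr mul0r expi0 mulr1.
      by rewrite Rintegral_cst// mul0r.
    by rewrite -rmorphM /= mulVf// gt_eqF.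
  have wE : w j - w k = pi * (j%:R - k%:R) / Q by rewrite /w; field; rewrite gt_eqF.
  have -> : cintegral (fun x => (\1_(`[- Q, Q[) x)%:C%C * expi ((w j - w k) * x)) = 0.
    rewrite /cintegral; congr Complex.
      rewrite -(integral_itv_cos_period 0 Q0 jk wE).
      by apply: eq_Rintegral => x _; rewrite !ReImE /= addr0; ring.
    rewrite -(integral_itv_cos_period (- (pi / 2)) Q0 jk wE).
    by apply: eq_Rintegral => x _; rewrite !ReImE /= cosBpihalf; ring.
  by rewrite mulr0.
have inner k : csq (L2inner (fun x => (u x)%:C%C) (e k)) =
    (2 * Q)^-1 * fourier_csq u (nu + k%:R / (2 * Q)).
  have E x : (u x)%:C%C * (e k x)^*%C = c%:C%C * ((u x)%:C%C * (expi (w k * x))^*%C).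
    rewrite /e !conjcM indicE; have [xQ|xQ] := boolP (x \in _).
      by apply: complex_ext; rewrite !ReImE /=; ring.
    rewrite uQ ?mul0r ?mulr0//.
    by move=> h; move/negP: xQ; apply; rewrite inE /= in_itv.
  rewrite /L2inner (eq_cintegral E) cintegralZ; last first.
    apply: bounded_supportedCM => //.
    have := bounded_measurable_expi (- w k) 0.
    by congr bounded_measurableC; apply/funext => x; rewrite addr0 -expiN mulNr.
  rewrite csqZ c2; congr (_ * _); rewrite /csq /cintegral /= /fourier_csq.
  congr (_ + _).
    by congr (_ ^+ 2); apply: eq_Rintegral => x _; rewrite mul0r subr0.
  rewrite -sqrrN; congr (_ ^+ 2).
  have bus := bounded_supportedM bu (bounded_measurable_sin (w k) 0).
  rewrite -mulN1r -RintegralZl//.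
    by apply: eq_Rintegral => x _; rewrite mul0r addr0 mulN1r mulrN opprK.
  apply: bounded_supported_integrable; move: (bounded_supportedN bus).
  by congr bounded_supported; apply/funext => x /=; rewrite mul0r !addr0 mulrN.
have := bessel (iota_uniq 0 n) os be bU.
under eq_bigr do rewrite inner.
have -> : iota 0 n = index_iota 0 n by rewrite /index_iota subn0.
rewrite -mulr_sumr big_mkord ler_pdivrMl//.
congr (_ <= _ * _); apply: eq_Rintegral => x _.
by rewrite /csq /= expr0n addr0.
Qed.

Lemma ge0_integral_itv_shift (f : R -> \bar R) a h : measurable_fun setT f ->
  (forall x, 0 <= f x)%E ->
  (\int[mu]_(x in `[a, (a + h)%R[) f x = \int[mu]_(x in `[0%R, h[) f (x + a)%R)%E.
Proof.
move=> mf f0; rewrite integral_mkcond [RHS]integral_mkcond.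
rewrite -(ge0_integral_shift a); last 2 first.
- by apply/(measurable_restrictT f) => //; exact: measurable_funTS.
- by move=> x; rewrite patchE; case: ifP.
apply: eq_integral => x _; rewrite !patchE.
congr (if _ then _ else _); apply/idP/idP; rewrite !inE /= !in_itv /=;
  move=> /andP[? ?]; apply/andP; split; lra.
Qed.

Lemma ge0_integral_itv_split (f : R -> \bar R) a h (n : nat) :
  measurable_fun setT f -> (forall x, 0 <= f x)%E -> 0 < h ->
  (\int[mu]_(x in `[a, (a + n%:R * h)%R[) f x =
   \int[mu]_(x in `[0%R, h[) (\sum_(k < n) f (x + (a + k%:R * h))%R))%E.
Proof.
move=> mf f0 h0.
have ms b : measurable_fun setT (fun x => f (x + b)).
  exact: (measurableT_comp mf (measurable_shift b)).
elim: n => [|n IH].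
  rewrite mul0r addr0 set_itvco0 integral_set0.
  by under eq_integral do rewrite big_ord0; rewrite integral0.
under [RHS]eq_integral do rewrite big_ord_recr /=.
rewrite ge0_integralD; first last.
- exact: (measurable_funTS (ms (a + n%:R * h))).
- by move=> x _.
- by apply: measurable_funTS; apply: emeasurable_sum => i; exact: ms.
- by move=> x _; apply: sume_ge0.
- by [].
rewrite -IH -(ge0_integral_itv_shift (a + n%:R * h)%R h mf f0) -ge0_integral_setU//.
- congr (integral _ _ _); apply/seteqP; rewrite -natr1 mulrDl mul1r addrA.
  have nh : 0 <= n%:R * h by rewrite mulr_ge0// ltW.
  split=> x /=; rewrite !in_itv /=.
    by case: (ltP x (a + n%:R * h)%R) => xn /andP[-> xh]; [left|right].
  by move=> [|] /andP[? ?]; apply/andP; split; lra.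
- exact: measurable_funTS.
- apply/disj_setPS => x /=; rewrite !in_itv /= => -[/andP[_ h1] /andP[h2 _]].
  by move: (lt_le_trans h1 h2); rewrite ltxx.
Qed.

(** An interval of frequencies is folded onto one cell of length [1 / P], with [P = 2 * Q]. There
    Bessel's inequality bounds the sum over all cells by [P] times the energy of [u], and [P]
    cancels against the length of the cell. The interval then grows to the whole line. *)
Lemma plancherel_le u : bounded_supported u ->
  measurable_fun setT (fourier_csq u) ->
  (\int[mu]_nu (fourier_csq u nu)%:E <= (\int[mu]_x (u x ^+ 2))%:E)%E.
Proof.
move=> bu mG; pose f nu := (fourier_csq u nu)%:E.
have mf : measurable_fun setT f by exact/measurable_EFinP.
have f0 x : (0 <= f x)%E by rewrite lee_fin fourier_csq_ge0.
have [_ [M uM]] := bu.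
have [Q Q0 uQ] : exists2 Q : nat, (0 < Q)%N & forall x, ~ (- Q%:R <= x < Q%:R) -> u x = 0.
  have M0 : 0 <= M by apply: le_trans (uM 0).1.
  exists (Num.truncn M).+1 => // x xQ; apply: (uM x).2.
  rewrite ltNge; apply/negP => xM; apply: xQ.
  have MQ := truncnS_gt M; move: xM; rewrite ler_norml => /andP[x1 x2].
  by apply/andP; split; lra.
have Q0' : 0 < Q%:R :> R by rewrite ltr0n.
pose P := (2 * Q)%N.
have PE : P%:R = 2 * Q%:R :> R by rewrite natrM.
have P0 : 0 < P%:R :> R by rewrite PE mulr_gt0.
have bound a (n : nat) :
    (\int[mu]_(x in `[a, (a + n%:R * P%:R^-1)%R[) f x <= (\int[mu]_x (u x ^+ 2))%:E)%E.
  rewrite ge0_integral_itv_split ?invr_gt0//.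
  apply: (@le_trans _ _ (\int[mu]_(x in `[0%R, (P%:R^-1)%R[) (P%:R * \int[mu]_x (u x ^+ 2))%:E)%E).
    apply: ge0_le_integral => //.
    - by move=> x _; apply: sume_ge0.
    - apply: measurable_funTS; apply: emeasurable_sum => i.
      exact: (measurableT_comp mf (measurable_shift _)).
    - move=> x _; rewrite sumEFin lee_fin.
      have := bessel_fourier (x + a) n bu Q0' uQ; rewrite -PE.
      by congr (_ <= _); apply: eq_bigr => k _; rewrite addrA.
  rewrite integral_cst//= lebesgue_measure_itv /= lte_fin invr_gt0 P0 oppr0 adde0.
  by rewrite -EFinM lee_fin mulrAC mulfV ?mul1r// gt_eqF.
pose F (n : nat) : set R := `[(- n%:R)%R, n%:R[%classic.
have cv := @ge0_nondecreasing_set_cvg_integral _ (measurableTypeR R) R F f mu.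
have FT : \bigcup_i F i = setT.
  apply/seteqP; split=> // x _; exists (Num.truncn `|x|).+1 => //=.
  have := truncnS_gt `|x|; rewrite /F /= in_itv /= ltr_norml => /andP[h1 h2].
  by rewrite h2 ltW.
rewrite FT in cv.
apply: (cvge_to_le (cv _ _ _ _)).
- apply/nondecreasing_seqP => n; rewrite subsetEset => x; rewrite /F /= !in_itv /= -natr1.
  by move=> /andP[? ?]; apply/andP; split; lra.
- by move=> i; exact: measurable_itv.
- by move=> i; exact: measurable_funTS.
- by [].
apply: nearW => n; have := bound (- n%:R) (2 * n * P)%N.
suff -> : - n%:R + (2 * n * P)%:R * P%:R^-1 = n%:R :> R by [].
by rewrite natrM mulfK ?gt_eqF// natrM; ring.
Qed.

End Plancherel.

(** The predicate [P] lets an injective enumeration also cover finite and empty sets; sums over [A]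
    become series, which can be integrated term by term. *)
Lemma countable_enum (T : pointedType) (A : set T) : countable A ->
  exists (P : pred nat) (e : nat -> T),
    A = [set e n | n in [set n | P n]] /\ set_inj [set n | P n] e.
Proof.
move=> /countable_injP[f fi]; pose P n := `[< exists2 x, A x & f x = n >].
pose e n : T := get [set x | A x /\ f x = n].
have eP n : P n -> A (e n) /\ f (e n) = n.
  by move=> /asboolP[x Ax fx]; apply: (@getPex _ [set x | A x /\ f x = n]); exists x.
exists P, e; split.
  apply/seteqP; split=> [x Ax|_ [n /= Pn <-]]; last exact: (eP _ Pn).1.
  have Pfx : P (f x) by apply/asboolP; exists x.
  exists (f x) => //; have [Ae fe] := eP _ Pfx.
  by apply: fi; rewrite ?inE.
move=> m n; rewrite !inE /= => Pm Pn emn.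
by rewrite -(eP m Pm).2 -(eP n Pn).2 emn.
Qed.

(** * The packing inequality *)

Section Packing.
Context {R : realType}.
Local Notation mu := (@lebesgue_measure R).
Local Notation RR := (measurableTypeR R).
Local Notation mu2 := (mu \x mu)%E.

Lemma ge0_integral2_shift (f : RR * RR -> \bar R) (l : RR * RR) :
  measurable_fun setT f -> (forall z, 0 <= f z)%E ->
  (\int[mu2]_z f (z.1 + l.1, z.2 + l.2)%R = \int[mu2]_z f z)%E.
Proof.
move=> mf f0.
pose f' (z : RR * RR) := f (z.1 + l.1, z.2 + l.2)%R.
have ms : measurable_fun setT (fun z : RR * RR => (z.1 + l.1, z.2 + l.2)%R : RR * RR).
  by apply: measurable_fun_pair; apply: measurable_funD.
have mf' : measurable_fun setT f' by exact: (measurableT_comp mf ms).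
have f'0 z : (0 <= f' z)%E by exact: f0.
rewrite (fubini_tonelli1 f mf f0) (fubini_tonelli1 f' mf' f'0).
rewrite -[RHS](ge0_integral_shift l.1); first last.
- by move=> x; apply: integral_ge0.
- exact: measurable_fun_fubini_tonelli_F.
apply: eq_integral => x _; rewrite /fubini_F /=.
rewrite -[RHS](ge0_integral_shift l.2)//.
exact: (measurableT_comp mf).
Qed.

Variables (Om : set R) (M : R).
Hypotheses (mOm : measurable Om) (OmM : forall x, Om x -> `|x| <= M).
Hypothesis (muOm : mu Om = 1%E).

Lemma integral_window : (\int[mu]_x (\1_Om x)%:E = 1)%E.
Proof. by rewrite integral_indic// setIT; exact: muOm. Qed.

Lemma integral_ambiguity_le :
  (\int[mu2]_z (fourier_csq (overlap Om z.1) z.2)%:E <= 1)%E.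
Proof.
pose G (z : RR * RR) := (fourier_csq (overlap Om z.1) z.2)%:E.
have mG : measurable_fun setT G.
  by apply/measurable_EFinP; apply: (measurable_fourier_csq (M := M)).
have G0 z : (0 <= G z)%E by rewrite lee_fin fourier_csq_ge0.
pose H (z : RR * RR) : \bar R := (overlap Om z.1 z.2)%:E.
have H0 z : (0 <= H z)%E by rewrite lee_fin mulr_ge0.
have mi : measurable_fun setT (\1_Om : RR -> R) by exact: measurable_indic.
have mH : measurable_fun setT H.
  apply/measurable_EFinP; apply: measurable_funM; last exact: (measurableT_comp mi).
  by apply: (measurableT_comp mi); apply: measurable_funB.
rewrite (fubini_tonelli1 G)//.
apply: (@le_trans _ _ (\int[mu]_s \int[mu]_x H (s, x))%E).
  apply: ge0_le_integral => //.
  - by move=> s _; apply: integral_ge0.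
  - exact: measurable_fun_fubini_tonelli_F.
  - exact: measurable_fun_fubini_tonelli_F.
  - move=> s _; have bo := bounded_supported_overlap mOm OmM s.
    apply: (le_trans (plancherel_le bo _)).
      by apply/measurable_EFinP; exact: (measurableT_comp mG (measurable_pair1 s)).
    have -> : \int[mu]_x overlap Om s x ^+ 2 = \int[mu]_x overlap Om s x.
      apply: eq_Rintegral => x _; rewrite /overlap !indicE.
      by case: (_ \in _); case: (_ \in _); rewrite ?mulr1 ?mulr0 ?expr1n ?expr0n.
    by rewrite /Rintegral fineK//; apply: integrable_fin_num => //;
      exact: bounded_supported_integrable.
rewrite (fubini_tonelli H)//.
have -> : (\int[mu]_x \int[mu]_s H (s, x) = \int[mu]_x (\1_Om x)%:E)%E.
  apply: eq_integral => x _; rewrite /H /overlap /=.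
  have -> : (\int[mu]_s (\1_Om (x - s) * \1_Om x)%:E = (\1_Om x)%:E * \int[mu]_s (\1_Om s)%:E)%E.
    rewrite -ge0_integralZl//; last exact/measurable_EFinP.
    pose k s : \bar R := ((\1_Om x)%:E * (\1_Om s)%:E)%E.
    have mk : measurable_fun setT k by apply: measurable_funeM; exact/measurable_EFinP.
    have k0 s : (0 <= k s)%E by rewrite mule_ge0.
    (* A translation and a reflection replace [s] by [x - s]. *)
    rewrite -/k -[RHS](ge0_integral_shift x)//.
    rewrite -[RHS]ge0_integral_opp//.
      by apply: eq_integral => s _; rewrite /k -EFinM mulrC addrC.
    exact: (measurableT_comp mk (measurable_shift x)).
  by rewrite integral_window mule1.
by rewrite integral_window.
Qed.

Variable (Lam : set (R * R)).
Hypotheses (cLam : countable Lam)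
  (basis : orthonormal_basis Lam (time_freq_shift (cindic Om))).

(** Parseval's inequality for the window shifted by [z], a function of norm 1 whose coefficients are
    values of the ambiguity function. *)
Lemma gabor_covering (z : R * R) :
  (1 <= \esum_(l in Lam) (fourier_csq (overlap Om (z.1 - l.1)) (z.2 - l.2))%:E)%E.
Proof.
have bg l := bounded_supported_gabor mOm OmM l.
apply: le_trans (le_trans (parseval_ge basis bg (bg z)) _); last first.
  by apply: le_esum => l _; rewrite (csq_L2inner_gabor mOm OmM).
have -> : \int[mu]_x csq (time_freq_shift (cindic Om) z x) = \int[mu]_x \1_Om (x - z.1).
  apply: eq_Rintegral => x _; rewrite csqM csq_expi mulr1 /csq /cindic /= indicE.
  by case: (_ \in _); rewrite ?expr1n ?expr0n /= addr0.
rewrite (Rintegral_shift (- z.1) (bounded_supported_window mOm OmM)).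
by rewrite /Rintegral integral_window.
Qed.

(* Integrate [gabor_covering] over [A `*` E], shift each term, and bound the
   sum by [integral_ambiguity_le]. *)
Lemma gabor_packing (A E : set R) : measurable A -> measurable E ->
  (forall l l' a a' e e', Lam l -> Lam l' -> A a -> A a' -> E e -> E e' ->
     l.1 - l'.1 = a - a' -> l.2 - l'.2 = e - e' -> l = l') ->
  (mu A * mu E <= 1)%E.
Proof.
move=> mA mE pack.
have [P [en [LamE en_inj]]] := countable_enum (A := Lam) cLam.
pose G (z : RR * RR) := (fourier_csq (overlap Om z.1) z.2)%:E.
have mG : measurable_fun setT G.
  by apply/measurable_EFinP; apply: (measurable_fourier_csq (M := M)).
have G0 z : (0 <= G z)%E by rewrite lee_fin fourier_csq_ge0.
pose chi (z : RR * RR) : R := \1_A z.1 * \1_E z.2.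
have chi0 z : 0 <= chi z by rewrite mulr_ge0.
have mchi : measurable_fun setT chi.
  by apply: measurable_funM; apply: (measurableT_comp (f := \1__ : RR -> R));
    first exact: measurable_indic.
pose p n : R := (P n)%:R.
have p0 n : 0 <= p n by rewrite ler0n.
have msh (l : RR * RR) : measurable_fun setT (fun z : RR * RR => (z.1 + l.1, z.2 + l.2)%R : RR * RR).
  by apply: measurable_fun_pair; apply: measurable_funD.
(* The terms [T n] add up to [chi] times the covering sum; [U n] is [T n] translated by [en n], so
   that the shift is carried by the box and no longer by [G]. *)
pose T n (z : RR * RR) : \bar R := ((p n * chi z)%:E * G (z.1 - (en n).1, z.2 - (en n).2)%R)%E.
pose U n (z : RR * RR) : \bar R := ((p n * chi (z.1 + (en n).1, z.2 + (en n).2)%R)%:E * G z)%E.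
have T0 n z : (0 <= T n z)%E by rewrite mule_ge0// lee_fin mulr_ge0.
have U0 n z : (0 <= U n z)%E by rewrite mule_ge0// lee_fin mulr_ge0.
have mT n : measurable_fun setT (T n).
  apply: emeasurable_funM; first by apply/measurable_EFinP; apply: measurable_funM.
  exact: (measurableT_comp mG (msh (- (en n).1, - (en n).2))).
have mU n : measurable_fun setT (U n).
  apply: emeasurable_funM => //; apply/measurable_EFinP; apply: measurable_funM => //.
  exact: (measurableT_comp mchi (msh (en n))).
have mchiE : measurable_fun setT (EFin \o chi) by exact/measurable_EFinP.
have -> : (mu A * mu E = \int[mu2]_z (chi z)%:E)%E.
  rewrite (fubini_tonelli1 (EFin \o chi))//.
  have -> : fubini_F mu (EFin \o chi) = fun x => ((mu E) * (\1_A x)%:E)%E.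
    apply/funext => x; rewrite /fubini_F /chi /=.
    rewrite -[mu E]mul1e muleC -[E in mu E]setIT -integral_indic// mul1e.
    rewrite -ge0_integralZl//.
    exact/measurable_EFinP/measurable_indic.
  rewrite ge0_integralZl// ?integral_indic ?setIT 1?muleC//.
  exact/measurable_EFinP/measurable_indic.
apply: (@le_trans _ _ (\int[mu2]_z \sum_(n <oo) T n z)%E).
  apply: ge0_le_integral => //.
  - by move=> z _; rewrite lee_fin.
  - exact: ge0_emeasurable_sum.
  - move=> z _.
    have := gabor_covering z; rewrite LamE esum_pred_image//; last first.
      by move=> n _; rewrite lee_fin fourier_csq_ge0.
    rewrite eseries_mkcond.
    have -> : (\sum_(n <oo) T n z = \sum_(n <oo) (chi z)%:E * (if P n then
       G (z.1 - (en n).1, z.2 - (en n).2)%R else 0))%E.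
      apply: eq_eseriesr => n _; rewrite /T /p; case: (P n); first by rewrite mul1r.
      by rewrite mul0r mul0e mule0.
    move=> h; rewrite nneseriesZl ?lee_fin//; last by move=> n _; case: ifP.
    by rewrite -[leLHS]mule1 lee_wpmul2l// lee_fin.
rewrite integral_nneseries//.
have -> : (\sum_(n <oo) \int[mu2]_z T n z = \sum_(n <oo) \int[mu2]_z U n z)%E.
  apply: eq_eseriesr => n _.
  rewrite -(ge0_integral2_shift (en n) (mT n) (T0 n)); apply: eq_integral => z _.
  by rewrite /T /U /= !addrK.
rewrite -integral_nneseries//.
apply: le_trans integral_ambiguity_le.
apply: ge0_le_integral => //.
- by move=> z _; apply: nneseries_ge0.
- exact: ge0_emeasurable_sum.
- move=> z _; rewrite -/(G z).
  (* The translated boxes are disjoint, so at most one term is non-zero at [z], and it equals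
     [G z]. *)
  have [[n0 [Pn0 An0 En0]]|none] := pselect (exists n, [/\ P n, A (z.1 + (en n).1) & E (z.2 + (en n).2)]).
    rewrite (nneseriesD1 (n := n0))//.
    rewrite eseries0 ?adde0; last first.
      move=> n _ /= nn0; rewrite /U /p /chi /=; case: (boolP (P n)) => Pn; last by rewrite mul0r mul0e.
      rewrite !indicE; have [An|] := boolP (_ \in A); last by rewrite !mul0r mulr0 mul0e.
      have [En|] := boolP (_ \in E); last by rewrite !mulr0 mul0e.
      exfalso; move: An En; rewrite !inE => An En.
      move: nn0; apply/negP; rewrite negbK; apply/eqP.
      have L m : P m -> Lam (en m) by move=> Pm; rewrite LamE; exists m.
      apply: en_inj; rewrite ?inE//.
      by apply: (pack _ _ _ _ _ _ (L _ Pn) (L _ Pn0) An An0 En En0); ring.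
    rewrite /U /p /chi Pn0 !indicE !mem_set//= !mulr1 mul1e//.
  rewrite eseries0 => [|n _ _]; first exact: G0.
  rewrite /U /p /chi /=; case: (boolP (P n)) => Pn; last by rewrite mul0r mul0e.
  rewrite !indicE; have [An|] := boolP (_ \in A); last by rewrite !mul0r mulr0 mul0e.
  have [En|] := boolP (_ \in E); last by rewrite !mulr0 mul0e.
  by case: none; exists n; move: An En; rewrite !inE.
Qed.

End Packing.

(** * Zeros of the ambiguity function of two intervals *)

Section Trig.
Context {R : realType}.
Local Notation mu := (@lebesgue_measure R).
Implicit Types (w q l r m a b c d s : R).

(* The integral of a cosine wave over an interval of length L is its value at
   the midpoint times this amplitude. *)
Definition amp w (L : R) : R := if w == 0 then L else 2 * sin (w * L / 2) / w.

Lemma amp0 w : amp w 0 = 0.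
Proof. by rewrite /amp; case: ifP => // _; rewrite mulr0 mul0r sin0 mulr0 mul0r. Qed.

Lemma amp_normr w (L : R) : amp `|w| L = amp w L.
Proof.
rewrite /amp normr_eq0; case: eqP => // w0.
have [//|_] := ger0P w.
by rewrite !mulNr sinN; field; apply/eqP.
Qed.

Lemma amp_gt0 w (L : R) : 0 < L -> `|w| * L < 2 * pi -> 0 < amp w L.
Proof.
rewrite -amp_normr /amp => L0; have := normr_ge0 w.
rewrite le_eqVlt eq_sym; case: eqP => //= _ w0 wL.
rewrite divr_gt0// mulr_gt0// sin_gt0_pi//.
have wL0 : 0 < `|w| * L by rewrite mulr_gt0.
by apply/andP; split; lra.
Qed.

Lemma integral_itv_cos_amp w q l r : l <= r ->
  \int[mu]_x (\1_(`[l, r[) x * cos (w * x + q)) =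
  amp w (r - l) * cos (w * ((l + r) / 2) + q).
Proof.
move=> lr; rewrite /amp; case: eqP => [->|/eqP w0].
  rewrite mul0r add0r.
  have -> : \int[mu]_x (\1_(`[l, r[) x * cos (0 * x + q)) =
            cos q * \int[mu]_x (\1_(`[l, r[) x).
    rewrite -RintegralZl//; last first.
      apply: bounded_supported_integrable.
      apply: (@bounded_supported_indic _ _ (`|l| + `|r|)) => // x /=.
      rewrite in_itv /= => /andP[lx xr]; rewrite ler_norml.
      have := ler_norm l; have := ler_norm r; have := ler_norm (- l).
      have := normr_ge0 r; have := normr_ge0 l.
      by rewrite normrN => *; apply/andP; split; lra.
    by apply: eq_Rintegral => x _; rewrite mul0r add0r mulrC.
  rewrite /Rintegral integral_indic// setIT /= lebesgue_measure_itv /= lte_fin.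
  case: ifPn => [_|]; first by rewrite -EFinD /= mulrC.
  rewrite -leNgt => rl; have -> : r = l by apply/le_anti/andP.
  by rewrite subrr mul0r mulr0.
rewrite Rintegral_itv_cos//.
have -> : w * r + q = (w * ((l + r) / 2) + q) + w * (r - l) / 2 by field.
have -> : w * l + q = (w * ((l + r) / 2) + q) - w * (r - l) / 2 by field.
by rewrite sinD sinB; field.
Qed.

Lemma cosine_wave_eq0 w m a :
  (forall q, a * cos (w * m + q) = 0) -> a = 0.
Proof. by move=> /(_ (- (w * m))); rewrite subrr cos0 mulr1. Qed.

(** Reading the sum at the crest of each wave gives [a + a' * c = 0] and [a * c + a' = 0], where [c]
    is the cosine of the phase difference. As the amplitudes are positive, the waves must be equal
    and opposite. *)
Lemma two_cosine_waves w m m' a a' : 0 < a -> 0 < a' ->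
  (forall q, a * cos (w * m + q) + a' * cos (w * m' + q) = 0) ->
  a = a' /\ cos (`|w| * (m' - m)) = -1.
Proof.
move=> a0 a'0 H.
have -> : cos (`|w| * (m' - m)) = cos (w * (m' - m)).
  by have [//|_] := ger0P w; rewrite mulNr cosN.
have := H (- (w * m)); rewrite subrr cos0 mulr1 -mulrBr => h1.
have := H (- (w * m')); rewrite subrr cos0 mulr1 -mulrBr -opprB mulrN cosN => h2.
move: h1 h2; set c := cos _ => h1 h2.
have c2 : (a' - a) * (1 - c) = 0 by lra.
have c1 : (a + a') * (1 + c) = 0 by lra.
have c3 : c = -1 by move/eqP: c1; rewrite mulf_eq0 => /orP[/eqP|/eqP]; lra.
by split => //; move: h1; rewrite c3; lra.
Qed.

(** The half angles lie in []0, pi[]; two sines there agree at distinct points only if these are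
    symmetric about [pi / 2]. *)
Lemma amp_eq w (L L' : R) : 0 < L -> L < L' -> `|w| * L' < 2 * pi ->
  amp w L = amp w L' -> `|w| * (L + L') = 2 * pi.
Proof.
move=> L0 LL' wL'; rewrite -(amp_normr w) -(amp_normr w L') /amp.
have := normr_ge0 w; rewrite le_eqVlt eq_sym; case: eqP => [_ _ LE|/eqP w0 /= wp].
  by move: LL'; rewrite LE ltxx.
move=> /(congr1 (fun x => x * `|w| / 2)).
have E z : 2 * z / `|w| * `|w| / 2 = z by field.
rewrite !E => /eqP; rewrite -subr_eq0.
have -> : `|w| * L / 2 = `|w| * (L + L') / 4 - `|w| * (L' - L) / 4 by field.
have -> : `|w| * L' / 2 = `|w| * (L + L') / 4 + `|w| * (L' - L) / 4 by field.
rewrite sinB sinD => sE.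
have {}sE : cos (`|w| * (L + L') / 4) * sin (`|w| * (L' - L) / 4) = 0.
  by move/eqP: sE; set x := sin _ * cos _; set y := cos _ * sin _; lra.
have wL : `|w| * L < `|w| * L' by rewrite ltr_pM2l.
have wL0 : 0 < `|w| * L by rewrite mulr_gt0.
have sp : 0 < sin (`|w| * (L' - L) / 4).
  by rewrite sin_gt0_pi// mulrBr; apply/andP; split; lra.
move/eqP: sE; rewrite mulf_eq0 (gt_eqF sp) orbF -(cos_pihalf R) => /eqP cE.
have := cos_inj _ _ cE; rewrite !in_itv /= mulrDr.
have pi0 := pi_gt0 R.
move=> h; have {}h : (`|w| * L + `|w| * L') / 4 = pi / 2.
  by apply: h; apply/andP; split; lra.
lra.
Qed.

Lemma cos_pi_eqN1 (y : R) : 0 <= y -> cos (pi * y) = -1 ->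
  exists k : nat, y = 2 * k%:R + 1.
Proof.
move=> y0 cy.
have [k /andP[k1 k2]] : exists k : nat, k%:R <= y / 2 < k%:R + 1.
  by exists (Num.truncn (y / 2)); rewrite natr1; apply: truncn_itv; lra.
exists k; pose r := y - 2 * k%:R.
have [r0 r2] : 0 <= r /\ r < 2 by rewrite /r; split; lra.
have cr : cos (pi * r) = -1.
  by rewrite -(cos_period k) -cy; congr cos; rewrite /r; ring.
have pi0 := pi_gt0 R.
have pr : 0 <= pi * r by rewrite mulr_ge0// ltW.
suff r1 : r = 1 by move: r1; rewrite /r; lra.
have inj1 (z : R) : 0 <= z <= 1 -> cos (pi * z) = -1 -> z = 1.
  move=> /andP[z0 z1] cz; have := @cos_inj R (pi * z) pi.
  rewrite !in_itv /= cospi cz lexx (ltW pi0) mulr_ge0 ?(ltW pi0)//.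
  have -> : pi * z <= pi by rewrite ger_pMr.
  move=> /(_ isT isT erefl) h; apply: (mulfI (lt0r_neq0 pi0)).
  by rewrite h mulr1.
have [r1|r1] := leP r 1; first by apply: inj1 => //; rewrite r0.
have : 2 - r = 1.
  apply: inj1; first by apply/andP; split; lra.
  rewrite -cr -(cosN (pi * r)) -(cos_period 1 (- _)).
  by congr cos; ring.
by lra.
Qed.

End Trig.

Section TwoIntervals.
Context {R : realType}.
Local Notation mu := (@lebesgue_measure R).
Variables (al be : R).
Hypotheses (al0 : 0 < al) (al2 : al <= 1 / 2) (be0 : 0 < be).
Local Notation Om := (two_intervals al be).
Implicit Types (s w q x : R).

Lemma two_intervalsE x :
  (\1_Om x : R) = \1_(`[0, al[) x + \1_(`[al + be, 1 + be[) x.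
Proof.
have [? ? ?] := And3 al0 al2 be0.
rewrite /two_intervals !indicE in_setU.
have [h1|] := boolP (x \in `[0, al[%classic); have [h2|] := boolP (x \in `[al + be, 1 + be[%classic);
  rewrite ?addr0 ?add0r //.
exfalso; move: h1 h2; rewrite !inE /= !in_itv /= => /andP[? ?] /andP[? ?]; lra.
Qed.

Lemma measurable_two_intervals : measurable Om.
Proof. by apply: measurableU; exact: measurable_itv. Qed.

Lemma two_intervals_bounded x : Om x -> `|x| <= 1 + be.
Proof.
have [? ? ?] := And3 al0 al2 be0.
rewrite /two_intervals /= !in_itv /= ler_norml.
by move=> [|] /andP[? ?]; apply/andP; split; lra.
Qed.

Lemma measure_two_intervals : mu Om = 1%E.
Proof.
have [? ? ?] := And3 al0 al2 be0.
rewrite /two_intervals measureU//=; last first.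
  apply/seteqP; split => // x /=; rewrite !in_itv /= => -[/andP[? ?] /andP[? ?]]; lra.
rewrite !lebesgue_measure_itv /= !lte_fin !ifT//; last by lra.
by rewrite -!EFinD; congr EFin; ring.
Qed.

Lemma integral_shifted_itv s w q a b c d l r : l <= r ->
  (forall x, (a <= x - s < b) && (c <= x < d) = (l <= x < r)) ->
  \int[mu]_x (\1_(`[a, b[) (x - s) * \1_(`[c, d[) x * cos (w * x + q)) =
  amp w (r - l) * cos (w * ((l + r) / 2) + q).
Proof.
move=> lr E; rewrite -integral_itv_cos_amp//; apply: eq_Rintegral => x _.
congr (_ * _); rewrite !indicE -natrM mulnb; congr (_%:R); congr nat_of_bool.
have I u v y : (y \in `[u, v[%classic) = (u <= y < v).
  by apply/idP/idP; rewrite inE /= in_itv.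
by rewrite !I.
Qed.

(** Let A and B be the first and the second interval. For [s >= 0] the shifted A may meet A or B,
    while the shifted B meets only B. Each right end is raised to the left end when the overlap is
    empty, so that the amplitude becomes 0. The ends are given through equations, which lets each
    case supply simplified values. *)
Lemma integral_overlap s w q raa rbb lab rab : 0 <= s ->
  raa = Num.max s al -> rbb = Num.max (al + be + s) (1 + be) ->
  lab = Num.max s (al + be) -> rab = Num.max lab (Num.min (s + al) (1 + be)) ->
  \int[mu]_x (overlap Om s x * cos (w * x + q)) =
  amp w (raa - s) * cos (w * ((s + raa) / 2) + q) +
  amp w (rab - lab) * cos (w * ((lab + rab) / 2) + q) +
  amp w (rbb - (al + be + s)) * cos (w * ((al + be + s + rbb) / 2) + q).
Proof.
have [? ? ?] := And3 al0 al2 be0.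
move=> s0 Eraa Erbb Elab Erab.
have E1 x : overlap Om s x * cos (w * x + q) =
  (\1_(`[0, al[) (x - s) * \1_(`[0, al[) x * cos (w * x + q) +
   \1_(`[0, al[) (x - s) * \1_(`[al + be, 1 + be[) x * cos (w * x + q)) +
  (\1_(`[al + be, 1 + be[) (x - s) * \1_(`[al + be, 1 + be[) x * cos (w * x + q) +
   \1_(`[al + be, 1 + be[) (x - s) * \1_(`[0, al[) x * cos (w * x + q)).
  by rewrite /overlap !two_intervalsE; ring.
have bi a b c d : bounded_supported (fun x => \1_(`[a, b[) (x - s) * \1_(`[c, d[) x * cos (w * x + q)).
  apply: bounded_supportedM; last exact: bounded_measurable_cos.
  have bnd (u v y : R) : `[u, v[%classic y -> `|y| <= `|u| + `|v|.
    rewrite /= in_itv /= => /andP[uy yv]; rewrite ler_norml.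
    have := ler_norm v; have := ler_norm (- u); rewrite normrN.
    have := normr_ge0 u; have := normr_ge0 v => *.
    by apply/andP; split; lra.
  apply: bounded_supportedM.
    by apply: (bounded_supported_window_shift _ (bnd a b)); exact: measurable_itv.
  by apply: bounded_supported_bounded; apply: (bounded_supported_indic _ (bnd c d)).
have bI a b c d := bounded_supported_integrable (bi a b c d).
have bi2 a b c d a' b' c' d' := bounded_supported_integrable (bounded_supportedD (bi a b c d) (bi a' b' c' d')).
under eq_Rintegral do rewrite E1.
rewrite RintegralD//=; [|exact: bi2|exact: bi2].
rewrite !RintegralD//=.
rewrite (@integral_shifted_itv s w q 0 al 0 al (s) raa); last 2 first.
- by rewrite Eraa le_max lexx.
- move=> x; rewrite Eraa lt_max; apply/idP/idP; last first.
    by move=> /andP[? /orP[?|?]]; [lra|]; rewrite -andbA; apply/and4P; split; lra.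
  by rewrite -andbA => /and4P[? ? ? ?]; apply/andP; split; [lra|apply/orP; right; lra].
rewrite (@integral_shifted_itv s w q 0 al (al + be) (1 + be) (lab) rab); last 2 first.
- by rewrite Erab le_max lexx.
- move=> x; rewrite Erab lt_max lt_min Elab ge_max; apply/idP/idP; last first.
    move=> /andP[/andP[? ?] /orP[|/andP[? ?]]].
      by rewrite lt_max => /orP[?|?]; lra.
    by rewrite -andbA; apply/and4P; split; lra.
  rewrite -andbA => /and4P[? ? ? ?]; apply/andP; split; first by apply/andP; split; lra.
  by apply/orP; right; apply/andP; split; lra.
rewrite (@integral_shifted_itv s w q (al + be) (1 + be) (al + be) (1 + be) (al + be + s) rbb); last 2 first.
- by rewrite Erbb le_max lexx.
- move=> x; rewrite Erbb lt_max; apply/idP/idP; last first.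
    by move=> /andP[? /orP[?|?]]; [lra|]; rewrite -andbA; apply/and4P; split; lra.
  by rewrite -andbA => /and4P[? ? ? ?]; apply/andP; split; [lra|apply/orP; right; lra].
rewrite (@integral_shifted_itv s w q (al + be) (1 + be) 0 al (0) 0)//; last first.
  move=> x; have -> : (0 <= x < 0) = false by apply/negP => /andP[? ?]; lra.
  by apply/negP; rewrite -andbA => /and4P[? ? ? ?]; lra.
by rewrite subrr amp0 mul0r addr0.
Qed.

End TwoIntervals.

Section NonVanishing.
Context {R : realType}.
Local Notation mu := (@lebesgue_measure R).
Variables (al be : R).
Hypotheses (al0 : 0 < al) (al2 : al <= 1 / 2) (be0 : 0 < be).
Local Notation Om := (two_intervals al be).
Implicit Types (s w q x nu : R).

(** The equation [V s nu = 0]: ranging over all phases covers both the real and the imaginary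
    part. *)
Definition vanishing s nu : Prop :=
  forall q, \int[mu]_x (overlap Om s x * cos (2 * pi * nu * x + q)) = 0.

Let normw nu : `|2 * pi * nu| = 2 * pi * `|nu|.
Proof. by rewrite normrM ger0_norm// mulr_ge0// pi_ge0. Qed.

Let amp_pos nu (L : R) : 0 < L -> `|nu| * L < 1 -> 0 < amp (2 * pi * nu) L.
Proof.
move=> L0 nL; apply: amp_gt0 => //.
rewrite normw (_ : _ * L = 2 * pi * (`|nu| * L)); last by ring.
have := pi_gt0 R => pi0; rewrite gtr_pMr//; lra.
Qed.

Ltac maxmin :=
  first [by apply/esym/max_idPr; lra | by apply/esym/max_idPl; lra
       | rewrite minEle; case: leP => ?; rewrite maxEle; case: leP => ?; lra].

(** Here and below the name lists the overlaps that are non-empty. For [s <= be] the shifted A does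
    not reach B; the two self-overlaps have midpoints [(1 + 2 * be) / 2] apart, so opposite phases
    mean an odd value of [|nu| * (1 + 2 * be)]. *)
Lemma vanishing_AA_BB s nu : 0 <= s -> s < al -> s <= be ->
  `|nu| * (1 - al - s) < 1 -> vanishing s nu ->
  amp (2 * pi * nu) (al - s) = amp (2 * pi * nu) (1 - al - s) /\
  exists k : nat, `|nu| * (1 + 2 * be) = 2 * k%:R + 1.
Proof.
have [? ? ?] := And3 al0 al2 be0.
move=> s0 sal sbe nL V; set w := 2 * pi * nu.
have L1 : 0 < amp w (al - s).
  apply: amp_pos; first by lra.
  by apply: le_lt_trans nL; rewrite ler_wpM2l//; lra.
have L2 : 0 < amp w (1 - al - s) by apply: amp_pos => //; lra.
have H q : amp w (al - s) * cos (w * ((s + al) / 2) + q) +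
           amp w (1 - al - s) * cos (w * ((al + be + s + (1 + be)) / 2) + q) = 0.
  rewrite -[RHS](V q) (@integral_overlap R al be al0 al2 be0 s w q al (1 + be) (al + be) (al + be))//.
  - rewrite subrr amp0 mul0r addr0; congr (_ + amp w _ * _); lra.
  - maxmin.
  - maxmin.
  - maxmin.
  - maxmin.
have [-> c1] := two_cosine_waves L1 L2 H; split => //.
apply: cos_pi_eqN1; first by rewrite mulr_ge0//; lra.
rewrite -c1 normw; congr cos; by field.
Qed.

Lemma nonvanishing_BB s nu : al <= s -> s < 1 - al -> s <= be ->
  `|nu| * (1 - al - s) < 1 -> ~ vanishing s nu.
Proof.
have [? ? ?] := And3 al0 al2 be0.
move=> sal s1 sbe nL V; set w := 2 * pi * nu.
have L2 : 0 < amp w (1 - al - s) by apply: amp_pos => //; lra.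
have H q : amp w (1 - al - s) * cos (w * ((al + be + s + (1 + be)) / 2) + q) = 0.
  rewrite -[RHS](V q) (@integral_overlap R al be al0 al2 be0 s w q s (1 + be) (al + be) (al + be))//.
  - rewrite !subrr amp0 !mul0r !add0r; congr (amp w _ * _); lra.
  - lra.
  - maxmin.
  - maxmin.
  - maxmin.
  - maxmin.
by move: L2; rewrite (cosine_wave_eq0 H) ltxx.
Qed.

Lemma nonvanishing_AB s nu : 1 - al <= s -> be < s -> s < 1 + be ->
  `|nu| * al < 1 -> ~ vanishing s nu.
Proof.
have [? ? ?] := And3 al0 al2 be0.
move=> s1 sbe s2 nL V; set w := 2 * pi * nu.
pose l := Num.max s (al + be); pose r := Num.min (s + al) (1 + be).
have [lr rl] : l < r /\ r - l <= al.
  by rewrite /l /r; case: (leP s (al + be)) => ?; case: (leP (s + al) (1 + be)) => ?; split; lra.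
have L : 0 < amp w (r - l).
  apply: amp_pos; first by lra.
  by apply: le_lt_trans nL; rewrite ler_wpM2l.
have H q : amp w (r - l) * cos (w * ((l + r) / 2) + q) = 0.
  rewrite -[RHS](V q) (@integral_overlap R al be al0 al2 be0 s w q s (al + be + s) l r)//.
  - by rewrite !subrr amp0 !mul0r addr0 add0r.
  - lra.
  - maxmin.
  - maxmin.
  - by rewrite -/r; apply/esym/max_idPr; exact: ltW.
by move: L; rewrite (cosine_wave_eq0 H) ltxx.
Qed.

(** The midpoints are [(1 + 2 * be - l) / 2] apart, so cancellation would make
    [|nu| * (1 + 2 * be - l)] an odd integer, but it is less than 1 because [l >= al + be]. *)
Lemma nonvanishing_AB_BB s nu : al <= s -> s < 1 - al -> be < s ->
  `|nu| <= 1 -> `|nu| * (1 + be - al) < 1 -> ~ vanishing s nu.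
Proof.
have [? ? ?] := And3 al0 al2 be0.
move=> sal s1 sbe n1 nL V; set w := 2 * pi * nu.
pose l := Num.max s (al + be).
have [l1 l2 l3] : [/\ s <= l, al + be <= l & l < s + al].
  by rewrite /l; case: (leP s (al + be)) => ?; split; lra.
have lt1 (L : R) : L < 1 -> `|nu| * L < 1.
  move=> L1; have [L0|L0] := leP L 0; first by apply: (@le_lt_trans _ _ 0) => //; rewrite mulr_ge0_le0.
  by apply: le_lt_trans L1; rewrite ger_pMl.
have L1 : 0 < amp w (s + al - l) by apply: amp_pos; [lra|apply: lt1; lra].
have L2 : 0 < amp w (1 - al - s) by apply: amp_pos; [lra|apply: lt1; lra].
have H q : amp w (s + al - l) * cos (w * ((l + (s + al)) / 2) + q) +
           amp w (1 - al - s) * cos (w * ((al + be + s + (1 + be)) / 2) + q) = 0.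
  rewrite -[RHS](V q) (@integral_overlap R al be al0 al2 be0 s w q s (1 + be) l (s + al))//.
  - by rewrite subrr amp0 mul0r add0r; congr (_ + amp w _ * _); lra.
  - lra.
  - maxmin.
  - maxmin.
  - maxmin.
have [_] := two_cosine_waves L1 L2 H.
rewrite normw.
have -> : 2 * pi * `|nu| * ((al + be + s + (1 + be)) / 2 - (l + (s + al)) / 2) =
  pi * (`|nu| * (1 + 2 * be - l)) by field.
move=> /cos_pi_eqN1; case; first by rewrite mulr_ge0//; lra.
move=> k kE.
have : `|nu| * (1 + 2 * be - l) < 1.
  by apply: le_lt_trans nL; rewrite ler_wpM2l//; lra.
have := ler0n R k; rewrite kE; lra.
Qed.

Lemma sinMsin x y : 2 * (sin x * sin y) = cos (x - y) - cos (x + y).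
Proof. by rewrite cosB cosD; ring. Qed.

(** At a phase where the AB wave vanishes, product formulas turn the cancellation of the other two
    into [sin (w * (1 + be - s) / 2) * sin (w * (1 - 2 * al) / 2) = 0]. Both lengths lie in []0,
    1[], so neither sine vanishes when [|nu| <= 1] and [nu] is non-zero; at [nu = 0] the integral is
    a positive length. *)
Lemma nonvanishing_AA_AB_BB s nu : be < s -> s < al -> al < 1 / 2 ->
  `|nu| <= 1 -> ~ vanishing s nu.
Proof.
have [? ? ?] := And3 al0 al2 be0.
move=> sbe sal al3 n1 V; pose w := 2 * pi * nu.
have H q : amp w (al - s) * cos (w * ((s + al) / 2) + q) +
           amp w (s - be) * cos (w * ((al + be + (s + al)) / 2) + q) +
           amp w (1 - al - s) * cos (w * ((al + be + s + (1 + be)) / 2) + q) = 0.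
  rewrite -[RHS](V q) (@integral_overlap R al be al0 al2 be0 s w q al (1 + be) (al + be) (s + al))//.
  - congr (_ + amp w _ * _ + amp w _ * _); lra.
  - lra.
  - maxmin.
  - maxmin.
  - maxmin.
  - maxmin.
have [w0|w0] := eqVneq w 0.
  have := H 0; rewrite /amp w0 eqxx !mul0r !addr0 cos0 !mulr1; lra.
have := H (pi / 2 - w * ((al + be + (s + al)) / 2)).
have -> : w * ((al + be + (s + al)) / 2) + (pi / 2 - w * ((al + be + (s + al)) / 2)) =
  pi / 2 by ring.
rewrite cos_pihalf mulr0 addr0.
have -> : w * ((s + al) / 2) + (pi / 2 - w * ((al + be + (s + al)) / 2)) =
  - (w * (al + be) / 2) + pi / 2 by field.
have -> : w * ((al + be + s + (1 + be)) / 2) + (pi / 2 - w * ((al + be + (s + al)) / 2)) =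
  w * (1 + be - al) / 2 + pi / 2 by field.
rewrite !cosDpihalf sinN opprK /amp (negPf w0).
move=> /(congr1 (fun x => x * w)); rewrite mul0r => h.
have {}h : 2 * (sin (w * (al - s) / 2) * sin (w * (al + be) / 2)) =
       2 * (sin (w * (1 - al - s) / 2) * sin (w * (1 + be - al) / 2)).
  apply/eqP; rewrite -subr_eq0 -h; apply/eqP; by field.
move: h; rewrite !sinMsin => h.
have {}h : sin (w * (1 + be - s) / 2) * sin (w * (1 - 2 * al) / 2) = 0.
  suff : 2 * (sin (w * (1 + be - s) / 2) * sin (w * (1 - 2 * al) / 2)) = 0 by lra.
  rewrite sinMsin.
  have E1 : w * (1 + be - s) / 2 - w * (1 - 2 * al) / 2 = w * (al - s) / 2 + w * (al + be) / 2 by field.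
  have E2 : w * (1 + be - s) / 2 + w * (1 - 2 * al) / 2 = w * (1 - al - s) / 2 + w * (1 + be - al) / 2 by field.
  have E3 : w * (al - s) / 2 - w * (al + be) / 2 = w * (1 - al - s) / 2 - w * (1 + be - al) / 2 by field.
  by rewrite E1 E2; move: h; rewrite E3; lra.
have S (L : R) : 0 < L -> L < 1 -> sin (w * L / 2) != 0.
  move=> L0 L1.
  have wp : 0 < `|w| by rewrite normr_gt0.
  have pi0 := pi_gt0 R.
  have wL : `|w| * L / 2 < pi.
    rewrite normw (_ : _ / 2 = pi * (`|nu| * L)); last by field.
    by rewrite gtr_pMr//; apply: le_lt_trans L1; rewrite ger_pMl.
  have : 0 < sin (`|w| * L / 2).
    by rewrite sin_gt0_pi// wL andbT divr_gt0// mulr_gt0.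
  have [//|_] := ger0P w; first by move=> ? /lt0r_neq0.
  by rewrite !mulNr sinN oppr_gt0 => /ltr0_neq0.
by move/eqP: h; rewrite mulf_eq0 => /orP[]; apply/negP; apply: S; lra.
Qed.

End NonVanishing.

(** * The condition is necessary for Gabor bases *)

Section Necessity.
Context {R : realType}.
Local Notation mu := (@lebesgue_measure R).
Implicit Types (al be s x nu : R).

(** Exchanging [l] and [l'] changes the sign of both differences, so only shifts [s >= 0] have to be
    examined. *)
Lemma packing_of_nonvanishing al be (Lam : set (R * R)) (A E : set R) :
  0 < al -> al <= 1 / 2 -> 0 < be ->
  countable Lam ->
  orthonormal_basis Lam (time_freq_shift (cindic (two_intervals al be))) ->
  measurable A -> measurable E ->
  (forall a a' e e', A a -> A a' -> E e -> E e' -> 0 <= a - a' ->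
     ~ vanishing al be (a - a') (e - e')) ->
  (mu A * mu E <= 1)%E.
Proof.
move=> al0 al2 be0 cL bL mA mE nv.
have mOm := measurable_two_intervals al be.
have bOm := two_intervals_bounded al0 al2 be0.
apply: (gabor_packing mOm bOm (measure_two_intervals al0 al2 be0) cL bL mA mE).
move=> l l' a a' e e' Ll Ll' Aa Aa' Ee Ee' E1 E2.
have [//|ll'] := eqVneq l l'; exfalso.
have [_ orth _] := bL.
have van (z z' : R * R) : Lam z -> Lam z' -> z != z' ->
    vanishing al be (z.1 - z'.1) (z.2 - z'.2).
  move=> Lz Lz' zz' q; apply: (gabor_orthogonal mOm bOm).
  by rewrite orth// (negPf zz').
have [s0|s0] := leP 0 (a - a').
  by apply: (nv a a' e e') => //; rewrite -E1 -E2; apply: van.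
apply: (nv a' a e' e) => //; first by lra.
have -> : a' - a = l'.1 - l.1 by rewrite -opprB -E1 opprB.
have -> : e' - e = l'.2 - l.2 by rewrite -opprB -E2 opprB.
by apply: van; rewrite // eq_sym.
Qed.

Lemma measure_itv_co (a b : R) : a <= b -> mu `[a, b[%classic = (b - a)%:E.
Proof.
rewrite le_eqVlt => /predU1P[->|ab]; first by rewrite set_itvco0 measure0 subrr.
by rewrite lebesgue_measure_itv /= lte_fin ab -EFinD.
Qed.

Lemma itv_diff_lt (h e e' : R) : `[0, h[%classic e -> `[0, h[%classic e' -> `|e - e'| < h.
Proof.
rewrite /= !in_itv /= => /andP[? ?] /andP[? ?]; rewrite ltr_norml.
by apply/andP; split; lra.
Qed.

Lemma two_intervals_diff al be a a' : 0 < al -> al <= 1 / 2 -> 0 < be ->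
  two_intervals al be a -> two_intervals al be a' -> 0 <= a - a' ->
  a - a' < 1 - al \/ be < a - a' < 1 + be.
Proof.
move=> al0 al2 be0; rewrite /two_intervals /= !in_itv /=.
move=> [/andP[? ?]|/andP[? ?]] [/andP[? ?]|/andP[? ?]] ?.
- by left; lra.
- by left; lra.
- by right; apply/andP; split; lra.
- by left; lra.
Qed.

(** From [be = 1 - al] on, the overlaps AB and BB no longer coexist. Below this value a
    contradiction arises for every [be], above it for every [be] that is not an integer. *)
Lemma gabor_natural_gap al be (Lam : set (R * R)) : 0 < al -> al < 1 / 2 -> 0 < be ->
  countable Lam ->
  orthonormal_basis Lam (time_freq_shift (cindic (two_intervals al be))) ->
  exists n : nat, (0 < n)%N /\ be = n%:R.
Proof.
move=> al0 al2 be0 cL bL; have al2' := ltW al2.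
have [b1|b1] := ltP be (1 - al).
  (* Take [A = `[0, 1 + be[] and [E = `[0, h[]; then [|A| |E| > 1]. *)
  exfalso.
  (* [h <= 1] gives [|nu| < 1], and [h * (1 + be - al) <= 1] rules out cancellation between AB and
     BB; the area [(1 + be) * h] still exceeds 1. *)
  pose h := Num.min 1 (1 + be - al)^-1.
  have d0 : 0 < 1 + be - al by lra.
  have [h1 h2 h3] : [/\ h <= 1, h * (1 + be - al) <= 1 & 1 < (1 + be) * h].
    rewrite /h; case: (leP 1 (1 + be - al)^-1) => hh.
      by move: hh; rewrite invf_ge1// => hh; split=> //; lra.
    split; [exact: ltW|by rewrite mulVf// lt0r_neq0|].
    by rewrite ltr_pdivlMr//; lra.
  have h0 : 0 < h by rewrite /h lt_min ltr01 invr_gt0.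
  have := @packing_of_nonvanishing al be Lam `[0, (1 + be)[%classic `[0, h[%classic al0 al2' be0 cL bL.
  rewrite !measure_itv_co ?(ltW h0)//; last by lra.
  rewrite -EFinM lee_fin !subr0 leNgt h3 => /(_ _ _ _)/notF; apply => //.
  move=> a a' e e' Aa Aa' Ee Ee' s0.
  have nh := itv_diff_lt Ee Ee'.
  have := itv_diff_lt Aa Aa'; rewrite ger0_norm//.
  move: (a - a') (e - e') s0 nh => s nu s0 nh s1 V.
  have n1 : `|nu| < 1 by lra.
  have nb : `|nu| * (1 + be - al) < 1.
    by apply: lt_le_trans h2; rewrite ltr_pM2r.
  have lt1 (L : R) : L <= 1 -> `|nu| * L < 1.
    move=> L1; have [L0|L0] := leP L 0; first by apply: (@le_lt_trans _ _ 0) => //; rewrite mulr_ge0_le0.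
    by apply: lt_le_trans L1; rewrite gtr_pMl.
  have [sal|sal] := ltP s al.
    have [sbe|sbe] := leP s be.
      have nL : `|nu| * (1 - al - s) < 1 by apply: lt1; lra.
      (* Equal amplitudes would force [|nu| * (1 - 2 * s) = 1], which [|nu| < 1] forbids. *)
      have [E _] := vanishing_AA_BB al0 al2' be0 s0 sal sbe nL V.
      have w1 : `|2 * pi * nu| * (1 - al - s) < 2 * pi.
        rewrite normrM ger0_norm ?mulr_ge0 ?pi_ge0// -[ltLHS]mulrA.
        by rewrite gtr_pMr// mulr_gt0// pi_gt0.
      have := amp_eq _ _ w1 E.
      have -> : al - s + (1 - al - s) = 1 - 2 * s by ring.
      rewrite normrM (@ger0_norm _ (2 * pi)) ?mulr_ge0 ?pi_ge0// -mulrA.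
      move=> h'; have {}h' : 2 * pi * (`|nu| * (1 - 2 * s)) = 2 * pi by apply: h'; lra.
      have pi2 : 2 * pi != 0 :> R by rewrite mulf_neq0// lt0r_neq0// pi_gt0.
      have : `|nu| * (1 - 2 * s) < 1 by apply: lt1; lra.
      suff -> : `|nu| * (1 - 2 * s) = 1 by rewrite ltxx.
      by apply: (mulfI pi2); rewrite h' mulr1.
    exact: (nonvanishing_AA_AB_BB al0 al2' be0 sbe sal al2 (ltW n1) V).
  have [s2|s2] := ltP s (1 - al).
    have [sbe|sbe] := leP s be.
      by apply: (nonvanishing_BB al0 al2' be0 sal s2 sbe _ V); apply: lt1; lra.
    exact: (nonvanishing_AB_BB al0 al2' be0 sal s2 sbe (ltW n1) nb V).
  by apply: (nonvanishing_AB al0 al2' be0 s2 _ s1 _ V); [lra|apply: lt1; lra].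
have [K /andP[K1 K2]] : exists K : nat, K%:R <= be < K%:R + 1.
  by exists (Num.truncn be); rewrite natr1; apply: truncn_itv; exact: ltW.
move: K1; rewrite le_eqVlt => /predU1P[KE|K1].
  by exists K; split => //; move: be0; rewrite -KE ltr0n.
(* Take [A = Omega] and [E = `[0, h[] with [h > 1] so small that [|nu| < h],
   [|nu| (1 - 2 s) = 1] and [|nu| (1 + 2 be)] odd are incompatible. *)
exfalso.
(* [1 + 2 * be] lies strictly between the consecutive odd numbers [2 * K + 1] and [2 * K + 3]; the
   second bound keeps [|nu| * (1 + 2 * be)] below the larger one, the first keeps the amplitudes
   positive. *)
pose h := Num.min (1 - al)^-1 ((2 * K%:R + 3) / (1 + 2 * be)).
have d1 : 0 < 1 - al by lra.
have d2 : 0 < 1 + 2 * be by lra.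
have [h1 h2 h3] : [/\ h * (1 - al) <= 1, h * (1 + 2 * be) <= 2 * K%:R + 3 & 1 < h].
  split.
  - by rewrite -ler_pdivlMr// div1r /h ge_min lexx.
  - by rewrite -ler_pdivlMr// /h ge_min lexx orbT.
  - rewrite /h lt_min; apply/andP; split; first by rewrite -div1r ltr_pdivlMr//; lra.
    by rewrite ltr_pdivlMr//; lra.
have := @packing_of_nonvanishing al be Lam (two_intervals al be) `[0, h[%classic al0 al2' be0 cL bL.
rewrite measure_two_intervals// measure_itv_co; last by lra.
rewrite mul1e lee_fin subr0 leNgt h3 => /(_ _ _ _)/notF; apply => //.
  exact: measurable_two_intervals.
move=> a a' e e' Aa Aa' Ee Ee' s0.
have nh := itv_diff_lt Ee Ee'.
have := two_intervals_diff al0 al2' be0 Aa Aa' s0.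
move: (a - a') (e - e') s0 nh => s nu s0 nh s1 V.
have n1 : `|nu| * (1 - al) < 1 by apply: lt_le_trans h1; rewrite ltr_pM2r.
have lt1 (L : R) : L <= 1 - al -> `|nu| * L < 1.
  by move=> L1; apply: le_lt_trans n1; rewrite ler_wpM2l.
have [sal|sal] := ltP s al; last first.
  case: s1 => [s1|/andP[s1 s2]].
    by apply: (nonvanishing_BB al0 al2' be0 sal s1 _ _ V); [lra|apply: lt1; lra].
  by apply: (nonvanishing_AB al0 al2' be0 _ s1 s2 _ V); [lra|apply: lt1; lra].
have sbe : s <= be by lra.
have nL : `|nu| * (1 - al - s) < 1 by apply: lt1; lra.
have [E [k kE]] := vanishing_AA_BB al0 al2' be0 s0 sal sbe nL V.
have w1 : `|2 * pi * nu| * (1 - al - s) < 2 * pi.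
  rewrite normrM ger0_norm ?mulr_ge0 ?pi_ge0// -[ltLHS]mulrA.
  by rewrite gtr_pMr// mulr_gt0// pi_gt0.
have := amp_eq _ _ w1 E.
have -> : al - s + (1 - al - s) = 1 - 2 * s by ring.
rewrite normrM (@ger0_norm _ (2 * pi)) ?mulr_ge0 ?pi_ge0// -mulrA.
move=> h'; have {}h' : 2 * pi * (`|nu| * (1 - 2 * s)) = 2 * pi by apply: h'; lra.
have pi2 : 2 * pi != 0 :> R by rewrite mulf_neq0// lt0r_neq0// pi_gt0.
have {}h' : `|nu| * (1 - 2 * s) = 1 by apply: (mulfI pi2); rewrite h' mulr1.
(* Hence [|nu| * (1 + 2 * be)] also stays above [2 * K + 1], and cannot be odd. *)
have nu1 : 1 <= `|nu| by rewrite -h' ler_piMr//; lra.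
have lo : 1 + 2 * be <= 2 * k%:R + 1 by rewrite -kE ler_peMl//; lra.
have hi : 2 * k%:R + 1 < 2 * K%:R + 3 :> R.
  by rewrite -kE; apply: lt_le_trans h2; rewrite ltr_pM2r.
have : K%:R < k%:R :> R by lra.
have : k%:R < K.+1%:R :> R by rewrite -natr1; lra.
by rewrite !ltr_nat ltnS leqNgt => /negP.
Qed.

(** Both intervals have length [1 / 2], so the amplitudes agree at every frequency and only the
    phase condition can be violated: [|nu| * p] must not be odd, for [p = 1 + 2 * be]. If [p] is an
    integer then [be] is a half-integer. *)
Lemma gabor_half_natural_gap be (Lam : set (R * R)) : 1 / 2 <= be ->
  countable Lam ->
  orthonormal_basis Lam (time_freq_shift (cindic (two_intervals (1 / 2) be))) ->
  exists n : nat, (0 < n)%N /\ be = n%:R / 2.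
Proof.
move=> be2 cL bL; set al : R := 1 / 2 in bL.
have al0 : 0 < al by rewrite /al; lra.
have al2 : al <= 1 / 2 by [].
have alE : al = 1 / 2 by [].
have be0 : 0 < be by lra.
pose p := 1 + 2 * be.
have p2 : 2 <= p by rewrite /p; lra.
have [N /andP[N1 N2]] : exists N : nat, N%:R <= p < N%:R + 1.
  by exists (Num.truncn p); rewrite natr1; apply: truncn_itv; lra.
move: N1; rewrite le_eqVlt => /predU1P[NE|N1].
  have N2' : (2 <= N)%N by rewrite -(ler_nat R) NE.
  exists N.-1; split; first by case: N N2' {NE N2} => [|[]].
  have -> : N.-1%:R = p - 1 :> R by rewrite -NE -subn1 natrB//; case: N N2' {NE N2}.
  by rewrite /p; lra.
(* Take [A = Omega] and [E] the frequencies in `[0, 2[ at which the floor of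
   [p nu] is even: two of them never differ by an odd multiple of [p^-1]. *)
exfalso.
have p0 : 0 < p by lra.
(* The pieces of index below [N] are complete, of length [1 / p]. The piece of index [N] starts
   before 2 and may be cut there; what is left of it still raises the measure of [E] above 1. *)
pose r (j : nat) := Num.min ((2 * j%:R + 1) / p) 2.
pose I (j : nat) : set R := `[2 * j%:R / p, r j[%classic.
pose E : set R := \big[setU/set0]_(j < N.+1) I j.
have EI e : E e -> exists j : nat, 2 * j%:R <= e * p < 2 * j%:R + 1 /\ 0 <= e < 2.
  rewrite /E -bigcup_mkord => -[j _]; rewrite /I /r /= in_itv /= lt_min.
  move=> /and3P[h1 h2 h3]; exists j; split; last first.
    by rewrite h3 andbT; apply: le_trans h1; rewrite divr_ge0// ?mulr_ge0// ltW.
  by move: h1 h2; rewrite ler_pdivrMr// ltr_pdivlMr// => -> ->.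
have mI j : measurable (I j) by exact: measurable_itv.
have mE : measurable E by apply: bigsetU_measurable.
have muE : mu E = (\sum_(j < N.+1) mu (I j))%E.
  rewrite /E measure_bigsetU//.
  apply/trivIsetP => i j _ _; rewrite neq_ltn => ij.
  apply/seteqP; split => // x [] /=; rewrite /I /r /= !in_itv /= !lt_min.
  move=> /and3P[i1 i2 _] /and3P[j1 j2 _].
  move: i1 i2 j1 j2; rewrite !ler_pdivrMr// !ltr_pdivlMr// => i1 i2 j1 j2.
  case/orP : ij; rewrite -(ler_nat R) -natr1; lra.
have muI (j : nat) : (j < N)%N -> mu (I j) = (p^-1)%:E.
  rewrite -(ler_nat R) -natr1 => jN.
  rewrite /I (_ : r j = (2 * j%:R + 1) / p).
    rewrite measure_itv_co; last by rewrite ler_pM2r ?invr_gt0//; lra.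
    by congr EFin; field; exact: lt0r_neq0.
  by rewrite /r; apply/min_idPl; rewrite ler_pdivrMr//; lra.
have := @packing_of_nonvanishing al be Lam (two_intervals al be) E al0 al2 be0 cL bL.
rewrite measure_two_intervals// mul1e muE big_ord_recr /=.
under eq_bigr => j _ do rewrite muI//.
have rN : 2 * N%:R / p <= r N.
  rewrite /r le_min; apply/andP; split; first by rewrite ler_pM2r ?invr_gt0//; lra.
  by rewrite ler_pdivrMr//; lra.
rewrite measure_itv_co// sumEFin -EFinD lee_fin sumr_const card_ord -[_ *+ N]mulr_natl.
rewrite (_ : _ <= 1 = false); last first.
  apply/negbTE; rewrite -ltNge /r; case: (leP ((2 * N%:R + 1) / p) 2) => hh.
    have -> : N%:R / p + ((2 * N%:R + 1) / p - 2 * N%:R / p) = (N%:R + 1) / p.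
      by field; exact: lt0r_neq0.
    by rewrite ltr_pdivlMr// mul1r.
  have : N%:R / p < 1 by rewrite ltr_pdivrMr// mul1r.
  have -> : 2 * N%:R / p = 2 * (N%:R / p) by field; exact: lt0r_neq0.
  lra.
move=> /(_ _ _ _)/notF; apply => //.
  exact: measurable_two_intervals.
move=> a a' e e' Aa Aa' Ee Ee' s0.
have [j [jE je]] := EI _ Ee; have [j' [jE' je']] := EI _ Ee'.
have := two_intervals_diff al0 al2 be0 Aa Aa' s0.
have nh : `|e - e'| < 2.
  by move/andP: je => [? ?]; move/andP: je' => [? ?]; rewrite ltr_norml; apply/andP; split; lra.
have nodd (k : nat) : `|e - e'| * p <> 2 * k%:R + 1.
  move/andP: jE => [? ?]; move/andP: jE' => [? ?].
  (* Points whose floors are [2 * i] and [2 * i'] and which differ by [2 * k + 1] would put the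
     integer [i - i'] strictly between [k] and [k + 1]. *)
  have key (i i' : nat) (x x' : R) : 2 * i%:R <= x * p -> x * p < 2 * i%:R + 1 ->
      2 * i'%:R <= x' * p -> x' * p < 2 * i'%:R + 1 -> (x - x') * p <> 2 * k%:R + 1.
    move=> h1 h2 h3 h4 h5.
    have : i'%:R + k%:R < i%:R :> R by lra.
    have : i%:R < (i' + k).+1%:R :> R by rewrite -natr1 natrD; lra.
    by rewrite -natrD !ltr_nat ltnS leqNgt => /negP.
  by have [_|_] := ger0P (e - e'); [apply: (key j j')|rewrite opprB; apply: (key j' j)].
move: (a - a') (e - e') s0 nh nodd => s nu s0 nh nodd s1 V.
have lt1 (L : R) : L <= 1 / 2 -> `|nu| * L < 1.
  move=> L1; apply: (@le_lt_trans _ _ (`|nu| * (1 / 2))); first by rewrite ler_wpM2l.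
  by lra.
have [sal|sal] := ltP s al.
  have sbe : s <= be by lra.
  have nL : `|nu| * (1 - al - s) < 1 by apply: lt1; lra.
  have [_ [k kE]] := vanishing_AA_BB al0 al2 be0 s0 sal sbe nL V.
  exact: (nodd k).
case: s1 => [s1|/andP[s1 s2]]; first by lra.
by apply: (nonvanishing_AB al0 al2 be0 _ s1 s2 _ V); [lra|apply: lt1; lra].
Qed.

End Necessity.

(** * The condition is necessary for tilings *)

Section ExactTiling.
Context {R : realType}.
Local Notation mu := (@lebesgue_measure R).
Implicit Types (al be x y t : R) (T : set R).

Definition exact_tiling al be T : Prop :=
  (forall x, exists2 t, T t & two_intervals al be (x - t)) /\
  (forall x t t', T t -> T t' -> two_intervals al be (x - t) ->
     two_intervals al be (x - t') -> t = t').

Lemma two_intervalsP al be x :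
  two_intervals al be x <-> (0 <= x < al) || (al + be <= x < 1 + be).
Proof.
rewrite /two_intervals /= !in_itv /=; split; first by move=> [->|->]; rewrite ?orbT.
by move=> /orP; tauto.
Qed.

Lemma ae_exists_itv (P : R -> Prop) (a b : R) : {ae mu, forall x, P x} ->
  a < b -> exists2 x, a <= x < b & P x.
Proof.
move=> [N [mN N0 PN]] ab; apply: contrapT => none.
have sub : `[a, b[%classic `<=` N.
  move=> x /=; rewrite in_itv /= => xab; apply: PN => /= Px.
  by apply: none; exists x.
have : (mu `[a, b[%classic <= mu N)%E.
  by apply: le_measure => //; rewrite inE //; exact: measurable_itv.
by rewrite N0 measure_itv_co ?(ltW ab)// lee_fin subr_le0 leNgt ab.
Qed.

Lemma esum_indic_ex (A T : set R) y :
  \esum_(t in T) (\1_A (y - t) : R)%:E = 1%E -> exists2 t, T t & A (y - t).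
Proof.
move=> E; apply: contrapT => none; move: E; rewrite esum1.
  by move=> /eqP; rewrite eq_sym onee_eq0.
move=> t Tt; rewrite indicE memNset// => Ayt.
by apply: none; exists t.
Qed.

Lemma esum_indic_unique (A T : set R) y t t' :
  \esum_(t in T) (\1_A (y - t) : R)%:E = 1%E -> T t -> T t' ->
  A (y - t) -> A (y - t') -> t = t'.
Proof.
move=> E Tt Tt' At At'; apply/eqP/negPn/negP => tt'.
have : (2%:E <= \esum_(t in T) (\1_A (y - t) : R)%:E)%E.
  apply: esum_ge; exists [set` [:: t; t']].
    split; first exact: finite_seq.
    by move=> u /=; rewrite !inE => /orP[] /eqP ->.
  rewrite -fsbig_seq /=; last by rewrite inE tt'.
  by rewrite big_cons big_seq1 !indicE !mem_set.
by rewrite E lee_fin; lra.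
Qed.

Lemma two_intervals_right_open al be x : two_intervals al be x ->
  exists2 d : R, 0 < d & forall y, x <= y < x + d -> two_intervals al be y.
Proof.
move=> /two_intervalsP/orP[/andP[? ?]|/andP[? ?]].
  exists (al - x); first by lra.
  by move=> y /andP[? ?]; apply/two_intervalsP/orP; left; apply/andP; split; lra.
exists (1 + be - x); first by lra.
by move=> y /andP[? ?]; apply/two_intervalsP/orP; right; apply/andP; split; lra.
Qed.

(** The second interval has length [1 - al >= 1 / 2], so its translates by points closer than
    [1 / 2] overlap. *)
Lemma tiling_separated al be T : 0 < al -> al <= 1 / 2 -> 0 < be ->
  (forall x t t', T t -> T t' -> two_intervals al be (x - t) ->
     two_intervals al be (x - t') -> t = t') ->
  forall t t', T t -> T t' -> `|t - t'| < 1 / 2 -> t = t'.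
Proof.
move=> al0 al2 be0 uT.
suff H t t' : T t -> T t' -> t <= t' -> t' - t < 1 / 2 -> t = t'.
  move=> t t' Tt Tt'; have [tt'|tt'] := leP t t'.
    by rewrite ler0_norm ?subr_le0// opprB; exact: H.
  by rewrite gtr0_norm ?subr_gt0// => h; apply/esym; apply: H => //; exact: ltW.
move=> Tt Tt' tt' d; apply: (uT (t' + al + be)) => //; apply/two_intervalsP/orP; right;
  by apply/andP; split; lra.
Qed.

Lemma tiling_exact al be T : 0 < al -> al <= 1 / 2 -> 0 < be ->
  {ae mu, forall x : R,
      \esum_(t in T) (\1_(two_intervals al be) (x - t) : R)%:E = 1%E} ->
  exact_tiling al be T.
Proof.
move=> al0 al2 be0 ae.
have uT x t t' : T t -> T t' -> two_intervals al be (x - t) ->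
     two_intervals al be (x - t') -> t = t'.
  move=> Tt Tt' /two_intervals_right_open[d d0 h] /two_intervals_right_open[d' d'0 h'].
  have [|y /andP[y1 y2] Ey] := ae_exists_itv (a := x) (b := x + Num.min d d') ae.
    by rewrite ltrDl lt_min d0.
  have : y - x < Num.min d d' by lra.
  rewrite lt_min => /andP[? ?].
  apply: (esum_indic_unique Ey) => //; [apply: h|apply: h']; apply/andP; split; lra.
split => // x; apply: contrapT => none.
have sep := tiling_separated al0 al2 be0 uT.
(* A translate covering points just after an uncovered [x] must have an interval that opens to the
   right of [x]. Separation leaves a gap free of such openings, so a whole right neighbourhood would
   be uncovered. *)
have gap z : exists2 e : R, 0 < e & forall t, T t -> ~ (z < t < z + e).
  have [[t [Tt /andP[zt tz]]]|no] := pselect (exists t, T t /\ z < t < z + 1 / 2).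
    exists (t - z); first by lra.
    move=> t' Tt' /andP[zt' t'z]; have E : t = t'.
      by apply: sep => //; rewrite gtr0_norm; lra.
    by move: t'z; rewrite E; lra.
  by exists (1 / 2); [lra|move=> t Tt zt; apply: no; exists t].
have [e1 e10 g1] := gap x; have [e2 e20 g2] := gap (x - al - be).
have [|y /andP[y1 y2] /esum_indic_ex[t Tt]] :=
    ae_exists_itv (a := x) (b := x + Num.min e1 e2) ae.
  by rewrite ltrDl lt_min e10.
have : y - x < Num.min e1 e2 by lra.
rewrite lt_min => /andP[? ?] /two_intervalsP/orP[/andP[? ?]|/andP[? ?]].
  have [xt|xt] := ltP x t; first by apply: (g1 t Tt); apply/andP; split; lra.
  by apply: none; exists t => //; apply/two_intervalsP/orP; left; apply/andP; split; lra.
have [xt|xt] := ltP (x - al - be) t; first by apply: (g2 t Tt); apply/andP; split; lra.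
by apply: none; exists t => //; apply/two_intervalsP/orP; right; apply/andP; split; lra.
Qed.

Lemma exact_tiling_half be T : 1 / 2 <= be -> exact_tiling (1 / 2) be T ->
  exists n : nat, (0 < n)%N /\ be = n%:R / 2.
Proof.
move=> be2 [cT uT].
pose S a := T a \/ T (a - 1 / 2 - be).
have cS x : exists2 a, S a & a <= x < a + 1 / 2.
  have [t Tt /two_intervalsP/orP[/andP[? ?]|/andP[? ?]]] := cT x.
    by exists t; [left|apply/andP; split; lra].
  exists (t + 1 / 2 + be); last by apply/andP; split; lra.
  by right; have -> : t + 1 / 2 + be - 1 / 2 - be = t by ring.
have uS x a a' : S a -> S a' -> a <= x < a + 1 / 2 -> a' <= x < a' + 1 / 2 -> a = a'.
  move=> Sa Sa' /andP[a1 a2] /andP[a3 a4].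
  have om (u : R) : u <= x < u + 1 / 2 -> two_intervals (1 / 2) be (x - u).
    by move=> /andP[? ?]; apply/two_intervalsP/orP; left; apply/andP; split; lra.
  have om' (u : R) : u <= x < u + 1 / 2 -> two_intervals (1 / 2) be (x - (u - 1 / 2 - be)).
    by move=> /andP[? ?]; apply/two_intervalsP/orP; right; apply/andP; split; lra.
  have x1 : a <= x < a + 1 / 2 by rewrite a1.
  have x2 : a' <= x < a' + 1 / 2 by rewrite a3.
  (* In the mixed cases uniqueness makes the two cells belong to the same translate, but those are
     [1 / 2 + be] apart and share no point. *)
  case: Sa Sa' => [Ta|Ta] [Ta'|Ta'].
  - exact: (uT x _ _ Ta Ta' (om _ x1) (om _ x2)).
  - by have := uT x _ _ Ta Ta' (om _ x1) (om' _ x2); lra.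
  - by have := uT x _ _ Ta Ta' (om' _ x1) (om _ x2); lra.
  - by have := uT x _ _ Ta Ta' (om' _ x1) (om' _ x2); lra.
have stepS a : S a -> S (a + 1 / 2).
  move=> Sa; have [a' Sa' /andP[h1 h2]] := cS (a + 1 / 2).
  have [E|ne] := eqVneq a' (a + 1 / 2); first by rewrite -E.
  have lt : a' < a + 1 / 2 by rewrite lt_neqAle ne.
  have E : a = a' by apply: (uS a') => //; apply/andP; split; lra.
  by exfalso; rewrite E in h2; lra.
have [t0 Tt0 _] := cT 0.
have S0 (k : nat) : S (t0 + k%:R / 2).
  elim: k => [|k IH]; first by rewrite mul0r addr0; left.
  by rewrite (_ : _ + _ = t0 + k%:R / 2 + 1 / 2); [exact: stepS|rewrite -natr1; field].
(* The second cell of [t0] starts at [t0 + (1 + 2 * be) / 2]; the progression from [t0] must hit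
   this left end. *)
have [k /andP[k1 k2]] : exists k : nat, k%:R <= 1 + 2 * be < k%:R + 1.
  by exists (Num.truncn (1 + 2 * be)); rewrite natr1; apply: truncn_itv; lra.
have Sc : S (t0 + 1 / 2 + be).
  by right; have -> : t0 + 1 / 2 + be - 1 / 2 - be = t0 by ring.
have E : t0 + k%:R / 2 = t0 + 1 / 2 + be.
  by apply: (uS (t0 + 1 / 2 + be)) => //; apply/andP; split; lra.
have kE : k%:R = 1 + 2 * be by lra.
case: k {k1 k2 E} kE => [|[|k]] kE; [lra|lra|].
exists k.+1; split => //; rewrite -natr1 in kE; lra.
Qed.

Lemma exact_tiling_unequal al be T : 0 < al -> al < 1 / 2 -> 0 < be ->
  exact_tiling al be T -> exists n : nat, (0 < n)%N /\ be = n%:R.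
Proof.
move=> al0 al2 be0 [cT uT].
have omA x t : t <= x < t + al -> two_intervals al be (x - t).
  by move=> /andP[? ?]; apply/two_intervalsP/orP; left; apply/andP; split; lra.
have omB x t : t + al + be <= x < t + 1 + be -> two_intervals al be (x - t).
  by move=> /andP[? ?]; apply/two_intervalsP/orP; right; apply/andP; split; lra.
(* At [t + al] the first interval of [t] ends. A first interval covering this point would make the
   second intervals overlap; so a second interval does, and it must open exactly there, since
   otherwise it would overlap the first interval of [t]. *)
have shift t : T t -> T (t - be).
  move=> Tt; have [t' Tt' /two_intervalsP/orP[/andP[? ?]|/andP[? ?]]] := cT (t + al).
    have E : t = t'.
      by apply: (uT (t' + al + be)) => //; apply: omB; apply/andP; split; lra.
    by exfalso; move: E; lra.
  suff -> : t - be = t' by [].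
  apply/eqP/negPn/negP => ne.
  have lt : t' + al + be < t + al by rewrite lt_neqAle; apply/andP; split; [apply/eqP => E; move/eqP: ne; apply; lra|lra].
  have [h|h] := leP t (t' + al + be).
    have E : t = t'.
      apply: (uT (t' + al + be)) => //; first by apply: omA; apply/andP; split; lra.
      by apply: omB; apply/andP; split; lra.
    by move: lt; rewrite E; lra.
  have E : t = t'.
    apply: (uT t) => //; first by apply: omA; apply/andP; split; lra.
    by apply: omB; apply/andP; split; lra.
  by move: lt; rewrite E; lra.
(* The second interval of [t - be] is [[t + al, t + 1[], which completes the first interval of [t]
   to a unit cell; cells of distinct points are therefore disjoint. *)
have block t t' x : T t -> T t' -> t <= x < t + 1 -> t' <= x < t' + 1 -> t = t'.
  have cov u : T u -> u <= x < u + 1 ->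
      two_intervals al be (x - u) /\ x < u + al \/
      two_intervals al be (x - (u - be)) /\ u + al <= x.
    move=> Tu /andP[? ?]; have [h|h] := ltP x (u + al).
      by left; split => //; apply: omA; apply/andP; split; lra.
    by right; split => //; apply: omB; apply/andP; split; lra.
  move=> Tt Tt' xt xt'; have [[c h]|[c h]] := cov _ Tt xt; have [[c' h']|[c' h']] := cov _ Tt' xt'.
  - exact: (uT x).
  - by have E := uT x _ _ Tt (shift _ Tt') c c'; exfalso; lra.
  - by have E := uT x _ _ (shift _ Tt) Tt' c c'; exfalso; lra.
  - by have := uT x _ _ (shift _ Tt) (shift _ Tt') c c'; lra.
have shifts t (j : nat) : T t -> T (t - j%:R * be).
  move=> Tt; elim: j => [|j IH]; first by rewrite mul0r subr0.
  by rewrite (_ : _ - _ = t - j%:R * be - be); [exact: shift|rewrite -natr1; ring].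
have [t0 Tt0 _] := cT 0.
(* The number of points of T in the windows below is nondecreasing in k and
   bounded, so at a window where it is maximal T has become periodic. *)
have [X TX perX] : exists2 X, T X & forall r, T r -> r < X -> T (r + be).
  pose W (k : nat) r := T r /\ k%:R * be <= t0 - r < (k%:R + 1) * be.
  pose P n := exists k (s : seq R), [/\ uniq s, size s = n & forall r, r \in s -> W k r].
  have P0 : exists n, `[< P n >] by exists 0%N; apply/asboolP; exists 0%N, [::].
  (* Points of [T] are at least 1 apart, so within a window of length [be] their offsets have
     distinct integer parts. *)
  have Pbound n : `[< P n >] -> (n <= (Num.truncn be).+1)%N.
    move=> /asboolP[k [s [us <- sW]]].
    pose f r := Num.truncn (t0 - r - k%:R * be).
    rewrite -(size_map f) -[leqRHS](size_iota 0); apply: uniq_leq_size.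
      rewrite map_inj_in_uniq// => r r' rs r's.
      have [Tr /andP[r1 r2]] := sW _ rs; have [Tr' /andP[r'1 r'2]] := sW _ r's.
      have := @truncn_itv _ (t0 - r - k%:R * be).
      have := @truncn_itv _ (t0 - r' - k%:R * be).
      rewrite -/(f r) -/(f r') => /(_ _)/andP[|f1 f2]; first by lra.
      move=> /(_ _)/andP[|f3 f4]; first by lra.
      move=> E; rewrite E -natr1 in f3 f4; rewrite -natr1 in f2.
      have [rr'|rr'] := leP r r'.
        by apply: (block _ _ r') => //; apply/andP; split; lra.
      by apply: (block _ _ r) => //; apply/andP; split; lra.
    move=> _ /mapP[r rs ->]; rewrite mem_iota add0n /= ltnS.
    have [_ /andP[r1 r2]] := sW _ rs.
    by apply: le_truncn; lra.
  case: (ex_maxnP P0 Pbound) => n /asboolP[k [s [us sn sW]]] nmax.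
  exists (t0 - (k.+1)%:R * be); first exact: shifts.
  move=> r Tr rX.
  have q0 : 0 <= (t0 - r) / be.
    rewrite divr_ge0 ?(ltW be0)//.
    have : 0 <= k.+1%:R * be by rewrite mulr_ge0// ltW.
    by lra.
  have := truncn_itv q0; set j := Num.truncn _.
  rewrite ler_pdivlMr// ltr_pdivrMr// => /andP[j1 j2].
  have kj : (k < j)%N.
    rewrite ltnNge; apply/negP => jk.
    have : j.+1%:R * be <= k.+1%:R * be by rewrite ler_pM2r// ler_nat ltnS.
    by lra.
  (* The points of the maximal window, moved into the window of [r] by steps of [be]. If [r] were
     not among them, its window would contain [n.+1] points. *)
  pose s' := [seq u - (j - k)%:R * be | u <- s].
  have jkE : (j - k)%:R = j%:R - k%:R :> R by rewrite natrB// ltnW.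
  have rs' : r \in s'.
    apply/negPn/negP => rs'.
    have : `[< P n.+1 >].
      apply/asboolP; exists j, (r :: s'); split.
      - by rewrite /= rs' map_inj_uniq// => u v /addIr.
      - by rewrite /= size_map sn.
      - move=> u; rewrite in_cons => /predU1P[->|].
          by split => //; apply/andP; split; rewrite ?natr1.
        move=> /mapP[v vs ->]; have [Tv /andP[v1 v2]] := sW _ vs.
        split; first exact: shifts.
        by rewrite jkE; apply/andP; split; lra.
    by move=> /nmax; rewrite ltnn.
  have /mapP[v vs rE] := rs'; have [Tv _] := sW _ vs.
  have -> : r + be = v - (j - k).-1%:R * be.
    have -> : (j - k).-1%:R = (j - k)%:R - 1 :> R.
      by rewrite -subn1 natrB// subn_gt0.
    by rewrite rE; ring.
  exact: shifts.
have be1 : 1 <= be.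
  rewrite leNgt; apply/negP => be1.
  have E := block _ _ X TX (shift _ TX); have : X = X - be by apply: E; apply/andP; split; lra.
  lra.
have step t : T t -> t < X -> T (t + 1).
  move=> Tt tX; have [t' Tt' om] := cT (t + 1).
  have nob u : T u -> t < u -> u < t + 1 -> False.
    move=> Tu u1 u2; have E : t = u by apply: (block _ _ u) => //; apply/andP; split; lra.
    by move: u1; rewrite E ltxx.
  move: om => /two_intervalsP/orP[/andP[h1 h2]|/andP[h1 h2]].
    have [E|ne] := eqVneq t' (t + 1); first by rewrite -E.
    have lt : t' < t + 1 by rewrite lt_neqAle ne; lra.
    by exfalso; apply: (nob t') => //; lra.
  (* If a second interval covers [t + 1], periodicity puts [t' + be] in [T], strictly inside the
     unit cell of [t]. *)
  have T'' : T (t' + be) by apply: perX => //; lra.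
  by exfalso; apply: (nob _ T''); lra.
have [k /andP[k1 k2]] : exists k : nat, k%:R <= be < k%:R + 1.
  by exists (Num.truncn be); rewrite natr1; apply: truncn_itv; lra.
have Tj (j : nat) : (j <= k)%N -> T (X - be + j%:R).
  elim: j => [|j IH] jk; first by rewrite addr0; exact: shift.
  rewrite -natr1 addrA; apply: step; first exact/IH/ltnW.
  have : j.+1%:R <= k%:R :> R by rewrite ler_nat.
  by rewrite -natr1; lra.
(* With [k] the integer part of [be], the unit steps from [X - be] end at a point whose cell
   contains [X]; cells being disjoint, that point is [X]. *)
have E : X - be + k%:R = X.
  by apply: (block _ _ X) => //; [exact: Tj|apply/andP; split; lra|apply/andP; split; lra].
have kE : be = k%:R by lra.
by exists k; split => //; rewrite -(ltr_nat R) -kE.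
Qed.

End ExactTiling.

(** * Approximation by linear combinations *)

Section Measurability.
Context {R : realType}.
Local Notation mu := (@lebesgue_measure R).
Implicit Types f g h : R -> R[i].

Lemma bounded_supportedC_cmeasurable f : bounded_supportedC f -> cmeasurable f.
Proof. by move=> [[? _] [? _]]. Qed.

Lemma bounded_measurableC_cmeasurable f : bounded_measurableC f -> cmeasurable f.
Proof. by move=> [[? _] [? _]]. Qed.

Lemma cmeasurableD f g : cmeasurable f -> cmeasurable g ->
  cmeasurable (fun x => f x + g x).
Proof.
move=> [f1 f2] [g1 g2]; split.
  by under eq_fun do rewrite cReD; exact: measurable_funD.
by under eq_fun do rewrite cImD; exact: measurable_funD.
Qed.

Lemma cmeasurableN f : cmeasurable f -> cmeasurable (fun x => - f x).
Proof.
move=> [f1 f2]; split.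
  by under eq_fun do rewrite cReN; exact: measurableT_comp.
by under eq_fun do rewrite cImN; exact: measurableT_comp.
Qed.

Lemma cmeasurableB f g : cmeasurable f -> cmeasurable g ->
  cmeasurable (fun x => f x - g x).
Proof. by move=> mf mg; apply: cmeasurableD => //; exact: cmeasurableN. Qed.

Lemma cmeasurableM f g : cmeasurable f -> cmeasurable g ->
  cmeasurable (fun x => f x * g x).
Proof.
move=> [f1 f2] [g1 g2]; split.
  under eq_fun do rewrite cReM.
  by apply: measurable_funB; apply: measurable_funM.
under eq_fun do rewrite cImM.
by apply: measurable_funD; apply: measurable_funM.
Qed.

Lemma cmeasurable_cst (z : R[i]) : cmeasurable (cst z).
Proof. by split; exact: measurable_cst. Qed.

Lemma cmeasurable_real (u : R -> R) : measurable_fun setT u ->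
  cmeasurable (fun x => (u x)%:C%C).
Proof. by move=> mu'; split => //=; exact: measurable_cst. Qed.

Lemma cmeasurable_sum (I : Type) (s : seq I) (f : I -> R -> R[i]) :
  (forall i, cmeasurable (f i)) -> cmeasurable (fun x => \sum_(i <- s) f i x).
Proof.
move=> mf; elim: s => [|i s IH].
  by under eq_fun do rewrite big_nil; exact: cmeasurable_cst.
by under eq_fun do rewrite big_cons; exact: cmeasurableD.
Qed.

Lemma cmeasurable_shift f (t : R) : cmeasurable f -> cmeasurable (fun x => f (x + t)).
Proof.
move=> [f1 f2]; split.
  exact: (measurableT_comp f1 (measurable_shift t)).
exact: (measurableT_comp f2 (measurable_shift t)).
Qed.

Lemma measurable_csq f : cmeasurable f -> measurable_fun setT (csq \o f).
Proof.
by move=> [f1 f2]; apply: measurable_funD; apply: measurable_funX.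
Qed.

Lemma energyD_le f g : cmeasurable f -> cmeasurable g ->
  (energy (fun x => f x + g x)%R <= 2%:E * energy f + 2%:E * energy g)%E.
Proof.
move=> mf mg.
have E h : cmeasurable h -> measurable_fun setT (fun x => (csq (h x))%:E).
  by move=> /measurable_csq mh; exact/measurable_EFinP.
rewrite /energy -!ge0_integralZl//; try exact: E;
  try by move=> x _; rewrite lee_fin csq_ge0.
rewrite -ge0_integralD//; last 4 first.
- by move=> x _; rewrite mule_ge0 ?lee_fin ?csq_ge0.
- by apply: measurable_funeM; exact: E.
- by move=> x _; rewrite mule_ge0 ?lee_fin ?csq_ge0.
- by apply: measurable_funeM; exact: E.
apply: ge0_le_integral => //.
- by move=> x _; rewrite lee_fin csq_ge0.
- by apply: E; exact: cmeasurableD.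
- by apply: emeasurable_funD; apply: measurable_funeM; exact: E.
- by move=> x _; rewrite -!EFinM -EFinD lee_fin; exact: csqD_le.
Qed.

Lemma energyZ (z : R[i]) f : cmeasurable f ->
  energy (fun x => z * f x) = ((csq z)%:E * energy f)%E.
Proof.
move=> mf; rewrite /energy -ge0_integralZl//.
- by apply: eq_integral => x _; rewrite csqM EFinM.
- by apply/measurable_EFinP; exact: measurable_csq.
- by move=> x _; rewrite lee_fin csq_ge0.
- by rewrite lee_fin csq_ge0.
Qed.

Lemma L2_integrable f : L2 f -> mu.-integrable setT (EFin \o (csq \o f)).
Proof.
move=> [mf]; rewrite L2norm_lty => ef; apply/integrableP; split.
  by apply/measurable_EFinP; exact: measurable_csq.
under eq_integral do rewrite /= ger0_norm ?csq_ge0//.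
exact: ef.
Qed.

End Measurability.

Section Approximation.
Context {R : realType} (I : choiceType) (Lam : set I) (e : I -> R -> R[i]).
Hypothesis me : forall i, cmeasurable (e i).
Local Notation mu := (@lebesgue_measure R).
Implicit Types (f g h : R -> R[i]) (z : R[i]).

Definition lincomb h : Prop := exists (s : seq I) (c : I -> R[i]),
  [/\ uniq s, [set` s] `<=` Lam & forall x, h x = \sum_(i <- s) c i * e i x].

Definition approximable f : Prop := forall eps : R, 0 < eps ->
  exists2 h, lincomb h & (energy (fun x => f x - h x)%R < eps%:E)%E.

Lemma lincomb_cmeasurable h : lincomb h -> cmeasurable h.
Proof.
move=> [s [c [_ _ hE]]]; rewrite (funext hE); apply: cmeasurable_sum => i.
exact: (cmeasurableM (cmeasurable_cst _)).
Qed.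

Lemma lincomb0 : lincomb (cst 0).
Proof.
by exists [::], (fun=> 0); split => // x; rewrite big_nil.
Qed.

Lemma lincombD1 h i z : Lam i -> lincomb h -> lincomb (fun x => h x + z * e i x).
Proof.
move=> Li [s [c [us sL hE]]]; have [si|si] := boolP (i \in s).
  exists s, (fun j => if j == i then c j + z else c j); split => // x.
  rewrite hE !(bigD1_seq i si us) /= eqxx mulrDl addrAC; congr (_ + _).
  by apply: eq_bigr => j /negPf ->.
exists (i :: s), (fun j => if j == i then z else c j); split => [|j|x].
- by rewrite /= si.
- by rewrite /= in_cons => /predU1P[->//|]; exact: sL.
- rewrite big_cons eqxx addrC hE; congr (_ + _); apply: eq_big_seq => j js.
  by case: eqP => // ji; move: si; rewrite -ji js.
Qed.

Lemma lincomb_ind (P : (R -> R[i]) -> Prop) : P (cst 0) ->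
  (forall h i z, Lam i -> lincomb h -> P h -> P (fun x => h x + z * e i x)) ->
  forall h, lincomb h -> P h.
Proof.
move=> P0 PS h [s [c [us sL hE]]].
have [_] : lincomb h /\ P h; last by [].
rewrite (funext hE); elim: s us sL {h hE} => [_ _|i s IH /= /andP[si us] sL].
  under eq_fun do rewrite big_nil; split => //; exact: lincomb0.
have Li : Lam i by apply: sL => /=; rewrite mem_head.
have [|l p] := IH us; first by move=> j js; apply: sL => /=; rewrite in_cons js orbT.
under eq_fun do rewrite big_cons addrC.
by split; [exact: lincombD1|exact: PS].
Qed.

Lemma lincomb1 i : Lam i -> lincomb (e i).
Proof.
move=> Li; have := lincombD1 1 Li lincomb0.
by under eq_fun do rewrite add0r mul1r.
Qed.

Lemma lincombD h g : lincomb h -> lincomb g -> lincomb (fun x => h x + g x).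
Proof.
move=> lh; elim/lincomb_ind => [|g' i z Li lg IH].
  by under eq_fun do rewrite addr0.
by under eq_fun do rewrite addrA; exact: lincombD1.
Qed.

Lemma lincombZ z h : lincomb h -> lincomb (fun x => z * h x).
Proof.
elim/lincomb_ind => [|g' i z' Li lg IH].
  by under eq_fun do rewrite mulr0; exact: lincomb0.
by under eq_fun do rewrite mulrDr mulrA; exact: lincombD1.
Qed.

Lemma energy0 : energy (cst (0 : R[i])) = 0%E.
Proof.
rewrite /energy; apply: integral0_eq => x _.
by rewrite /csq /= expr0n addr0.
Qed.

Lemma lincomb_approximable h : lincomb h -> approximable h.
Proof.
move=> lh eps e0; exists h => //; under [X in energy X]eq_fun do rewrite subrr.
by rewrite energy0 lte_fin.
Qed.

(** The closed span is closed. The constant 2 in [energyD_le], once for each of the two errors,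
    accounts for [eps / 4]. *)
Lemma approximable_closed f : cmeasurable f ->
  (forall eps : R, 0 < eps -> exists g, [/\ cmeasurable g, approximable g &
     (energy (fun x => f x - g x)%R < eps%:E)%E]) ->
  approximable f.
Proof.
move=> mf H eps e0; have e4 : 0 < eps / 4 by lra.
have [g [mg ag fg]] := H _ e4; have [h lh gh] := ag _ e4; exists h => //.
have mh := lincomb_cmeasurable lh.
have -> : (fun x => f x - h x) = (fun x => (f x - g x) + (g x - h x)).
  by apply/funext => x; ring.
apply: (le_lt_trans (energyD_le (cmeasurableB mf mg) (cmeasurableB mg mh))).
have -> : eps%:E = (2%:E * (eps / 4)%:E + 2%:E * (eps / 4)%:E)%E.
  by rewrite -!EFinM -EFinD; congr EFin; field.
by rewrite lteD// lte_pmul2l.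
Qed.

Lemma approximableD f g : cmeasurable f -> cmeasurable g ->
  approximable f -> approximable g -> approximable (fun x => f x + g x).
Proof.
move=> mf mg af ag eps e0; have e4 : 0 < eps / 4 by lra.
have [h lh fh] := af _ e4; have [k lk gk] := ag _ e4.
exists (fun x => h x + k x); first exact: lincombD.
have mh := lincomb_cmeasurable lh; have mk := lincomb_cmeasurable lk.
have -> : (fun x => f x + g x - (h x + k x)) = (fun x => (f x - h x) + (g x - k x)).
  by apply/funext => x; ring.
apply: (le_lt_trans (energyD_le (cmeasurableB mf mh) (cmeasurableB mg mk))).
have -> : eps%:E = (2%:E * (eps / 4)%:E + 2%:E * (eps / 4)%:E)%E.
  by rewrite -!EFinM -EFinD; congr EFin; field.
by rewrite lteD// lte_pmul2l.
Qed.

Lemma approximable0 : approximable (cst 0).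
Proof. exact: (lincomb_approximable lincomb0). Qed.

Lemma approximableZ z f : cmeasurable f -> approximable f ->
  approximable (fun x => z * f x).
Proof.
move=> mf af eps e0; have d0 : 0 < csq z + 1 by rewrite ltr_wpDl// csq_ge0.
have [h lh fh] := af _ (divr_gt0 e0 d0).
exists (fun x => z * h x); first exact: lincombZ.
have mh := lincomb_cmeasurable lh.
under [X in energy X]eq_fun do rewrite -mulrBr.
rewrite energyZ; last exact: cmeasurableB.
apply: (@le_lt_trans _ _ ((csq z)%:E * (eps / (csq z + 1))%:E)%E).
  by rewrite lee_wpmul2l ?lee_fin ?csq_ge0// ltW.
rewrite -EFinM lte_fin mulrCA gtr_pMr// ltr_pdivrMr// mul1r.
by rewrite ltrDl.
Qed.

Lemma approximableB f g : cmeasurable f -> cmeasurable g ->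
  approximable f -> approximable g -> approximable (fun x => f x - g x).
Proof.
move=> mf mg af ag; apply: approximableD => //; first exact: cmeasurableN.
by have := approximableZ (-1) mg ag; under eq_fun do rewrite mulN1r.
Qed.

Lemma approximable_sum (J : Type) (s : seq J) (f : J -> R -> R[i]) :
  (forall j, cmeasurable (f j)) -> (forall j, approximable (f j)) ->
  approximable (fun x => \sum_(j <- s) f j x).
Proof.
move=> mf af; elim: s => [|j s IH].
  by under eq_fun do rewrite big_nil; exact: approximable0.
under eq_fun do rewrite big_cons.
by apply: approximableD => //; exact: cmeasurable_sum.
Qed.

Lemma approximable_dominated (F : nat -> R -> R[i]) f (G : R -> R) :
  (forall n, cmeasurable (F n)) -> cmeasurable f ->
  mu.-integrable setT (EFin \o G) ->
  (forall n x, csq (F n x) <= G x) -> (forall x, csq (f x) <= G x) ->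
  {ae mu, forall x, csq (f x - F n x) @[n --> \oo] --> (0 : R)} ->
  (forall n, approximable (F n)) -> approximable f.
Proof.
move=> mF mf iG FG fG cv aF; apply: approximable_closed => // eps e0.
have mD n : measurable_fun setT (fun x => (csq (f x - F n x))%:E).
  apply/measurable_EFinP.
  exact: (measurable_csq (cmeasurableB mf (mF n))).
have iG4 : mu.-integrable setT (fun x => (4%:E * (EFin \o G) x)%E) by exact: integrableZl.
have [||_ _] := @dominated_convergence _ _ R mu setT measurableT
  (fun n x => (csq (f x - F n x))%:E) (cst 0%E) _ mD (measurable_cst _) _ iG4.
- case: cv => N [mN N0 sN]; exists N; split => // x nx; apply: sN => cvx; apply: nx => _; apply: (cvg_comp _ _ cvx).
  exact: cvg_refl.
- apply: aeW => x n _ /=; rewrite ger0_norm ?csq_ge0// -EFinM lee_fin.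
  apply: (le_trans (csqD_le _ _)).
  have -> : csq (- F n x) = csq (F n x) by rewrite /csq !ReImE !sqrrN.
  by have := FG n x; have := fG x; lra.
rewrite integral0 => /fine_cvgP[fin cvI].
have [n _ Hn] := filterI fin (cvgr_lt _ cvI _ e0).
have [/= finn ltn] := Hn n (leqnn n).
exists (F n); split => //.
by rewrite /energy -(fineK finn) lte_fin.
Qed.

End Approximation.

(** * Polynomials in a cosine converging to indicators of arcs *)

Section Threshold.
Context {R : realType}.
Implicit Types u y : R.

Lemma bernoulli_ineq y (N : nat) : -1 <= y -> 1 + N%:R * y <= (1 + y) ^+ N.
Proof.
move=> y1; elim: N => [|N IH]; first by rewrite mul0r addr0 expr0.
rewrite exprS; apply: (@le_trans _ _ ((1 + y) * (1 + N%:R * y))); last first.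
  by rewrite ler_wpM2l//; lra.
have -> : (1 + y) * (1 + N%:R * y) = 1 + N.+1%:R * y + N%:R * y ^+ 2.
  by rewrite -natr1; ring.
by rewrite lerDl mulr_ge0// sqr_ge0.
Qed.

(* On [0, 1] these polynomials converge to the indicator of [u < 1 / 2], away
   from the threshold. *)
Definition threshold (n : nat) u : R := (1 - u ^+ n) ^+ (2 ^ n).

Lemma threshold_itv n u : 0 <= u <= 1 -> 0 <= threshold n u <= 1.
Proof.
move=> /andP[u0 u1]; have un0 : 0 <= u ^+ n by rewrite exprn_ge0.
have un1 : u ^+ n <= 1 by rewrite exprn_ile1.
by rewrite exprn_ge0 ?exprn_ile1//; lra.
Qed.

(** Bernoulli's inequality gives [1 - (2 * u) ^+ n <= threshold n u]. *)
Lemma cvg_threshold_lt u : 0 <= u -> u < 1 / 2 ->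
  threshold n u @[n --> \oo] --> (1 : R).
Proof.
move=> u0 u2.
have h : (1 - (2 * u) ^+ n) @[n --> \oo] --> (1 - 0 : R).
  by apply: cvgB; [exact: cvg_cst|apply: cvg_expr; rewrite ger0_norm; lra].
rewrite subr0 in h; apply: (squeeze_cvgr _ h (cvg_cst _)).
apply: nearW => n; have := @threshold_itv n u.
have -> : 0 <= u <= 1 by apply/andP; split; lra.
move=> /(_ isT)/andP[_ ->]; rewrite andbT.
have un1 : u ^+ n <= 1 by rewrite exprn_ile1//; lra.
have := @bernoulli_ineq (- u ^+ n) (2 ^ n); rewrite exprMn -natrX mulrN.
by apply; lra.
Qed.

(** Since [(1 - u ^+ n) * (1 + u ^+ n) <= 1], the value is at most the inverse of
    [(1 + u ^+ n) ^+ (2 ^ n)], which Bernoulli's inequality bounds below by [(2 * u) ^+ n]. *)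
Lemma cvg_threshold_gt u : 1 / 2 < u -> u <= 1 ->
  threshold n u @[n --> \oo] --> (0 : R).
Proof.
move=> u2 u1; have u0 : 0 < 2 * u by lra.
have h : (2 * u)^-1 ^+ n @[n --> \oo] --> (0 : R).
  by apply: cvg_expr; rewrite gtr0_norm ?invr_gt0// invf_lt1//; lra.
apply: (squeeze_cvgr _ (cvg_cst _) h); apply: nearW => n.
have := @threshold_itv n u.
have -> : 0 <= u <= 1 by apply/andP; split; lra.
move=> /(_ isT)/andP[-> _] /=.
have un1 : u ^+ n <= 1 by rewrite exprn_ile1//; lra.
have un0 : 0 <= u ^+ n by rewrite exprn_ge0//; lra.
rewrite exprVn -[leRHS]mul1r ler_pdivlMr ?exprn_gt0//.
apply: (@le_trans _ _ (threshold n u * (1 + u ^+ n) ^+ (2 ^ n))).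
  rewrite ler_wpM2l//; first by rewrite exprn_ge0//; lra.
  have := @bernoulli_ineq (u ^+ n) (2 ^ n); rewrite exprMn -natrX.
  by move=> /(_ _)/(le_trans _); apply; lra.
rewrite /threshold -exprMn exprn_ile1//.
  by rewrite mulr_ge0//; lra.
have -> : (1 - u ^+ n) * (1 + u ^+ n) = 1 - (u ^+ n) ^+ 2 by ring.
by have := sqr_ge0 (u ^+ n); lra.
Qed.

End Threshold.

Section Arc.
Context {R : realType}.
Implicit Types x y a b t P : R.

Lemma cos_arc_lt x y : 0 <= y <= pi -> y < x < 2 * pi - y -> cos x < cos y.
Proof.
move=> /andP[y0 y1] /andP[yx xy]; have [xpi|xpi] := leP x pi.
  by rewrite ltr_cos// in_itv /=; apply/andP; split; lra.
have -> : cos x = cos (2 * pi - x).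
  by rewrite -(cosN (2 * pi - x)) opprB -[in RHS](cos_period 1) mulr1 subrK.
by rewrite ltr_cos ?in_itv /=; last 2 first; try apply/andP; try split; lra.
Qed.

(** A cosine of period [P] centred at the midpoint of the arc, rescaled to take the value [1 / 2] at
    [a] and [b]; the divisor 4 keeps it in [[0, 1]]. *)
Definition arc_level P a b x : R :=
  1 / 2 + (cos (pi * ((b - a) / P)) - cos (2 * pi / P * (x - (a + b) / 2))) / 4.

Lemma arc_level_itv P a b x : 0 <= arc_level P a b x <= 1.
Proof.
rewrite /arc_level; set c := cos _; set c' := cos _.
have := cos_max (pi * ((b - a) / P)); have := cos_max (2 * pi / P * (x - (a + b) / 2)).
by rewrite -/c -/c' !ler_norml => /andP[? ?] /andP[? ?]; apply/andP; split; lra.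
Qed.

Lemma arc_level_lt P a b x : 0 < P -> b - a <= P -> a < x < b ->
  arc_level P a b x < 1 / 2.
Proof.
move=> P0 bP /andP[ax xb]; have pi0 := pi_gt0 R.
have hb : (b - a) / P <= 1 by rewrite ler_pdivrMr// mul1r.
have h0 : 0 < (b - a) / P by rewrite divr_gt0//; lra.
suff : cos (pi * ((b - a) / P)) < cos (2 * pi / P * (x - (a + b) / 2)).
  by rewrite /arc_level; lra.
have -> : cos (2 * pi / P * (x - (a + b) / 2)) = cos (2 * pi / P * `|x - (a + b) / 2|).
  by have [//|_] := ger0P (x - (a + b) / 2); rewrite mulrN cosN.
set z := `|_|; have z0 : 0 <= z by exact: normr_ge0.
have zb : z < (b - a) / 2 by rewrite ltr_norml; apply/andP; split; lra.
have E : 2 * pi / P * z < pi * ((b - a) / P).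
  rewrite (_ : pi * _ = 2 * pi / P * ((b - a) / 2)); last by field; exact: lt0r_neq0.
  by rewrite ltr_pM2l// divr_gt0//; lra.
have A0 : 0 <= 2 * pi / P * z by rewrite mulr_ge0// divr_ge0//; lra.
have A1 : pi * ((b - a) / P) <= pi by rewrite ger_pMr.
by rewrite ltr_cos// in_itv /=; apply/andP; split; lra.
Qed.

Lemma arc_level_gt P a b t x : 0 < P -> t <= a -> a <= b -> b <= t + P ->
  t < x < t + P -> (x < a) || (b < x) -> 1 / 2 < arc_level P a b x.
Proof.
move=> P0 ta ab bP /andP[tx xP] out; have pi0 := pi_gt0 R.
have hb : (b - a) / P <= 1 by rewrite ler_pdivrMr// mul1r; lra.
have h0 : 0 <= (b - a) / P by rewrite divr_ge0//; lra.
suff : cos (2 * pi / P * (x - (a + b) / 2)) < cos (pi * ((b - a) / P)).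
  by rewrite /arc_level; lra.
have -> : cos (2 * pi / P * (x - (a + b) / 2)) = cos (2 * pi / P * `|x - (a + b) / 2|).
  by have [//|_] := ger0P (x - (a + b) / 2); rewrite mulrN cosN.
set z := `|_|.
have [zb zP] : (b - a) / 2 < z /\ z < P - (b - a) / 2.
  rewrite /z; case: (ger0P (x - (a + b) / 2)) => ?;
    by case/orP: out => ?; split; lra.
apply: cos_arc_lt.
  by rewrite mulr_ge0 ?ger_pMr//; lra.
have E : pi * ((b - a) / P) = 2 * pi / P * ((b - a) / 2) by field; exact: lt0r_neq0.
have k0 : 0 < 2 * pi / P by rewrite divr_gt0//; lra.
rewrite E ltr_pM2l// zb /=.
have -> : 2 * pi - 2 * pi / P * ((b - a) / 2) = 2 * pi / P * (P - (b - a) / 2).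
  by field; exact: lt0r_neq0.
by rewrite ltr_pM2l.
Qed.

End Arc.

(** * Completeness over one tile *)

Section Fiber.
Context {R : realType}.
Local Notation mu := (@lebesgue_measure R).
Variables (al be : R).
Hypotheses (al0 : 0 < al) (al2 : al <= 1 / 2) (be0 : 0 < be).
Local Notation Om := (two_intervals al be).
Local Notation e := (time_freq_shift (cindic Om)).
(** Invariance of [S] under [1 / P] makes the span over one tile stable under multiplication by
    trigonometric polynomials of period [P]. These see points only modulo [P]; the shift by [d], a
    multiple of [P], brings the second interval into [[t, t + P[], where the first one lies. *)
Variables (t P d : R) (m : nat) (S : set R).
Hypotheses (P0 : 0 < P) (alP : al <= P) (dm : d = m%:R * P).
Hypotheses (dal : d <= al + be) (dP : 1 + be - d <= P).
Hypotheses (Sup : forall nu, S nu -> S (nu + P^-1))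
           (Sdown : forall nu, S nu -> S (nu - P^-1)).
Implicit Types (x a b nu : R) (k : R -> R[i]).

Let Lam : set (R * R) := [set l | l.1 = t /\ S l.2].
Local Notation appr := (approximable Lam e).

Let bOm := two_intervals_bounded al0 al2 be0.
Let mOm := measurable_two_intervals al be.

Let me l : cmeasurable (e l).
Proof.
exact: (bounded_supportedC_cmeasurable (bounded_supported_gabor mOm bOm l)).
Qed.

Lemma csq_gabor_le1 (l : R * R) x : csq (e l x) <= 1.
Proof.
rewrite csqM csq_expi mulr1 /csq /cindic /= indicE.
by case: (_ \in _); rewrite ?expr1n ?expr0n /= addr0.
Qed.

(* The second interval is folded back next to the first one, modulo the
   period. *)
Definition fold x : R := if x < t + al then x else x - d.

Lemma fold_itv l x : l.1 = t -> e l x != 0 -> t <= fold x < t + P.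
Proof.
have [? ? ?] := And3 al0 al2 be0; have [? ? ? ?] := And4 P0 alP dal dP.
move=> lt; rewrite /time_freq_shift /cindic lt indicE.
have [|_] := boolP (x - t \in Om); last by rewrite mul0r eqxx.
rewrite inE => /two_intervalsP/orP[/andP[? ?]|/andP[? ?]] _; rewrite /fold.
  by case: ltP => ?; apply/andP; split; lra.
by case: ltP => ?; apply/andP; split; lra.
Qed.

Lemma measurable_fold : measurable_fun setT fold.
Proof.
apply: measurable_fun_ifT => //; first exact: measurable_fun_ltr.
exact: measurable_shift.
Qed.

(** On the tile, the product of one Gabor function with the function of period [P] that equals [k]
    on [[t, t + P[]: what a single class of frequencies modulo [1 / P] can reach. *)
Definition folded nu k x : R[i] := e (t, nu) x * k (fold x).

Lemma eq_folded nu k k' : (forall x, t <= x < t + P -> k x = k' x) ->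
  folded nu k = folded nu k'.
Proof.
move=> kk'; apply/funext => x; rewrite /folded.
have [->|ex] := eqVneq (e (t, nu) x) 0; first by rewrite !mul0r.
by rewrite kk'//; exact: (fold_itv _ ex).
Qed.

Lemma cmeasurable_folded nu k : cmeasurable k -> cmeasurable (folded nu k).
Proof.
move=> [k1 k2]; apply: cmeasurableM; first exact: me.
split; [exact: (measurableT_comp k1 measurable_fold)|].
exact: (measurableT_comp k2 measurable_fold).
Qed.

Lemma integrable_shift (g : R -> R) (c : R) : (forall x, 0 <= g x) ->
  mu.-integrable setT (EFin \o g) ->
  mu.-integrable setT (EFin \o (fun x => g (x + c))).
Proof.
move=> g0 /integrableP[mg ig]; apply/integrableP; split.
  exact: (measurableT_comp mg (measurable_shift c)).
have mg' : measurable_fun setT (abse \o (EFin \o g)) by exact: measurableT_comp.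
have := ge0_integral_shift c mg' (fun x => abse_ge0 _).
by move=> E; rewrite /= in E; rewrite E.
Qed.

(** As [fold x] is [x] or [x - d], a bound [g] before folding becomes [g x + g (x - d)], and the
    exceptional points are those of [N] and of [N + d]. *)
Lemma approximable_folded_dominated nu (F : nat -> R -> R[i]) k (g : R -> R)
    (N : set R) :
  (forall n, cmeasurable (F n)) -> cmeasurable k ->
  mu.-integrable setT (EFin \o g) ->
  (forall n x, csq (F n x) <= g x) -> (forall x, csq (k x) <= g x) ->
  finite_set N ->
  (forall x, ~ N x -> csq (k x - F n x) @[n --> \oo] --> (0 : R)) ->
  (forall n, appr (folded nu (F n))) -> appr (folded nu k).
Proof.
move=> mF mk ig Fg kg cN cv aF.
have g0 x : 0 <= g x by apply: le_trans (kg x); exact: csq_ge0.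
apply: (approximable_dominated me (F := fun n => folded nu (F n))
  (G := fun x => g x + g (x - d))) => //.
- by move=> n; exact: cmeasurable_folded.
- exact: cmeasurable_folded.
- exact: (integrableD measurableT ig (integrable_shift (- d) g0 ig)).
- move=> n x; rewrite /folded csqM.
  apply: (@le_trans _ _ (csq (F n (fold x)))).
    by rewrite ler_piMl ?csq_ge0 ?csq_gabor_le1.
  apply: (le_trans (Fg _ _)); rewrite /fold.
  by case: ifP => _; rewrite ?lerDl ?lerDr g0.
- move=> x; rewrite /folded csqM.
  apply: (@le_trans _ _ (csq (k (fold x)))).
    by rewrite ler_piMl ?csq_ge0 ?csq_gabor_le1.
  apply: (le_trans (kg _)); rewrite /fold.
  by case: ifP => _; rewrite ?lerDl ?lerDr g0.
- pose N' := N `|` (fun x => x + d) @` N.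
  have cN' : countable N'.
    by apply: finite_set_countable; rewrite finite_setU; split => //; exact: finite_image.
  exists N'; split.
  + exact: countable_measurable.
  + exact: countable_lebesgue_measure0.
  + move=> x /= nx; apply: contrapT => xN; apply: nx.
    have xf : ~ N (fold x).
      rewrite /fold; case: ifP => _ Nx; apply: xN; first by left.
      by right; exists (x - d) => //; rewrite subrK.
    have h := cv _ xf.
    have -> : (fun n => csq (folded nu k x - folded nu (F n) x)) =
      (fun n => csq (e (t, nu) x) * csq (k (fold x) - F n (fold x))).
      by apply/funext => n; rewrite /folded -mulrBr csqM.
    by rewrite -(mulr0 (csq (e (t, nu) x))); apply: cvgM => //; exact: cvg_cst.
Qed.

Definition multiplier (f : R -> R) : Prop :=
  forall h, lincomb Lam e h -> lincomb Lam e (fun x => (f x)%:C%C * h x).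

Lemma multiplier_cst c : multiplier (cst c).
Proof. by move=> h lh; exact: (lincombZ c%:C%C lh). Qed.

Lemma multiplierD f f' : multiplier f -> multiplier f' ->
  multiplier (fun x => f x + f' x).
Proof.
move=> mf mf' h lh; have := lincombD (mf _ lh) (mf' _ lh).
by congr lincomb; apply/funext => x; rewrite rmorphD /= mulrDl.
Qed.

Lemma multiplierM f f' : multiplier f -> multiplier f' ->
  multiplier (fun x => f x * f' x).
Proof.
move=> mf mf' h lh; have := mf _ (mf' _ lh).
by congr lincomb; apply/funext => x; rewrite rmorphM /= mulrA.
Qed.

Lemma multiplierX f n : multiplier f -> multiplier (fun x => f x ^+ n).
Proof.
move=> mf; elim: n => [|n IH]; first exact: multiplier_cst.
by under eq_fun do rewrite exprS; exact: multiplierM.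
Qed.

(** Euler's formula: the cosine moves the frequency [nu] to [nu + P^-1] and [nu - P^-1], both still
    in [S]; the centre [c] only contributes a phase to the coefficients. *)
Lemma multiplier_cos (c : R) : multiplier (fun x => cos (2 * pi / P * (x - c))).
Proof.
rewrite /multiplier; apply: lincomb_ind => [|h [s nu] z [/= -> Snu] lh IH].
  by under eq_fun do rewrite mulr0; exact: lincomb0.
have [w wE] : exists w, w = expi (- (2 * pi / P * c)) by eexists.
have := lincombD1 (i := (t, nu - P^-1)) (z * (2^-1 : R)%:C%C * w^*%C) (conj erefl (Sdown Snu))
  (lincombD1 (i := (t, nu + P^-1)) (z * (2^-1 : R)%:C%C * w) (conj erefl (Sup Snu)) IH).
congr lincomb; apply/funext => x; rewrite [RHS]mulrDr -addrA; congr (_ + _).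
rewrite /time_freq_shift /=.
have -> : 2 * pi * x * (nu + P^-1) = 2 * pi * x * nu + 2 * pi / P * x by ring.
have -> : 2 * pi * x * (nu - P^-1) = 2 * pi * x * nu + - (2 * pi / P * x) by ring.
rewrite !expiD.
have -> : (cos (2 * pi / P * (x - c)))%:C%C =
    (2^-1 : R)%:C%C * w * expi (2 * pi / P * x) + (2^-1 : R)%:C%C * w^*%C * expi (- (2 * pi / P * x)).
  have -> : 2 * pi / P * (x - c) = 2 * pi / P * x - 2 * pi / P * c by ring.
  rewrite wE; set A := 2 * pi / P * c; set B := 2 * pi / P * x.
  by apply: complex_ext; rewrite !ReImE /= ?cosB !cosN !sinN; field.
by ring.
Qed.

Lemma multiplier_threshold (a b : R) n :
  multiplier (fun x => threshold n (arc_level P a b x)).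
Proof.
apply: multiplierX.
have -> : (fun x => 1 - arc_level P a b x ^+ n) =
          (fun x => 1 + (-1) * arc_level P a b x ^+ n).
  by apply/funext => x; rewrite mulN1r.
apply: multiplierD; first exact: multiplier_cst.
apply: multiplierM; first exact: multiplier_cst.
apply: multiplierX.
have -> : arc_level P a b = (fun x => (1 / 2 + cos (pi * ((b - a) / P)) / 4) +
    (- 4^-1) * cos (2 * pi / P * (x - (a + b) / 2))).
  by apply/funext => x; rewrite /arc_level; field.
apply: multiplierD; first exact: multiplier_cst.
by apply: multiplierM; [exact: multiplier_cst|exact: multiplier_cos].
Qed.

Lemma arc_level_fold a b x : arc_level P a b (fold x) = arc_level P a b x.
Proof.
rewrite /fold; case: ifP => // _; rewrite /arc_level; congr (_ + (_ - _) / _).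
rewrite -[LHS](cos_period m); congr cos; rewrite dm; field.
exact: lt0r_neq0.
Qed.

Lemma measurable_arc_threshold a b n :
  measurable_fun setT (fun x => threshold n (arc_level P a b x)).
Proof.
apply: measurable_funX; apply: measurable_funB => //; apply: measurable_funX.
apply: measurable_funD => //; apply: measurable_funM => //; apply: measurable_funB => //.
have [mc _] := bounded_measurable_cos (2 * pi / P) (- (2 * pi / P * ((a + b) / 2))).
by move: mc; congr measurable_fun; apply/funext => x; congr cos; ring.
Qed.

Local Notation "\1C_ A" := (fun x => ((\1_A x : R)%:C)%C) (at level 0).

Lemma csq_real (r : R) : csq r%:C%C = r ^+ 2.
Proof. by rewrite /csq /= expr0n addr0. Qed.

Lemma approximable_folded_itv nu a b : S nu -> t <= a -> a <= b -> b <= t + P ->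
  appr (folded nu \1C_(`]a, b])).
Proof.
move=> Snu ta ab bP.
pose Q := `[t, t + P]%classic : set R.
(* The factor [\1_Q] provides an integrable bound and is invisible after folding, since [fold] sends
   the tile into [Q]. *)
pose F (n : nat) x : R[i] := (\1_Q x * threshold n (arc_level P a b x))%:C%C.
have mQ : measurable_fun setT (\1_Q : R -> R) by apply: measurable_indic; exact: measurable_itv.
have Qsq x : (\1_Q x : R) ^+ 2 = \1_Q x.
  by rewrite indicE; case: (_ \in _); rewrite ?expr1n ?expr0n.
apply: (@approximable_folded_dominated nu F _ (\1_Q) [set` [:: a; b; t; t + P]]).
- by move=> n; apply: cmeasurable_real; apply: measurable_funM => //; exact: measurable_arc_threshold.
- by apply: cmeasurable_real; apply: measurable_indic; exact: measurable_itv.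
- apply: bounded_supported_integrable; apply: (@bounded_supported_indic _ _ (`|t| + `|t + P|)).
    exact: measurable_itv.
  move=> x; rewrite /Q /= in_itv /= => /andP[tx xt]; rewrite ler_norml.
  have := ler_norm (t + P); have := ler_norm (- t); rewrite normrN.
  have := normr_ge0 t; have := normr_ge0 (t + P) => *.
  by apply/andP; split; lra.
- move=> n x; rewrite /F csq_real exprMn Qsq ler_piMr//.
  have /andP[h0 h1] := threshold_itv n (arc_level_itv P a b x).
  by rewrite exprn_ile1.
- move=> x; rewrite csq_real !indicE -natrX ler_nat.
  have [xab|] := boolP (x \in `]a, b]%classic); last by rewrite exp0n.
  suff -> : x \in Q by [].
  by move: xab; rewrite !inE /Q /= !in_itv /= => /andP[? ?]; apply/andP; split; lra.
- exact: finite_seq.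
- move=> x /= xN.
  have E n : csq ((\1_(`]a, b]) x)%:C%C - F n x) =
     (\1_(`]a, b]) x - \1_Q x * threshold n (arc_level P a b x)) ^+ 2.
    by rewrite /F -rmorphB csq_real.
  under eq_fun do rewrite E.
  have lim0 (v : R) : threshold n (arc_level P a b x) @[n --> \oo] --> v ->
      \1_(`]a, b]) x = \1_Q x * v ->
      (\1_(`]a, b]) x - \1_Q x * threshold n (arc_level P a b x)) ^+ 2 @[n --> \oo] --> (0 : R).
    move=> cv vE.
    have -> : (0 : R) = (\1_(`]a, b]) x - \1_Q x * v) * (\1_(`]a, b]) x - \1_Q x * v).
      by rewrite vE subrr mul0r.
    under eq_fun do rewrite expr2.
    by apply: cvgM; (apply: cvgB; [exact: cvg_cst|apply: cvgM => //; exact: cvg_cst]).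
  have [xa xb xt xtP] : [/\ x != a, x != b, x != t & x != t + P].
    by split; apply/eqP => h; apply: xN; rewrite h !inE eqxx ?orbT.
  have [xQ|xQ] := boolP (t < x < t + P); last first.
    have xQ' : ~ Q x.
      rewrite /Q /= in_itv /= => /andP[h1 h2]; move: xQ; apply/negP; rewrite negbK.
      by rewrite !lt_neqAle eq_sym xt h1 xtP h2.
    have xab : ~ `]a, b]%classic x.
      by move=> h; apply: xQ'; move: h; rewrite /Q /= !in_itv /= => /andP[? ?]; apply/andP; split; lra.
    have F0 n : (\1_(`]a, b]) x - \1_Q x * threshold n (arc_level P a b x)) ^+ 2 = 0.
      by rewrite !indicE !memNset// mul0r subrr expr0n.
    under eq_fun do rewrite F0.
    exact: cvg_cst.
  have /andP[x1 x2] := xQ.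
  have Q1 : \1_Q x = 1 :> R.
    by rewrite indicE mem_set// /Q /= in_itv /= !ltW.
  have /andP[l0 l1] := arc_level_itv P a b x.
  have [xab|xab] := boolP (a < x < b).
    apply: (lim0 1); first by apply: cvg_threshold_lt => //; apply: arc_level_lt => //; lra.
    rewrite Q1 mul1r indicE mem_set//= in_itv /=.
    by case/andP: xab => -> /ltW ->.
  apply: (lim0 0).
    apply: cvg_threshold_gt => //; apply: (arc_level_gt P0 ta ab bP xQ).
    by move: xab; rewrite negb_and -!leNgt => /orP[h|h]; apply/orP;
      [left|right]; rewrite lt_neqAle h ?xa// eq_sym xb.
  rewrite mulr0 indicE memNset//= in_itv /= => /andP[h1 h2].
  by move: xab; rewrite h1 lt_neqAle xb h2.
- move=> n; apply: lincomb_approximable => //.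
  have L0 : lincomb Lam e (e (t, nu)) by apply: lincomb1; split.
  have := multiplier_threshold a b n L0.
  congr lincomb; apply/funext => x; rewrite /folded /F mulrC arc_level_fold.
  have [->|ex] := eqVneq (e (t, nu) x) 0; first by rewrite !mul0r.
  have := @fold_itv (t, nu) x erefl ex => /andP[h1 h2].
  congr (_ * _); congr real_complex_def.
  by rewrite indicE mem_set ?mul1r// /Q /= in_itv /= h1 ltW.
Qed.

Let mfold1 nu (A : set R) : measurable A -> cmeasurable (folded nu \1C_A).
Proof.
by move=> mA; apply: cmeasurable_folded; apply: cmeasurable_real; apply: measurable_indic.
Qed.

(** Dynkin's induction from half-open intervals: complements are differences from the whole tile,
    and countable disjoint unions are dominated limits. Only the part of a set in [[t, t + P]]
    matters, which supplies the integrable bound. *)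
Lemma approximable_folded_indic nu (E : set R) : S nu -> measurable E ->
  appr (folded nu \1C_E).
Proof.
move=> Snu mE.
pose Q := `[t, t + P]%classic : set R.
have mQ : measurable Q by exact: measurable_itv.
have iQ : mu.-integrable setT (EFin \o (\1_Q : R -> R)).
  apply: bounded_supported_integrable; apply: (@bounded_supported_indic _ _ (`|t| + `|t + P|)) => //.
  move=> x; rewrite /Q /= in_itv /= => /andP[tx xt]; rewrite ler_norml.
  have := ler_norm (t + P); have := ler_norm (- t); rewrite normrN.
  have := normr_ge0 t; have := normr_ge0 (t + P) => *.
  by apply/andP; split; lra.
have restrict (A : set R) : folded nu \1C_A = folded nu \1C_(A `&` Q).
  apply: eq_folded => x /andP[tx xt]; congr real_complex_def.
  rewrite !indicE in_setI (_ : x \in Q = true) ?andbT//.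
  by rewrite mem_set// /Q /= in_itv /= tx ltW.
have bQ (A : set R) x : csq ((\1_(A `&` Q) x : R)%:C)%C <= \1_Q x.
  rewrite csq_real !indicE in_setI; case: (x \in A); case: (x \in Q);
    by rewrite ?expr1n ?expr0n.
have ET : appr (folded nu \1C_setT).
  have L0 : lincomb Lam e (e (t, nu)) by apply: lincomb1; split.
  have := lincomb_approximable L0; congr approximable; apply/funext => x.
  by rewrite /folded indicT mulr1.
have EU (A B : set R) : measurable A -> measurable B -> A `&` B = set0 ->
    appr (folded nu \1C_A) -> appr (folded nu \1C_B) -> appr (folded nu \1C_(A `|` B)).
  move=> mA mB AB aA aB.
  have := approximableD me (mfold1 nu mA) (mfold1 nu mB) aA aB.
  congr approximable; apply/funext => x; rewrite /folded -mulrDr -rmorphD /=.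
  congr (_ * _%:C%C); rewrite !indicE in_setU.
  have [xA|xA] := boolP (fold x \in A); have [xB|xB] := boolP (fold x \in B);
    rewrite ?addr0 ?add0r//.
  have : (A `&` B) (fold x) by split; exact/set_mem.
  by rewrite AB.
refine (@dynkin_induction _ (measurableTypeR R) (@ocitv R)
  (fun A => appr (folded nu \1C_A)) erefl (@ocitvI R) ET _ _ _ E mE).
- move=> _ [[a b] _ <-] /=.
  (* The interval is clamped to [[t, t + P]]; inside it, the clamped interval can differ from the
     original one only at the point [t], declared exceptional below. *)
  pose a' := Num.min (Num.max a t) (t + P).
  pose b' := Num.max a' (Num.min b (t + P)).
  have [h1 h2 h3 h4] : [/\ t <= a', a' <= b', b' <= t + P &
      forall x, t < x <= t + P -> (a < x <= b) = (a' < x <= b')].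
    have ? := P0.
    have ta : t <= a' by rewrite /a' le_min le_max lexx orbT; lra.
    have aP : a' <= t + P by rewrite /a' ge_min lexx orbT.
    split; [exact: ta| by rewrite /b' le_max lexx|by rewrite /b' ge_max aP ge_min lexx orbT|].
    move=> x /andP[tx xP]; apply/idP/idP => /andP[xa xb].
      have -> : a' < x by rewrite /a' gt_min gt_max xa tx.
      by rewrite /b' le_max; apply/orP; right; rewrite le_min xb xP.
    have ax : a < x.
      by move: xa; rewrite /a' gt_min gt_max [t + P < x]ltNge xP orbF => /andP[].
    rewrite ax; move: xb; rewrite /b' le_max leNgt xa /=.
    by rewrite le_min => /andP[].
  rewrite restrict.
  apply: (@approximable_folded_dominated nu (fun=> \1C_(`]a', b'])) _ (\1_Q) [set t]) => //.
  + by move=> n; apply: cmeasurable_real; apply: measurable_indic; exact: measurable_itv.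
  + by apply: cmeasurable_real; apply: measurable_indic; apply: measurableI => //; exact: measurable_itv.
  + move=> n x; have -> : `]a', b']%classic = `]a', b'] `&` Q; last exact: bQ.
    apply/esym/setIidPl => y; rewrite /Q /= !in_itv /= => /andP[? ?]; apply/andP; split; lra.
  + move=> x /= xt; have -> : \1_(`]a, b] `&` Q) x = \1_(`]a', b']) x :> R.
      rewrite !indicE in_setI; congr (_%:R); congr nat_of_bool.
      have I (u v : R) y : (y \in `]u, v]%classic) = (u < y <= v).
        by apply/idP/idP; rewrite inE /= in_itv.
      rewrite !I; have [xQ|xQ] := boolP (x \in Q).
        move: xQ; rewrite inE /Q /= in_itv /= andbT => /andP[? ?]; apply: h4.
        by rewrite lt_neqAle eq_sym; apply/andP; split => //; apply/andP; split => //; apply/eqP.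
      rewrite andbF; apply/esym/negbTE; apply: contra xQ => /andP[? ?].
      by rewrite inE /Q /= in_itv /=; apply/andP; split; lra.
    under eq_fun do rewrite subrr /csq /= expr0n addr0.
    exact: cvg_cst.
  + by move=> n; apply: approximable_folded_itv.
- move=> A mA aA; have mT := mfold1 nu (@measurableT _ R).
  have := approximableB me mT (mfold1 nu mA) ET aA.
  congr approximable; apply/funext => x; rewrite /folded -mulrBr -rmorphB /=.
  congr (_ * _%:C%C); rewrite !indicE in_setT in_setC.
  by case: (_ \in A); rewrite ?subrr ?subr0.
- move=> F mF tF aF; rewrite restrict.
  pose U n := \big[setU/set0]_(i < n) F i.
  have mU n : measurable (U n) by apply: bigsetU_measurable.
  have mUQ n : measurable (U n `&` Q) by exact: (measurableI _ _ (mU n) mQ).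
  have mFQ : measurable ((\bigcup_k F k) `&` Q).
    exact: (@measurableI _ (measurableTypeR R) _ _ (bigcupT_measurable F mF) mQ).
  apply: (@approximable_folded_dominated nu (fun n => \1C_(U n `&` Q)) _ (\1_Q) set0) => //.
  + by move=> n; apply: cmeasurable_real; exact: measurable_indic (mUQ n).
  + by apply: cmeasurable_real; exact: measurable_indic mFQ.
  + move=> x _; apply: cvg_near_cst.
    have [[i _ Fix]|no] := pselect ((\bigcup_k F k) x).
      exists i.+1 => // n /= ni.
      have -> : \1_((\bigcup_k F k) `&` Q) x = \1_(U n `&` Q) x :> R.
        rewrite !indicE !in_setI; congr ((_ && _)%:R).
        by rewrite !mem_set//; [rewrite /U -bigcup_mkord; exists i|exists i].
      by rewrite subrr /csq /= expr0n addr0.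
    exists 0%N => // n _ /=.
    have -> : \1_((\bigcup_k F k) `&` Q) x = \1_(U n `&` Q) x :> R.
      rewrite !indicE !in_setI; congr ((_ && _)%:R).
      rewrite !memNset// /U -bigcup_mkord => -[i /= ni Fi]; apply: no.
      by exists i.
    by rewrite subrr /csq /= expr0n addr0.
  + move=> n; rewrite -restrict; elim: n => [|n IH].
      rewrite /U big_ord0; have := approximable0 Lam e; congr approximable.
      by apply/funext => x; rewrite /folded indic0 mulr0.
    rewrite /U big_ord_recr /=; apply: (EU _ _ (mU n) (mF n) _ IH (aF n)).
    apply/seteqP; split => // x; rewrite /U -bigcup_mkord => -[[i /= ni Fi] Fn].
    have /trivIsetP/(_ i n I I) := tF; rewrite (ltn_eqF ni) => /(_ isT) E0.
    by have : (F i `&` F n) x by []; rewrite E0.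
Qed.

Import HBNNSimple.

Lemma approximable_folded_ge0 nu (k : R -> R) : S nu -> measurable_fun setT k ->
  (forall x, 0 <= k x) -> mu.-integrable setT (EFin \o (fun x => k x ^+ 2)) ->
  appr (folded nu (fun x => (k x)%:C%C)).
Proof.
move=> Snu mk k0 ik.
have mk' : measurable_fun setT (EFin \o k) by exact/measurable_EFinP.
pose g := @nnsfun_approx _ (measurableTypeR R) R setT measurableT (EFin \o k) mk'.
have cg x : g n x @[n --> \oo] --> k x.
  have /fine_cvgP[_] : (EFin \o g^~ x) n @[n --> \oo] --> (k x)%:E.
    by apply: (@cvg_nnsfun_approx _ (measurableTypeR R)) => // y _; rewrite lee_fin.
  exact.
have gk n x : g n x <= k x.
  rewrite -(cvg_lim (@Rhausdorff R) (cg x)).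
  apply: (@nondecreasing_cvgn_le _ (g^~ x)); last exact: (cvgP _ (cg x)).
  move=> i j ij; have := @nd_nnsfun_approx _ (measurableTypeR R) R setT measurableT (EFin \o k) mk' i j ij.
  by move=> /lefP; apply.
have mg n : measurable_fun setT (g n : R -> R).
  exact: (@measurable_funPT _ _ (measurableTypeR R) _ (g n)).
apply: (@approximable_folded_dominated nu (fun n x => (g n x)%:C%C) _ (fun x => k x ^+ 2) set0) => //.
- by move=> n; apply: cmeasurable_real.
- by move=> n x; rewrite csq_real ler_pXn2r// nnegrE.
- by move=> x; rewrite csq_real.
- move=> x _; under eq_fun do rewrite -rmorphB csq_real expr2.
  rewrite -(mulr0 (k x - k x)) -[X in _ * X](subrr (k x)).
  by apply: cvgM; apply: cvgB => //; exact: cvg_cst.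
- move=> n.
  have [s gs] : exists s : seq R, forall x,
      g n x = \sum_(r <- s) r * \1_(g n @^-1` [set r]) x.
    by eexists => x; rewrite fimfunE fsbig_finite.
  have E : folded nu (fun x => (g n x)%:C%C) = fun x => \sum_(r <- s)
     r%:C%C * folded nu \1C_(g n @^-1` [set r]) x.
    apply/funext => x; rewrite /folded gs rmorph_sum /= mulr_sumr.
    by apply: eq_bigr => r _; rewrite rmorphM /= mulrCA.
  have mP (r : R) : measurable (g n @^-1` [set r]).
    by have := mg n measurableT _ (measurable_set1 r); rewrite setTI.
  rewrite E; apply: (approximable_sum me) => r.
    exact: (cmeasurableM (cmeasurable_cst _) (mfold1 nu (mP r))).
  exact: (approximableZ me _ (mfold1 nu (mP r)) (approximable_folded_indic Snu (mP r))).
Qed.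

Lemma approximable_folded nu k : S nu -> L2 k -> appr (folded nu k).
Proof.
move=> Snu Lk; have ik := L2_integrable Lk; have [[mk1 mk2] _] := Lk.
have real_part (u : R -> R) : measurable_fun setT u ->
    (forall x, u x ^+ 2 <= csq (k x)) -> appr (folded nu (fun x => (u x)%:C%C)).
  move=> mu1 uk.
  have part (v : R -> R) : measurable_fun setT v -> (forall x, 0 <= v x) ->
      (forall x, v x ^+ 2 <= u x ^+ 2) -> appr (folded nu (fun x => (v x)%:C%C)).
    move=> mv v0 vu; apply: approximable_folded_ge0 => //.
    apply: (le_integrable _ _ _ ik) => //.
      by apply/measurable_EFinP; apply: measurable_funX.
    move=> x _; rewrite /= lee_fin !ger0_norm ?sqr_ge0 ?csq_ge0//.
    exact: le_trans (vu x) (uk x).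
  pose p x := Num.max (u x) 0; pose q x := Num.max (- u x) 0.
  have mp : measurable_fun setT p by apply: measurable_maxr.
  have mq : measurable_fun setT q by apply: measurable_maxr => //; exact: measurableT_comp.
  have ap : appr (folded nu (fun x => (p x)%:C%C)).
    apply: part => // x; rewrite /p; first by rewrite le_max lexx orbT.
    by case: (leP (u x) 0) => _; rewrite ?expr0n ?sqr_ge0.
  have aq : appr (folded nu (fun x => (q x)%:C%C)).
    apply: part => // x; rewrite /q; first by rewrite le_max lexx orbT.
    by case: (leP (- u x) 0) => _; rewrite ?expr0n ?sqr_ge0 ?sqrrN.
  have := approximableB me (cmeasurable_folded nu (cmeasurable_real mp))
    (cmeasurable_folded nu (cmeasurable_real mq)) ap aq.
  congr approximable; apply/funext => x; rewrite /folded -mulrBr -rmorphB /=.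
  congr (_ * _%:C%C); rewrite /p /q.
  by case: (leP (u (fold x)) 0) => h1; case: (leP (- u (fold x)) 0) => h2; lra.
have a1 : appr (folded nu (fun x => (complex.Re (k x))%:C%C)).
  by apply: real_part => // x; rewrite /csq lerDl sqr_ge0.
have a2 : appr (folded nu (fun x => (complex.Im (k x))%:C%C)).
  by apply: real_part => // x; rewrite /csq lerDr sqr_ge0.
have m1 := cmeasurable_folded nu (cmeasurable_real mk1).
have m2 := cmeasurable_folded nu (cmeasurable_real mk2).
have := approximableD me m1 (cmeasurableM (cmeasurable_cst 'i%C) m2) a1 (approximableZ me 'i%C m2 a2).
congr approximable; apply/funext => x; rewrite /folded /= [k _ in RHS]complexE.
by ring.
Qed.

End Fiber.

(** * Product bases *)

Section ProductBasis.
Context {R : realType}.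
Local Notation mu := (@lebesgue_measure R).
Implicit Types (f g : R -> R[i]).

Lemma approximableS (I : choiceType) (A B : set I) (e : I -> R -> R[i]) f :
  A `<=` B -> approximable A e f -> approximable B e f.
Proof.
move=> AB af eps e0; have [h [s [c [us sA hE]]] fh] := af _ e0.
by exists h => //; exists s, c; split => // i /sA /AB.
Qed.

Lemma L2D f g : L2 f -> L2 g -> L2 (fun x => f x + g x).
Proof.
move=> [mf] + [mg]; rewrite !L2norm_lty => ef eg; split; first exact: cmeasurableD.
rewrite L2norm_lty (le_lt_trans (energyD_le mf mg))//.
by rewrite lte_add_pinfty// lte_mul_pinfty// lee_fin.
Qed.

Lemma L2_le f g : cmeasurable g -> L2 f -> (forall x, csq (g x) <= csq (f x)) -> L2 g.
Proof.
move=> mg [mf]; rewrite L2norm_lty => ef gf; split => //.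
rewrite L2norm_lty (le_lt_trans _ ef)//; apply: ge0_le_integral => //.
- by move=> x _; rewrite lee_fin csq_ge0.
- by apply/measurable_EFinP; exact: measurable_csq.
- by apply/measurable_EFinP; exact: measurable_csq.
- by move=> x _; rewrite lee_fin.
Qed.

Lemma L2Z (z : R[i]) f : L2 f -> L2 (fun x => z * f x).
Proof.
move=> [mf]; rewrite L2norm_lty => ef; split.
  exact: (cmeasurableM (cmeasurable_cst z) mf).
by rewrite L2norm_lty energyZ// lte_mul_pinfty// lee_fin csq_ge0.
Qed.

Lemma L2_shift f (t : R) : L2 f -> L2 (fun x => f (x + t)).
Proof.
move=> [mf]; rewrite L2norm_lty => ef; split; first exact: cmeasurable_shift.
rewrite L2norm_lty /energy.
have m : measurable_fun setT (fun x => (csq (f x))%:E).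
  by apply/measurable_EFinP; exact: measurable_csq.
rewrite (ge0_integral_shift t m)// => x.
by rewrite lee_fin csq_ge0.
Qed.

Lemma L2_if (c : R) f g : L2 f -> L2 g -> L2 (fun x => if x < c then f x else g x).
Proof.
move=> Lf Lg.
have m (h : R -> R) (h' : R -> R) : measurable_fun setT h -> measurable_fun setT h' ->
    measurable_fun setT (fun x : R => if x < c then h x else h' x).
  by move=> mh mh'; apply: measurable_fun_ifT => //; exact: measurable_fun_ltr.
pose f' (x : R) := if x < c then f x else 0; pose g' (x : R) := if x < c then 0 else g x.
have -> : (fun x => if x < c then f x else g x) = (fun x => f' x + g' x).
  by apply/funext => x; rewrite /f' /g'; case: ifP; rewrite ?addr0 ?add0r.
have [[f1 f2] _] := Lf; have [[g1 g2] _] := Lg.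
have if_Re (b : bool) (u v : R[i]) : complex.Re (if b then u else v) = if b then complex.Re u else complex.Re v by case: b.
have if_Im (b : bool) (u v : R[i]) : complex.Im (if b then u else v) = if b then complex.Im u else complex.Im v by case: b.
apply: L2D.
  apply: (L2_le _ Lf).
    split; rewrite /f'.
      by under eq_fun do rewrite if_Re; apply: m.
    by under eq_fun do rewrite if_Im; apply: m.
  by move=> x; rewrite /f'; case: ifP => // _; rewrite {1}/csq /= expr0n addr0 csq_ge0.
apply: (L2_le _ Lg).
  split; rewrite /g'.
    by under eq_fun do rewrite if_Re; apply: m.
  by under eq_fun do rewrite if_Im; apply: m.
by move=> x; rewrite /g'; case: ifP => // _; rewrite {1}/csq /= expr0n addr0 csq_ge0.
Qed.

Variables (al be : R).
Hypotheses (al0 : 0 < al) (al2 : al <= 1 / 2) (be0 : 0 < be).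
Local Notation Om := (two_intervals al be).
Local Notation e := (time_freq_shift (cindic Om)).

(** Functions over distinct tiles have disjoint supports, so orthogonality only concerns frequencies
    over one tile. For completeness, [f] is the dominated limit of its restrictions to finitely many
    tiles. *)
Lemma product_orthonormal_basis (T S : set R) : exact_tiling al be T ->
  countable T ->
  (forall nu nu', S nu -> S nu' -> nu != nu' -> fourier_csq (\1_Om) (nu - nu') = 0) ->
  (forall t, T t -> forall f, L2 f ->
     approximable [set l | l.1 = t /\ S l.2] e (fun x => (\1_Om (x - t))%:C%C * f x)) ->
  orthonormal_basis [set l : R * R | T l.1 /\ S l.2] e.
Proof.
move=> [cT uT] ctT orth app.
have bOm := two_intervals_bounded al0 al2 be0.
have mOm := measurable_two_intervals al be.
have muOm := measure_two_intervals al0 al2 be0.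
have be' l := bounded_supported_gabor mOm bOm l.
have me l : cmeasurable (e l) := bounded_supportedC_cmeasurable (be' l).
split.
- by move=> l _; exact: bounded_supported_L2.
- move=> l l' [Tl Sl] [Tl' Sl'].
  have [<-|ll'] := eqVneq l l'.
    rewrite L2inner_selfE.
    have -> : \int[mu]_x csq (e l x) = \int[mu]_x \1_Om (x - l.1).
      apply: eq_Rintegral => x _; rewrite csqM csq_expi mulr1 /csq /cindic /= indicE.
      by case: (_ \in _); rewrite ?expr1n ?expr0n /= addr0.
    rewrite (Rintegral_shift (- l.1) (bounded_supported_window mOm bOm)).
    by rewrite /Rintegral (integral_window mOm muOm).
  apply/eqP; rewrite -csq_eq0 (csq_L2inner_gabor mOm bOm).
  have [E1|n1] := eqVneq l.1 l'.1.
    have -> : overlap Om (l.1 - l'.1) = \1_Om.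
      apply/funext => x; rewrite E1 subrr /overlap subr0 indicE.
      by case: (_ \in _); rewrite ?mulr1 ?mulr0.
    rewrite orth//; apply: contra ll' => /eqP E2; apply/eqP.
    by case: l l' E1 E2 {Tl Sl Tl' Sl'} => [? ?] [? ?] /= -> ->.
  have o0 x : overlap Om (l.1 - l'.1) x = 0.
    rewrite /overlap !indicE.
    have [h1|_] := boolP (_ \in _); last by rewrite mul0r.
    have [h2|_] := boolP (_ \in _); last by rewrite mulr0.
    exfalso; move/eqP: n1; apply; apply: (uT (x + l'.1)) => //.
      by move: h1; rewrite inE; congr Om; ring.
    by move: h2; rewrite inE addrK.
  have z (h : R -> R) : \int[mu]_x (overlap Om (l.1 - l'.1) x * h x) = 0.
    transitivity (\int[mu]_x (cst 0 x : R)).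
      by apply: eq_Rintegral => x _; rewrite o0 mul0r.
    by rewrite Rintegral_cst// mul0r.
  by rewrite /fourier_csq !z expr0n addr0.
- move=> f Lf eps e0.
  suff af : approximable [set l : R * R | T l.1 /\ S l.2] e f.
    have e2 : 0 < eps ^+ 2 by rewrite exprn_gt0.
    have [h [s [c [us sL hE]]] fh] := af _ e2; exists s, c; split => //.
    rewrite L2norm_lt//; move: fh; congr (energy _ < _)%E.
    by apply/funext => x; rewrite hE.
  have [P [en [TE en_inj]]] := countable_enum (A := T) ctT.
  have Ten k : P k -> T (en k) by move=> Pk; rewrite TE; exists k.
  have [mf _] := Lf.
  (* The union of the tiles of index below [n]; it grows by at most one tile, disjoint from the
     previous ones. *)
  pose U n := [set x | exists k, [/\ (k < n)%N, P k & Om (x - en k)]].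
  have stepU n : (fun x => (\1_(U n.+1) x)%:C%C * f x) =
      (fun x => (\1_(U n) x)%:C%C * f x +
         (P n)%:R * ((\1_Om (x - en n))%:C%C * f x)).
    apply/funext => x; rewrite mulrA -mulrDl; congr (_ * _).
    rewrite !indicE; have [h|h] := boolP (x \in U n).
      have -> : x \in U n.+1.
        move: h; rewrite !inE => -[k [kn Pk Ok]].
        by exists k; split => //; exact: ltnW.
      case: (boolP (P n)) => Pn; last by rewrite mul0r addr0.
      rewrite memNset ?mulr0 ?addr0// => On.
      move: h; rewrite inE => -[k [kn Pk Ok]].
      have := uT x _ _ (Ten _ Pn) (Ten _ Pk) On Ok => /(en_inj _ _).
      by rewrite !inE => /(_ Pn Pk) nk; move: kn; rewrite nk ltnn.
    case: (boolP (P n)) => Pn; last first.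
      rewrite mul0r addr0 memNset// => -[k [kn Pk Ok]].
      move/negP: h; apply; rewrite inE; exists k; split => //.
      rewrite ltn_neqAle -ltnS kn andbT; apply: contraNneq Pn => <-.
      exact: Pk.
    rewrite mul1r add0r; congr ((_%:R)%:C%C); congr nat_of_bool.
    apply/idP/idP; rewrite !inE; last by move=> On; exists n; split.
    move=> [k [kn Pk Ok]]; have [<-//|kn'] := eqVneq k n.
    exfalso; move/negP: h; apply; rewrite inE; exists k; split => //.
    by rewrite ltn_neqAle kn' -ltnS.
  have mterm n : cmeasurable (fun x => (\1_Om (x - en n))%:C%C * f x).
    apply: cmeasurableM => //; apply: cmeasurable_real.
    by have [] := bounded_measurable_window_shift mOm (en n).
  have U0 : (fun x => (\1_(U 0%N) x)%:C%C * f x) = cst 0.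
    apply/funext => x; rewrite indicE memNset ?mul0r// => -[k []].
    by rewrite ltn0.
  have mU n : cmeasurable (fun x => (\1_(U n) x)%:C%C * f x).
    elim: n => [|n IH]; first by rewrite U0; exact: cmeasurable_cst.
    rewrite stepU; apply: cmeasurableD => //.
    exact: (cmeasurableM (cmeasurable_cst _) (mterm n)).
  have aU n : approximable [set l : R * R | T l.1 /\ S l.2] e (fun x => (\1_(U n) x)%:C%C * f x).
    elim: n => [|n IH]; first by rewrite U0; exact: approximable0.
    rewrite stepU; case: (boolP (P n)) => Pn; last first.
      by under [X in approximable _ _ X]eq_fun do rewrite mul0r addr0.
    apply: (approximableD me) => //.
      exact: (cmeasurableM (cmeasurable_cst _) (mterm n)).
    under [X in approximable _ _ X]eq_fun do rewrite mul1r.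
    apply: approximableS (app _ (Ten _ Pn) _ Lf).
    by move=> l /= [-> Sl]; split => //; exact: Ten.
  apply: (approximable_dominated me (F := fun n x => (\1_(U n) x)%:C%C * f x)
    (G := csq \o f)) => //.
  + exact: L2_integrable.
  + move=> n x; rewrite csqM ler_piMl ?csq_ge0// /csq /= expr0n addr0 indicE.
    by case: (_ \in _); rewrite ?expr1n ?expr0n.
  + apply: aeW => x; apply: cvg_near_cst.
    have [t Tt Ot] := cT x; move: Tt; rewrite TE => -[k Pk kt].
    exists k.+1 => // n /= kn.
    rewrite indicE mem_set; last by exists k; rewrite kt.
    by rewrite mul1r subrr /csq /= expr0n addr0.
Qed.

End ProductBasis.

(** * Tilings by integers and by half-integers *)

Section ExplicitTilings.
Context {R : realType}.
Local Notation mu := (@lebesgue_measure R).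
Implicit Types (al be x y t nu q : R) (T : set R) (j : int) (n : nat).

Lemma sin_periodz j x : sin (x + 2 * pi * j%:~R) = sin x.
Proof.
case: j => n; first exact: sin_period.
by rewrite NegzE mulrNz -[in RHS](subrK (2 * pi * n.+1%:R) x) sin_period mulrN.
Qed.

Lemma eq_intr_dist (j k : int) : `|j%:~R - k%:~R| < 1 :> R -> j = k.
Proof. by rewrite -intrB -intr_norm ltrz1; lia. Qed.

(** The assumed sum of sines is [2 * pi * nu] times the integral over the two intervals of the
    cosine of phase [q]; the phases 0 and [- (pi / 2)] give the cosine and sine integrals. *)
Lemma fourier_csq_two_intervals_eq0 al be nu : 0 < al -> al <= 1 / 2 -> 0 < be ->
  nu != 0 ->
  (forall q, sin (2 * pi * nu * al + q) - sin q +
     (sin (2 * pi * nu * (1 + be) + q) - sin (2 * pi * nu * (al + be) + q)) = 0) ->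
  fourier_csq (\1_(two_intervals al be)) nu = 0.
Proof.
move=> al0 al2 be0 nu0 H; set w := 2 * pi * nu in H.
have w0 : w != 0 by rewrite !mulf_neq0// gt_eqF// pi_gt0.
have bi a b : bounded_supported (\1_(`[a, b[) : R -> R).
  apply: (@bounded_supported_indic _ _ (`|a| + `|b|)); first exact: measurable_itv.
  move=> x; rewrite /= in_itv /= => /andP[ax xb]; rewrite ler_norml.
  have := ler_norm b; have := ler_norm (- a); rewrite normrN.
  have := normr_ge0 a; have := normr_ge0 b => *.
  by apply/andP; split; lra.
have ii a b q : mu.-integrable setT (EFin \o (fun x => \1_(`[a, b[) x * cos (w * x + q))).
  apply: bounded_supported_integrable; apply: bounded_supportedM (bi a b) _.
  exact: bounded_measurable_cos.
have I q : \int[mu]_x (\1_(two_intervals al be) x * cos (w * x + q)) = 0.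
  transitivity (\int[mu]_x (\1_(`[0, al[) x * cos (w * x + q) +
                            \1_(`[al + be, 1 + be[) x * cos (w * x + q))).
    by apply: eq_Rintegral => x _; rewrite two_intervalsE// mulrDl.
  rewrite (RintegralD measurableT (ii _ _ q) (ii _ _ q)).
  rewrite !Rintegral_itv_cos//; [|lra|exact: ltW].
  by rewrite -mulrDl mulr0 add0r H mul0r.
rewrite /fourier_csq -/w.
have -> : \int[mu]_x (\1_(two_intervals al be) x * cos (w * x)) = 0.
  by rewrite -(I 0); apply: eq_Rintegral => x _; rewrite addr0.
have -> : \int[mu]_x (\1_(two_intervals al be) x * sin (w * x)) = 0.
  by rewrite -(I (- (pi / 2))); apply: eq_Rintegral => x _; rewrite cosBpihalf.
by rewrite expr0n addr0.
Qed.

Lemma discrete_set_separated (T : pseudoMetricType R) (A : set T) (d : R) :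
  0 < d -> (forall a b, A a -> A b -> ball a d b -> a = b) -> discrete_set A.
Proof.
move=> d0 sep x Ax; split; first exact/mem_set.
exists (ball x d); first exact: nbhsx_ballx.
apply/seteqP; split => [y [xy Ay]|y ->]; first by rewrite (sep x y).
by split => //; exact: ballxx.
Qed.

Lemma exact_tiling_tiles_line al be T : 0 < al -> al <= 1 / 2 -> 0 < be ->
  exact_tiling al be T -> tiles_line (two_intervals al be).
Proof.
move=> al0 al2 be0 [cT uT]; exists T.
  apply: (@discrete_set_separated _ _ (1 / 2)); first by rewrite divr_gt0.
  move=> t t' Tt Tt' tt'; exact: (tiling_separated al0 al2 be0 uT).
apply: aeW => x; have [t Tt Ot] := cT x.
rewrite (esumID [set t]); last by move=> s _; rewrite lee_fin.
have -> : T `&` [set t] = [set t] by apply/setIidPr => _ ->.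
rewrite esum_set1 ?lee_fin// indicE mem_set// esum1 ?adde0// => s [Ts st].
rewrite indicE memNset// => Os; apply: st.
exact: (uT x).
Qed.

Definition integer_set : set R := range (fun j : int => j%:~R).

Lemma exact_tiling_integers al n : 0 < al -> al <= 1 / 2 ->
  exact_tiling al n%:R integer_set.
Proof.
move=> al0 al2; split=> [x|x _ _ [j _ <-] [k _ <-]].
  have := floor_itv x; rewrite intrD => /andP[? ?].
  case: (ltP (x - (Num.floor x)%:~R) al) => ?.
    by exists (Num.floor x)%:~R; [exists (Num.floor x)|apply/two_intervalsP/orP; left; apply/andP; split; lra].
  exists (Num.floor x - n%:Z)%:~R; first by exists (Num.floor x - n%:Z).
  by apply/two_intervalsP/orP; right; rewrite intrB; apply/andP; split; lra.
have shift (i i' : int) : `|i%:~R - (i' + n%:Z)%:~R| < 1 :> R ->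
    i%:~R = i'%:~R + n%:R :> R by move=> /eq_intr_dist ->; rewrite intrD.
move=> /two_intervalsP/orP[/andP[? ?]|/andP[? ?]] /two_intervalsP/orP[/andP[? ?]|/andP[? ?]].
- by congr (_ %:~R); apply: eq_intr_dist; rewrite ltr_norml; apply/andP; split; lra.
- have := @shift j k; rewrite intrD ltr_norml => E; exfalso.
  suff: j%:~R = k%:~R + n%:R :> R by lra.
  by apply: E; apply/andP; split; lra.
- have := @shift k j; rewrite intrD ltr_norml => E; exfalso.
  suff: k%:~R = j%:~R + n%:R :> R by lra.
  by apply: E; apply/andP; split; lra.
- by congr (_ %:~R); apply: eq_intr_dist; rewrite ltr_norml; apply/andP; split; lra.
Qed.

(* [Omega] is made of two half-unit cells at distance [n.+1] cells, so exactly
   one of the cells [k] and [k - n.+1] must carry a translate. *)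
Definition half_integer_set n : set R :=
  [set t | exists2 k : int, ((k %% (2 * n.+1)%:Z)%Z < n.+1%:Z) & t = k%:~R / 2].

(** Subtracting [m] exchanges the two halves of the residues modulo [2 * m]. *)
Lemma modz_double_lt (k m : int) : 0 < m ->
  ((k - m) %% (2 * m) < m)%Z = ~~ (k %% (2 * m) < m)%Z.
Proof.
move=> m0; have m2 : 0 < 2 * m by lia.
have := divz_eq k (2 * m); have := divz_eq (k - m) (2 * m).
have := modz_ge0 k (lt0r_neq0 m2); have := modz_ge0 (k - m) (lt0r_neq0 m2).
have := ltz_pmod k m2; have := ltz_pmod (k - m) m2.
move: (k %% (2 * m))%Z ((k - m) %% (2 * m))%Z (k %/ (2 * m))%Z ((k - m) %/ (2 * m))%Z.
move=> r s a b sm rm s0 r0 E1 E2.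
(* The right-hand side lies strictly between [- m] and [3 * m], so the quotients differ by 0 or
   1. *)
have E : (a - b) * (2 * m) = m + s - r by lia.
have [ab|ab] := ltrP a b.
  have : 0 <= (b - a - 1) * m by rewrite mulr_ge0; lia.
  by move: E; nia.
have [ab1|ab1] := ltrP 1 (a - b).
  have : 0 <= (a - b - 2) * m by rewrite mulr_ge0; lia.
  by move: E; nia.
have [E3|E3] : a = b \/ a = b + 1 by lia.
  by move: E; rewrite E3 subrr mul0r => E; apply/idP/idP; lia.
by move: E; rewrite E3 addrAC subrr add0r mul1r => E; apply/idP/idP; lia.
Qed.

Lemma exact_tiling_half_integers n : exact_tiling (1 / 2) (n%:R / 2) (half_integer_set n).
Proof.
pose m := n.+1%:Z; have m0 : 0 < m by [].
have mE : (2 * n.+1)%:Z = 2 * m by rewrite /m; lia.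
have mR : m%:~R = n%:R + 1 :> R by rewrite /m -pmulrn -natr1.
split=> [x|x _ _ [j jm ->] [k km ->]].
  have := floor_itv (2 * x); rewrite intrD; set i := Num.floor _ => /andP[? ?].
  have [im|im] := boolP (i %% (2 * m) < m)%Z.
    exists (i%:~R / 2); first by exists i; rewrite ?mE.
    by apply/two_intervalsP/orP; left; apply/andP; split; lra.
  exists ((i - m)%:~R / 2); first by exists (i - m) => //; rewrite mE modz_double_lt.
  by apply/two_intervalsP/orP; right; rewrite intrB; apply/andP; split; lra.
rewrite !mE in jm km.
have shift (i i' : int) : `|i%:~R - (i' + m)%:~R| < 1 :> R ->
    (i %% (2 * m) < m)%Z -> (i' %% (2 * m) < m)%Z -> False.
  by move=> /eq_intr_dist -> h; have := modz_double_lt (i' + m) m0; rewrite h addrK => ->.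
move=> /two_intervalsP/orP[/andP[? ?]|/andP[? ?]] /two_intervalsP/orP[/andP[? ?]|/andP[? ?]].
- by congr (_ %:~R / _); apply: eq_intr_dist; rewrite ltr_norml; apply/andP; split; lra.
- exfalso; apply: (shift j k) => //; rewrite intrD ltr_norml; apply/andP; split; lra.
- exfalso; apply: (shift k j) => //; rewrite intrD ltr_norml; apply/andP; split; lra.
- by congr (_ %:~R / _); apply: eq_intr_dist; rewrite ltr_norml; apply/andP; split; lra.
Qed.

End ExplicitTilings.

(** * Orthonormal bases over the explicit tilings *)

Section ExplicitBases.
Context {R : realType}.
Local Notation mu := (@lebesgue_measure R).
Implicit Types (al be x y t nu q : R) (f : R -> R[i]) (j : int) (n : nat).

Lemma countable_integers : countable (@integer_set R).
Proof. exact: sub_countable (card_image_le _ _) (countableP _). Qed.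

Lemma countable_half_integers n : countable (@half_integer_set R n).
Proof.
apply: (@sub_countable _ _ _ (range (fun k : int => k%:~R / 2 : R))).
  by apply: subset_card_le => t [k _ ->]; exists k.
exact: sub_countable (card_image_le _ _) (countableP _).
Qed.

(** Modulo 1 the two intervals fill one period without overlap. Integer frequencies are thus
    orthogonal on the tile, and with [P = 1] and [d = n] every function on it is folded from a
    single frequency. *)
Lemma gabor_basis_integers al n : 0 < al -> al <= 1 / 2 -> (0 < n)%N ->
  orthonormal_basis [set l : R * R | integer_set l.1 /\ integer_set l.2]
    (time_freq_shift (cindic (two_intervals al n%:R))).
Proof.
move=> al0 al2 n0; have be0 : 0 < n%:R :> R by rewrite ltr0n.
apply: (product_orthonormal_basis al0 al2 be0).
- exact: exact_tiling_integers.
- exact: countable_integers.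
- move=> _ _ [j _ <-] [k _ <-] jk; rewrite -intrB.
  apply: fourier_csq_two_intervals_eq0 => // [|q]; first by rewrite intrB subr_eq0.
  have -> : 2 * pi * (j - k)%:~R * (1 + n%:R) + q =
      q + 2 * pi * ((j - k) * (1 + n%:Z))%:~R by rewrite !(intrM, intrD); ring.
  have -> : 2 * pi * (j - k)%:~R * (al + n%:R) + q =
      (2 * pi * (j - k)%:~R * al + q) + 2 * pi * ((j - k) * n%:Z)%:~R.
    by rewrite !(intrM, intrD); ring.
  by rewrite !sin_periodz; ring.
- move=> t _ f Lf.
  pose k y := if y < t + al then f y else f (y + n%:R).
  have Lk : L2 k by apply: L2_if => //; exact: L2_shift.
  have up nu : @integer_set R nu -> integer_set (nu + 1^-1).
    by move=> [j _ <-]; exists (j + 1) => //; rewrite intrD invr1.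
  have down nu : @integer_set R nu -> integer_set (nu - 1^-1).
    by move=> [j _ <-]; exists (j - 1) => //; rewrite intrB invr1.
  have S0 : @integer_set R 0 by exists 0.
  have := @approximable_folded R al n%:R al0 al2 be0 t 1 n%:R n (@integer_set R) ltr01
    _ _ _ _ up down 0 k S0 Lk.
  rewrite mulr1 => /(_ _ erefl) H.
  have := H ltac:(lra) ltac:(lra) ltac:(lra).
  congr approximable; apply/funext => x.
  rewrite /folded /time_freq_shift /= mulr0 expi0 mulr1 /cindic indicE.
  have [|_] := boolP (x - t \in _); last by rewrite !mul0r.
  rewrite inE => /two_intervalsP/orP[/andP[? ?]|/andP[? ?]]; rewrite !mul1r /fold /k.
    by rewrite !ifT//; lra.
  have -> : (x < t + al) = false by apply/negbTE; rewrite -leNgt; lra.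
  have -> : (x - n%:R < t + al) = false by apply/negbTE; rewrite -leNgt; lra.
  by rewrite subrK.
Qed.

Definition half_frequency_set n : set R :=
  range (fun p : int * bool => 2 * p.1%:~R + p.2%:R / n.+1%:R).

Lemma countable_half_frequencies n : countable (half_frequency_set n).
Proof. exact: sub_countable (card_image_le _ _) (countableP _). Qed.

(** [s] is a difference of two booleans. For [s = 0] each half-unit interval carries a whole number
    of periods; for [s = 1] or [s = -1] the distance [n.+1 / 2] between the intervals gives them
    opposite phases. *)
Lemma fourier_csq_half n j (s : R) : 2 * j%:~R + s / n.+1%:R != 0 -> (0 < n)%N ->
  [\/ s = 0, s = 1 | s = -1] ->
  fourier_csq (\1_(two_intervals (1 / 2) (n%:R / 2))) (2 * j%:~R + s / n.+1%:R) = 0.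
Proof.
move=> nu0 n0 sE; have be0 : 0 < n%:R / 2 :> R by rewrite divr_gt0 ?ltr0n.
have al0 : 0 < 1 / 2 :> R by rewrite divr_gt0.
apply: fourier_csq_two_intervals_eq0 => // q; move=> {nu0}.
have M0 : n%:R + 1 != 0 :> R by rewrite natr1.
have nE : n.+1%:R = n%:R + 1 :> R by rewrite natr1.
set w := 2 * pi * _.
case: sE => sE.
- have -> : w * (1 / 2) + q = q + 2 * pi * j%:~R by rewrite /w sE nE; field.
  have -> : w * (1 + n%:R / 2) + q = q + 2 * pi * (j * (2 + n%:Z))%:~R.
    by rewrite /w sE nE !(intrM, intrD); field.
  have -> : w * (1 / 2 + n%:R / 2) + q = q + 2 * pi * (j * (1 + n%:Z))%:~R.
    by rewrite /w sE nE !(intrM, intrD); field.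
  by rewrite !sin_periodz; ring.
- have -> : w * (1 / 2) + q = (pi / (n%:R + 1) + q) + 2 * pi * j%:~R.
    by rewrite /w sE nE; field.
  have -> : w * (1 + n%:R / 2) + q =
      ((pi / (n%:R + 1) + q) + pi) + 2 * pi * (j * (2 + n%:Z))%:~R.
    by rewrite /w sE nE !(intrM, intrD); field.
  have -> : w * (1 / 2 + n%:R / 2) + q = (q + pi) + 2 * pi * (j * (1 + n%:Z))%:~R.
    by rewrite /w sE nE !(intrM, intrD); field.
  by rewrite !sin_periodz !sinDpi; ring.
- have -> : w * (1 / 2) + q = (- (pi / (n%:R + 1)) + q) + 2 * pi * j%:~R.
    by rewrite /w sE nE; field.
  have -> : w * (1 + n%:R / 2) + q =
      ((- (pi / (n%:R + 1)) + q) + pi) + 2 * pi * (j * (2 + n%:Z) - 1)%:~R.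
    by rewrite /w sE nE !(intrM, intrD, intrB); field.
  have -> : w * (1 / 2 + n%:R / 2) + q = (q + pi) + 2 * pi * (j * (1 + n%:Z) - 1)%:~R.
    by rewrite /w sE nE !(intrM, intrD, intrB); field.
  by rewrite !sin_periodz !sinDpi; ring.
Qed.

(* The frequencies [2 j] and [2 j + 1 / n.+1] span the functions [f] with
   [f (y + d) = f y] and [f (y + d) = - f y] respectively, where
   [d = n.+1 / 2] is the distance of the two intervals; on [Omega] every [f]
   is a sum of two such functions. *)
Lemma gabor_basis_half_integers n : (0 < n)%N ->
  orthonormal_basis [set l : R * R | half_integer_set n l.1 /\ half_frequency_set n l.2]
    (time_freq_shift (cindic (two_intervals (1 / 2) (n%:R / 2)))).
Proof.
move=> n0; have be0 : 0 < n%:R / 2 :> R by rewrite divr_gt0 ?ltr0n.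
have al0 : 0 < 1 / 2 :> R by rewrite divr_gt0.
have M0 : n%:R + 1 != 0 :> R by rewrite natr1.
have nE : n.+1%:R = n%:R + 1 :> R by rewrite natr1.
have nge0 : 0 <= n%:R :> R by [].
apply: (product_orthonormal_basis al0 (lexx _) be0).
- exact: exact_tiling_half_integers.
- exact: countable_half_integers.
- move=> _ _ [[j b] _ <-] [[k c] _ <-] /= jk.
  have E : 2 * j%:~R + b%:R / n.+1%:R - (2 * k%:~R + c%:R / n.+1%:R) =
      2 * (j - k)%:~R + (b%:R - c%:R) / n.+1%:R :> R by rewrite intrB; ring.
  rewrite E fourier_csq_half//; first by rewrite -E subr_eq0.
  by case: b c {E jk} => [] [] /=; rewrite ?subrr ?subr0 ?sub0r;
    [apply: Or31|apply: Or32|apply: Or33|apply: Or31].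
- move=> t _ f Lf; pose d : R := n.+1%:R / 2; pose nu : R := n.+1%:R^-1.
  have Lfd : L2 (fun y => f (y + d)) by exact: L2_shift.
  pose p y := (1 / 2)%:C%C * (f y + f (y + d)).
  pose h y := (1 / 2)%:C%C * (f y + (-1) * f (y + d)).
  (* The exponential cancels the modulation at [nu] on the first interval; on the second one
     [2 * pi * nu * d = pi] leaves the factor -1. So the two folded functions add up to [p + h] on
     the first interval, and to [p - h] read at [x - d] on the second; both equal [f]. *)
  pose k y := expi (- (2 * pi * nu) * y + 0) * h y.
  have Lp : L2 p by apply: L2Z; exact: L2D.
  have Lh : L2 h by apply: L2Z; apply: L2D => //; exact: L2Z.
  have Lk : L2 k.
    apply: (L2_le _ Lh) => [|y]; last by rewrite csqM csq_expi mul1r.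
    have [mh _] := Lh; apply: cmeasurableM => //.
    exact: bounded_measurableC_cmeasurable (bounded_measurable_expi _ _).
  have twoV : (1 / 2)^-1 = 2 :> R by rewrite div1r invrK.
  have up l : half_frequency_set n l -> half_frequency_set n (l + (1 / 2)^-1).
    move=> [[j b] _ <-]; exists (j + 1, b) => //=; rewrite intrD twoV; ring.
  have down l : half_frequency_set n l -> half_frequency_set n (l - (1 / 2)^-1).
    move=> [[j b] _ <-]; exists (j - 1, b) => //=; rewrite intrB twoV; ring.
  have S0 : half_frequency_set n 0.
    by exists (0, false) => //=; rewrite mulr0 mul0r addr0.
  have S1 : half_frequency_set n nu.
    by exists (0, true) => //=; rewrite mulr0 add0r mul1r.
  have dE : d = n.+1%:R * (1 / 2) by rewrite /d mulrA mulr1.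
  have [h1 h2] : d <= 1 / 2 + n%:R / 2 /\ 1 + n%:R / 2 - d <= 1 / 2.
    by rewrite /d nE; split; lra.
  have H := @approximable_folded R (1 / 2) (n%:R / 2) al0 (lexx _) be0 t (1 / 2) d
    n.+1 (half_frequency_set n) al0 (lexx _) dE h1 h2 up down.
  have mf v g : L2 g -> cmeasurable (folded (1 / 2) (n%:R / 2) t d v g).
    by move=> [mg _]; exact: cmeasurable_folded.
  have me l : cmeasurable (time_freq_shift (cindic (two_intervals (1 / 2) (n%:R / 2))) l : R -> R[i]).
    apply: bounded_supportedC_cmeasurable; apply: bounded_supported_gabor.
      exact: measurable_two_intervals.
    exact: (two_intervals_bounded al0 (lexx _) be0).
  have := approximableD me (mf _ _ Lp) (mf _ _ Lk) (H 0 p S0 Lp) (H nu k S1 Lk).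
  congr approximable; apply/funext => x.
  rewrite /folded /time_freq_shift /= mulr0 expi0 mulr1 /cindic indicE.
  have [|_] := boolP (x - t \in _); last by rewrite !mul0r addr0.
  have ? : d = 1 / 2 + n%:R / 2 by rewrite /d nE; lra.
  rewrite inE => /two_intervalsP/orP[/andP[? ?]|/andP[? ?]]; rewrite /fold.
    have -> : x < t + 1 / 2 by lra.
    rewrite !mul1r /k addr0 mulrA -expiD.
    have -> : 2 * pi * x * nu + - (2 * pi * nu) * x = 0 by ring.
    by rewrite expi0 mul1r /p /h; apply: complex_ext; rewrite !ReImE /=; field.
  have -> : (x < t + 1 / 2) = false by apply/negbTE; rewrite -leNgt; lra.
  rewrite !mul1r /k addr0 mulrA -expiD.
  have -> : 2 * pi * x * nu + - (2 * pi * nu) * (x - d) = pi.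
    by rewrite /nu /d nE; field.
  have -> : expi pi = -1 :> R[i] by apply: complex_ext; rewrite !ReImE /= ?cospi ?sinpi ?oppr0.
  by rewrite /p /h subrK; apply: complex_ext; rewrite !ReImE /=; field.
Qed.

Lemma discrete_set_product (T S : set R) (d d' : R) : 0 < d -> 0 < d' ->
  (forall t t', T t -> T t' -> `|t - t'| < d -> t = t') ->
  (forall t t', S t -> S t' -> `|t - t'| < d' -> t = t') ->
  discrete_set [set l : R * R | T l.1 /\ S l.2].
Proof.
move=> d0 d0' sT sS; have m0 : 0 < Num.min d d' by rewrite lt_min d0.
apply: (@discrete_set_separated R (R * R)%type _ _ m0).
move=> [t v] [t' v'] [/= Tt Sv] [/= Tt' Sv'] [].
rewrite /= -!ball_normE /ball_ /= => tt' vv'.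
have tE : t = t' by apply: sT => //; apply: (lt_le_trans tt'); rewrite ge_min lexx.
have vE : v = v'.
  by apply: sS => //; apply: (lt_le_trans vv'); rewrite ge_min lexx orbT.
by rewrite tE vE.
Qed.

(** For [n >= 1] the step [1 / n.+1] is at most [1 / 2], so it is the smallest distance, the pairs
    being 2 apart. *)
Lemma half_frequencies_separated n : (0 < n)%N -> forall l l' : R,
  half_frequency_set n l -> half_frequency_set n l' -> `|l - l'| < n.+1%:R^-1 -> l = l'.
Proof.
move=> n0 _ _ [[j b] _ <-] [[k c] _ <-] /=; set v := _^-1.
have v0 : 0 < v by rewrite invr_gt0.
have v2 : v <= 1 / 2 by rewrite /v div1r lef_pV2 ?posrE// ler_nat.
have [<-|] := eqVneq j k.
  case: b c => [] [] //=; rewrite ltr_norml => /andP[? ?]; lra.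
rewrite neq_lt -!lezD1 -!(ler_int R) !intrD ltr_norml.
by case: b c => [] [] /= /orP[] ? /andP[? ?]; lra.
Qed.

End ExplicitBases.

(** * Discreteness and countability of the product sets, and the equivalences *)

Lemma gabor_basis_of_natural_gap (R : realType) (al be : R) : 0 < al -> al <= 1 / 2 ->
  (exists n : nat, (0 < n)%N /\ be = n%:R) ->
  exists Lam : set (R * R), [/\ discrete_set Lam, countable Lam
    & orthonormal_basis Lam (time_freq_shift (cindic (two_intervals al be)))].
Proof.
move=> al0 al2 [n [n0 ->]].
exists [set l : R * R | integer_set l.1 /\ integer_set l.2]; split.
- have sep (t t' : R) : integer_set t -> integer_set t' -> `|t - t'| < 1 -> t = t'.
    by move=> [j _ <-] [k _ <-] /eq_intr_dist ->.
  exact: (discrete_set_product ltr01 ltr01 sep sep).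
- exact: (countableX countable_integers countable_integers).
- exact: gabor_basis_integers.
Qed.

Lemma gabor_basis_of_half_natural_gap (R : realType) (be : R) :
  (exists n : nat, (0 < n)%N /\ be = n%:R / 2) ->
  exists Lam : set (R * R), [/\ discrete_set Lam, countable Lam
    & orthonormal_basis Lam (time_freq_shift (cindic (two_intervals (1 / 2) be)))].
Proof.
move=> [n [n0 ->]].
exists [set l : R * R | half_integer_set n l.1 /\ half_frequency_set n l.2]; split.
- have [_ uT] := @exact_tiling_half_integers R n.
  have al0 : 0 < 1 / 2 :> R by rewrite divr_gt0.
  have be0 : 0 < n%:R / 2 :> R by rewrite divr_gt0 ?ltr0n.
  have v0 : 0 < n.+1%:R^-1 :> R by rewrite invr_gt0.
  exact: (discrete_set_product al0 v0 (tiling_separated al0 (lexx _) be0 uT)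
    (half_frequencies_separated n0)).
- exact: (countableX (countable_half_integers n) (countable_half_frequencies n)).
- exact: gabor_basis_half_integers.
Qed.

Theorem theorem4p6 (R : realType) (alpha beta : R)
    (hbeta : 0 < beta)
    (halpha : (0 < alpha /\ alpha < 1 / 2) \/
              (alpha = 1 / 2 /\ 1 / 2 <= beta)) :
  let Omega : set R := two_intervals alpha beta in
  let g : R -> R[i] := cindic Omega in
  ((exists Lambda : set (R * R),
      [/\ discrete_set Lambda, countable Lambda
        & orthonormal_basis Lambda (time_freq_shift g)])
   <-> tiles_line Omega)
  /\
  (tiles_line Omega <->
     ((0 < alpha /\ alpha < 1 / 2) /\
        exists n : nat, (0 < n)%N /\ beta = n%:R)
     \/
     (alpha = 1 / 2 /\
        exists n : nat, (0 < n)%N /\ beta = n%:R / 2)).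
Proof.
move=> Omega g; rewrite /g /Omega {g Omega}; set gap := _ \/ _.
have al0 : 0 < alpha by case: halpha => -[// -> _]; rewrite divr_gt0.
have al2 : alpha <= 1 / 2 by case: halpha => -[]; [move=> _ /ltW|move=> ->].
have gap_tiles : gap -> tiles_line (two_intervals alpha beta).
  move=> [[_ [n [_ bE]]]|[aE [n [_ bE]]]].
    apply: (exact_tiling_tiles_line al0 al2 hbeta); rewrite bE.
    exact: exact_tiling_integers.
  apply: (exact_tiling_tiles_line al0 al2 hbeta); rewrite aE bE.
  exact: exact_tiling_half_integers.
have tiles_gap : tiles_line (two_intervals alpha beta) -> gap.
  move=> [T _ /(tiling_exact al0 al2 hbeta) eT].
  case: halpha => [[_ al2']|[aE be2]]; [left|right]; split=> //.
    exact: exact_tiling_unequal eT.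
  by move: eT; rewrite aE; exact: exact_tiling_half.
(* Both equivalences pass through the arithmetic condition [gap]. *)
split; last by split.
split.
- move=> [Lam [_ cLam bLam]]; apply: gap_tiles.
  case: halpha => [[_ al2']|[aE be2]]; [left|right]; split=> //.
    exact: gabor_natural_gap bLam.
  by move: bLam; rewrite aE; exact: gabor_half_natural_gap.
- move=> /tiles_gap[[_ hn]|[aE hn]]; first exact: gabor_basis_of_natural_gap.
  by rewrite aE; exact: gabor_basis_of_half_natural_gap.
Qed.
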